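(* Let $(X^{n+1},g_+)$ be an asymptotically hyperbolic manifold and let $1<p<\infty$. Then the first $p$-Dirichlet eigenvalue of $(X^{n+1},g_+)$ satisfies $$\lambda_{1,p}(X)\le \left(\frac{n}{p}\right)^p.$$
   Context: Let $\overline{X}^{n+1}$ be a compact manifold with boundary $M=\partial\overline{X}$ and interior $X$. A defining function for $M$ is a function $r$ on $\overline{X}$ with $r>0$ on $X$, $r=0$ on $M$ and $dr\neq 0$ on $M$. A complete Riemannian metric $g_+$ on $X$ is conformally compact (CC) if, for a defining function $r$, $\overline{g}:=r^2g_+$ extends to a metric on $\overline{X}$; throughout, the extension is assumed to be of class $C^{3,\theta}(\overline{X})$ for a Hölder exponent $\theta\in(0,1)$. The sectional curvatures of a CC metric approach $-|dr|^2_{\overline g}$ at $M$, and $|dr|^2_{\overline g}|_M$ is independent of the choice of $r$. A CC manifold $(X^{n+1},g_+)$ is asymptotically hyperbolic (AH) if its asymptotic sectional curvatures at $M$ are equal to $-1$, equivalently $|dr|^2_{r^2g_+}=1$ on $M$ for any defining function $r$. For a bounded domain $\Omega\subset X$ with smooth boundary, $$\lambda_{1,p}(\Omega)=\inf_{f\in W^{1,p}_0(\Omega)\setminus\{0\}}\frac{\int_\Omega|\nabla_{g_+}f|^p\,dv_{g_+}}{\int_\Omega|f|^p\,dv_{g_+}},$$ where $W^{1,p}_0(\Omega)$ is the completion of $C^\infty_0(\Omega)$ in the Sobolev norm. The first $p$-Dirichlet eigenvalue of $(X,g_+)$ is $\lambda_{1,p}(X):=\inf_\Omega\lambda_{1,p}(\Omega)$,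 the infimum being over all bounded domains of $X$ with smooth boundary. *)

(* Defs.v *)
From HB Require Import structures.
From mathcomp Require Import all_boot all_order all_algebra.
From mathcomp Require Import all_classical all_reals all_analysis measurable_realfun.

Set Implicit Arguments.
Unset Strict Implicit.
Unset Printing Implicit Defensive.

Import Order.TTheory GRing.Theory Num.Theory.
Import numFieldNormedType.Exports.

Local Open Scope classical_set_scope.
Local Open Scope ring_scope.

Section Euclidean.
Context {R : realType} {N : nat}.
Implicit Types (U V : set 'rV[R]_N) (f F : 'rV[R]_N -> R) (k : nat).

Fixpoint Ck k U f : Prop :=
  if k is k'.+1 then
    (forall x, U x -> differentiable f x) /\
    (forall a : 'I_N, Ck k' U (fun x => 'D_(delta_mx 0 a) f x))
  else forall x, U x -> {for x, continuous f}.

Definition smooth U f := forall k, Ck k U f.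

Fixpoint Ckholder (theta : R) k U f : Prop :=
  if k is k'.+1 then
    (forall x, U x -> differentiable f x) /\
    (forall a : 'I_N, Ckholder theta k' U (fun x => 'D_(delta_mx 0 a) f x))
  else exists C : R, forall x y, U x -> U y ->
         `|f x - f y| <= C * (`|x - y| `^ theta).

(* Regularity up to the boundary: [U] is relatively open in the half-space, and
   near each of its points [f] is the restriction of a function of the given
   class on an open set of R^N. *)
Definition locally_extends (P : set 'rV[R]_N -> ('rV[R]_N -> R) -> Prop) U f :=
  forall x, U x -> exists V F,
    [/\ open V, V x, P V F & forall y, V y -> U y -> F y = f y].

(* Right partial derivatives: they make sense at every point of the half-space
   [0 <= x_0], and on functions which are C^1 up to the boundary they agree with
   the partial derivatives of any C^1 extension. *)
Definition rpartial f (a : 'I_N) (x : 'rV[R]_N) : R :=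
  lim (h^-1 * (f (x + h *: delta_mx 0 a) - f x) @[h --> 0^'+]).

Definition spd (A : 'M[R]_N) :=
  A^T = A /\ forall v : 'rV[R]_N, v != 0 -> 0 < (v *m A *m v^T) 0 0.

End Euclidean.

Definition halfspace (R : realType) (n : nat) : set 'rV[R]_n.+1 :=
  [set x | 0 <= x 0 0].

(* Integration with respect to Lebesgue measure on R^N of a nonnegative Borel
   function, as an iterated one-dimensional Lebesgue integral (Tonelli). *)
Fixpoint lebesgue_int (R : realType) (N : nat) :
    ('rV[R]_N -> \bar R) -> \bar R :=
  match N return ('rV[R]_N -> \bar R) -> \bar R with
  | 0 => fun f => f 0
  | N'.+1 => fun f =>
      (\int[@lebesgue_measure R]_t
         lebesgue_int (fun y : 'rV[R]_N' =>
           f (row_mx (const_mx t : 'rV[R]_1) y)))%E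
  end.

(* The dimension is n+1; the maps [cmap] and [cinv] are total, with arbitrary
   values off [cdom] and off its image. *)

Record chart (R : realType) (n : nat) (T : topologicalType) := Chart {
  cdom : set T ;
  cmap : T -> 'rV[R]_n.+1 ;
  cinv : 'rV[R]_n.+1 -> T
}.

Definition is_chart (R : realType) (n : nat) (T : topologicalType)
    (c : chart R n T) : Prop :=
  [/\ open (cdom c),
      exists V, open V /\ cmap c @` cdom c = V `&` @halfspace R n,
      {in cdom c, cancel (cmap c) (cinv c)},
      forall p, cdom c p -> {for p, continuous (cmap c)} &
      {within cmap c @` cdom c, continuous (cinv c)}].

Record bmanifold (R : realType) (n : nat) := BManifold {
  mspace :> ptopologicalType ;
  midx : Type ;
  mchart : midx -> chart R n mspace ;
  mhausdorff : hausdorff_space mspace ;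
  msecond_countable : @second_countable mspace ;
  mchartP : forall i, is_chart (mchart i) ;
  mcover : forall p, exists i, cdom (mchart i) p ;
  mtransition : forall i j (b : 'I_n.+1),
    locally_extends smooth
      (cmap (mchart i) @` (cdom (mchart i) `&` cdom (mchart j)))
      (fun y => cmap (mchart j) (cinv (mchart i) y) 0 b)
}.

Section Manifold.
Context {R : realType} {n : nat} (M : bmanifold R n).
Implicit Types (i j : midx M) (p q : M) (f r rho : M -> R) (U Omega : set M).

Local Notation dom i := (cdom (mchart i)).
Local Notation phi i := (cmap (mchart i)).
Local Notation psi i := (cinv (mchart i)).

Definition chart_at p : midx M := projT1 (cid (mcover p)).

Definition mboundary : set M := [set p | exists i, dom i p /\ phi i p 0 0 = 0].

Definition minterior : set M := ~` mboundary.

(* for [U] open *)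
Definition smooth_on U f :=
  forall i, locally_extends smooth (phi i @` (dom i `&` U)) (f \o psi i).

(* components of df at p in the chart i *)
Definition dcoord i f p : 'rV[R]_n.+1 :=
  \row_a rpartial (f \o psi i) a (phi i p).

Definition defining_function r : Prop :=
  [/\ smooth_on setT r,
      forall p, minterior p -> 0 < r p,
      forall q, mboundary q -> r q = 0 &
      forall i q, mboundary q -> dom i q -> dcoord i r q != 0].

(* A symmetric 2-tensor field is given by its matrix of components in each
   chart; only the values on the image of the chart matter. *)

Definition tensor2 := midx M -> 'rV[R]_n.+1 -> 'M[R]_n.+1.

Implicit Types g gbar : tensor2.

Definition tcomp g i p : 'M[R]_n.+1 := g i (phi i p).

(* Riemannian metric on the interior. The Jacobian matrix of the library acts
   on row vectors. *)
Definition riemannian_metric g : Prop :=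
  [/\ forall i p, minterior p -> dom i p -> spd (tcomp g i p),
      forall i j p, minterior p -> dom i p -> dom j p ->
        tcomp g i p =
          'J (phi j \o psi i) (phi i p) *m tcomp g j p
            *m ('J (phi j \o psi i) (phi i p))^T &
      forall i a b, locally_extends smooth (phi i @` (dom i `&` minterior))
        (fun y => g i y a b)].

(* norm of the tangent vector at p with components v in the chart i *)
Definition vnorm g i p (v : 'rV[R]_n.+1) : R :=
  Num.sqrt ((v *m tcomp g i p *m v^T) 0 0).

Definition gradient g i f p : 'rV[R]_n.+1 :=
  dcoord i f p *m invmx (tcomp g i p).

Definition gradnorm g f p : R :=
  vnorm g (chart_at p) p (gradient g (chart_at p) f p).

Definition dnorm2 g i f p : R :=
  (dcoord i f p *m invmx (tcomp g i p) *m (dcoord i f p)^T) 0 0.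

Definition C1_curve (gam : R -> M) : Prop :=
  forall t, 0 <= t <= 1 ->
    [/\ minterior (gam t), {for t, continuous gam} &
      forall i, dom i (gam t) ->
        (\forall s \near t, derivable (phi i \o gam) s 1) /\
        {for t, continuous (fun s => 'D_1 (phi i \o gam) s)}].

Definition curve_length g (gam : R -> M) : \bar R :=
  (\int[@lebesgue_measure R]_(t in (`[0%R, 1%R] : set R))
    (let i := chart_at (gam t) in
     vnorm g i (gam t) ('D_1 (phi i \o gam) t))%:E)%E.

(* A piecewise C^1 curve can be reparametrized to a C^1 curve of the same
   length, whose velocity vanishes at the corners. *)
Definition rdist g p q : \bar R :=
  ereal_inf [set curve_length g gam | gam in
    [set gam | [/\ C1_curve gam, gam 0 = p & gam 1 = q]]].

Definition complete_metric g : Prop :=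
  forall u : nat -> M, (forall k, minterior (u k)) ->
    (forall e : R, 0 < e -> exists K, forall k l, (K <= k)%N -> (K <= l)%N ->
      (rdist g (u k) (u l) < e%:E)%E) ->
    exists2 p, minterior p &
      forall e : R, 0 < e -> \forall k \near \oo, (rdist g (u k) p < e%:E)%E.

(* [gbar] extends r^2 g to a metric of class C^(3,theta) on the whole manifold.
   At boundary points the transformation law of [gbar] follows from the one
   in the interior by continuity. *)
Definition compactification (theta : R) g r gbar : Prop :=
  [/\ defining_function r,
      forall i p, minterior p -> dom i p ->
        tcomp gbar i p = r p ^+ 2 *: tcomp g i p,
      forall i p, dom i p -> spd (tcomp gbar i p) &
      forall i a b, locally_extends (Ckholder theta 3) (phi i @` dom i)
        (fun y => gbar i y a b)].

Definition conformally_compact (theta : R) g : Prop :=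
  [/\ compact [set: M], mboundary !=set0, riemannian_metric g,
      complete_metric g & exists r gbar, compactification theta g r gbar].

Definition asymptotically_hyperbolic (theta : R) g : Prop :=
  conformally_compact theta g /\
  forall r gbar, compactification theta g r gbar ->
    forall i q, mboundary q -> dom i q -> dnorm2 gbar i r q = 1.

(* The Riemannian volume measure: the unique Borel measure on the interior
   which is sqrt(det g) dx in every chart. It lives on the Borel sets of the
   whole manifold, but its values on the boundary are irrelevant. *)

Definition borel := g_sigma_algebraType (@open M).
HB.instance Definition _ := Measurable.on borel.

Definition riemannian_volume g (vol : {measure set borel -> \bar R}) : Prop :=
  forall i (h : borel -> \bar R), measurable_fun setT h ->
    (forall x, (0 <= h x)%E) ->
    (\int[vol]_(x in (dom i `&` minterior : set borel)) h x)%E =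
    lebesgue_int (fun y =>
      if y \in phi i @` (dom i `&` minterior)
      then (h (psi i y) * (Num.sqrt (\det (g i y)))%:E)%E else 0%E).

Definition smooth_bounded_domain g Omega : Prop :=
  [/\ Omega `<=` minterior,
      [/\ open Omega, Omega !=set0 & connected Omega],
      exists p (C : R), minterior p /\
        forall q, Omega q -> (rdist g p q <= C%:E)%E &
      forall p, minterior p -> (closure Omega `\` Omega) p ->
        exists V rho, [/\ open V, V p, smooth_on V rho,
          dcoord (chart_at p) rho p != 0 &
          Omega `&` V = [set q | V q /\ rho q < 0]]].

Definition test_function Omega f : Prop :=
  smooth_on minterior f /\
  exists K : set M, [/\ compact K, K `<=` Omega & forall p, ~ K p -> f p = 0].

Definition Lp_integral (vol : {measure set borel -> \bar R}) (p : R) Omega f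
    : \bar R :=
  (\int[vol]_(x in (Omega : set borel)) (`|f x| `^ p)%:E)%E.

Definition p_energy g (vol : {measure set borel -> \bar R}) (p : R) Omega f
    : \bar R :=
  (\int[vol]_(x in (Omega : set borel)) (gradnorm g f x `^ p)%:E)%E.

(* W_0^(1,p)(Omega) is the completion of the space of test functions in the
   Sobolev norm: its elements are represented by the Sobolev-Cauchy sequences of
   test functions. *)
Definition W1p0 g vol (p : R) Omega (u : nat -> M -> R) : Prop :=
  (forall k, test_function Omega (u k)) /\
  forall e : R, 0 < e -> exists K, forall k l, (K <= k)%N -> (K <= l)%N ->
    (Lp_integral vol p Omega (u k \- u l)%R +
     p_energy g vol p Omega (u k \- u l)%R < e%:E)%E.

(* [a] and [b] are the integrals of |grad f|^p and |f|^p for the element f of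
   W_0^(1,p)(Omega) represented by [u], and [b != 0] says that f is nonzero. *)
Definition lambda1_domain g vol (p : R) Omega : \bar R :=
  ereal_inf [set x | exists u (a b : R),
    [/\ W1p0 g vol p Omega u,
        p_energy g vol p Omega (u k) @[k --> \oo] --> a%:E,
        Lp_integral vol p Omega (u k) @[k --> \oo] --> b%:E,
        b != 0 & x = (a / b)%:E]].

Definition lambda1 g vol (p : R) : \bar R :=
  ereal_inf [set lambda1_domain g vol p Omega | Omega in
    smooth_bounded_domain g].

End Manifold.

(* Main.v *)
(* Near a boundary point [q], in a chart with [x_0 = 0] on the boundary, [r/x_0]
   tends to [c > 0] with [c^2 gbar^{00}(q) = 1].  Hence for small [x] the metric
   [g = gbar/r^2] satisfies, up to a factor [1 + eps],
   [|df|_g <= x_0 (|d_0 f| + K sum_j |d_j f|)] and [dv_g = w0 x_0^{-(n+1)} dx].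
   Take [f = x_0^{n/p}] on [d <= x_0 <= T] and [|x_j - q_j| <= s'], cut off
   smoothly outside.  Where no normal cut-off acts, [|df|_g^p] is nearly
   [(n/p)^p x_0^n]; both integrals are then dominated by
   [int_d^T dx_0 / x_0 = ln (T/d)], the two normal cut-offs contributing a
   quantity independent of [d].  So the Rayleigh quotient tends to [(n/p)^p] as
   [d -> 0] and then [eps -> 0]. *)
From HB Require Import structures.
Require Import Defs.
From mathcomp Require Import all_boot all_order all_algebra.
From mathcomp Require Import all_classical all_reals all_analysis measurable_realfun.
From mathcomp Require Import ring lra.

Set Implicit Arguments.
Unset Strict Implicit.
Unset Printing Implicit Defensive.

Import Order.TTheory GRing.Theory Num.Theory.
Import numFieldNormedType.Exports.

Local Open Scope classical_set_scope.
Local Open Scope ring_scope.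

(** * Functions of class C^k *)

(** The order of the choices carries the argument. For given [eps] the geometry near [q] provides
    [K] and [rho]. The lateral widths are [s = rho / 4] and [s' = (1 - eps) s], so the cubes seen by
    the numerator and the denominator differ only by the factor [(1 - eps)^n]. The height [T] is
    then so small that the lateral cut-offs, whose derivatives keep [x_0^(n/p)] and gain one more
    [x_0] from the metric, cost at most [eps]; only [d] is left to tend to 0. The normal cut-offs
    live on [[d/2, d]] and [[T, 2T]], where [|x_0 d_0 f|] is at most [x_0^(n/p)] times a constant
    independent of [d] and [T], and where [dx_0 / x_0] has mass [ln 2]. The infimum runs over
    connected bounded domains with smooth boundary, so the box supporting [f] is enclosed in a
    superellipsoid. The volume measure is known only through Borel integrands, while the energy
    density passes through an arbitrary choice of charts; hence every integral is compared with that
    of the weight [x_0^n] on a slab. *)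

Lemma near_eq_differentiable (K : numFieldType) (V W : normedModType K)
    (f g : V -> W) (x : V) :
  {near x, f =1 g} -> differentiable f x -> differentiable g x.
Proof.
move=> fg /diff_locallyP [cdf df].
have fgx : f x = g x by apply: nbhs_singleton fg.
have dg : g \o shift x = cst (g x) + 'd f x +o_ 0 id.
  apply/eqaddoP => e e0; have /eqaddoP/(_ e e0) := df.
  have {}fg : \forall h \near (0 : V), f (h + x) = g (h + x).
    by move: fg; rewrite (near_shift 0) subr0.
  apply: filterS2 fg => h fgh.
  by rewrite !fctE /= fgh fgx.
have dE := diff_unique cdf dg.
by apply/diff_locallyP; rewrite dE.
Unshelve. all: by end_near. Qed.

Section CkTheory.
Context {R : realType} {N : nat}.
Implicit Types (U V : set 'rV[R]_N) (f g : 'rV[R]_N -> R) (k : nat).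

Local Notation pd a f := (fun x => 'D_(delta_mx 0 a) f x).

Lemma open_eq_near U f g x :
  open U -> U x -> (forall y, U y -> f y = g y) -> {near x, f =1 g}.
Proof.
by move=> oU Ux fg; near=> y; apply: fg; near: y; apply: open_nbhs_nbhs.
Unshelve. all: by end_near. Qed.

Lemma Ck_ext k U f g : open U -> (forall y, U y -> f y = g y) ->
  Ck k U f -> Ck k U g.
Proof.
move=> oU; elim: k f g => [|k IH] f g fg /=.
  move=> cf x Ux; have nfg := open_eq_near oU Ux fg.
  by apply: cvg_trans (cvg_trans (near_eq_cvg nfg) _); rewrite -?fg//; apply: cf.
move=> [df cf]; split.
  by move=> x Ux; apply: near_eq_differentiable (df x Ux); apply: open_eq_near oU Ux fg.
move=> a; apply: IH (cf a) => y Uy.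
by apply: near_eq_derive; apply: open_eq_near oU Uy fg.
Qed.

Lemma Ck_sub k U V f : V `<=` U -> Ck k U f -> Ck k V f.
Proof.
move=> VU; elim: k f => [|k IH] f /=; first by move=> cf x /VU; apply: cf.
by move=> [df cf]; split=> [x /VU|a]; [apply: df|apply: IH].
Qed.

Lemma Ck_pred k U f : Ck k.+1 U f -> Ck k U f.
Proof.
elim: k f => [|k IH] f.
  by move=> [df _] x Ux; apply: differentiable_continuous; apply: df.
by move=> [df cf]; split=> // a; apply: IH; apply: cf.
Qed.

Lemma smooth_ext U f g : open U -> (forall y, U y -> f y = g y) ->
  smooth U f -> smooth U g.
Proof. by move=> oU fg sf k; apply: Ck_ext (sf k). Qed.

Lemma smooth_sub U V f : V `<=` U -> smooth U f -> smooth V f.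
Proof. by move=> VU sf k; apply: Ck_sub (sf k). Qed.

Lemma smooth_differentiable U f x : smooth U f -> U x -> differentiable f x.
Proof. by move=> /(_ 1%N) [+ _]; apply. Qed.

Lemma smooth_continuous U f x : smooth U f -> U x -> {for x, continuous f}.
Proof. by move=> /(_ 0%N); apply. Qed.

Lemma smooth_pd U f a : smooth U f -> smooth U (pd a f).
Proof. by move=> sf k; have [_] := sf k.+1; apply. Qed.

Lemma Ck_cst k U (c : R) : Ck k U (fun=> c).
Proof.
elim: k c => [|k IH] c /=; first by move=> x _; exact: (@cst_continuous _ _ c).
split=> [x _|a]; first by apply: differentiable_cst.
rewrite (_ : pd a _ = fun=> 0); first exact: IH.
 by apply/funext => x; exact: (@derive_cst _ _ _ c).
Qed.

Lemma derive_coord (x v : 'rV[R]_N) b : 'D_v (fun y : 'rV[R]_N => y 0 b) x = v 0 b.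
Proof.
apply: lim_near_cst => //; near=> h.
rewrite /= !mxE addrK /GRing.scale/= mulKf//.
by near: h; exact: nbhs_dnbhs_neq.
Unshelve. all: by end_near. Qed.

Lemma Ck_coord k U b : open U -> Ck k U (fun x => x 0 b).
Proof.
move=> oU; case: k => [|k] /=; first by move=> x _; apply: coord_continuous.
split=> [x _|a]; first exact: differentiable_coord.
have -> : pd a (fun x : 'rV[R]_N => x 0 b) = fun=> (delta_mx 0 a : 'rV[R]_N) 0 b.
  by apply/funext => x; rewrite derive_coord.
exact: Ck_cst.
Qed.

Lemma Ck_add k U f g : open U -> Ck k U f -> Ck k U g -> Ck k U (fun x => f x + g x).
Proof.
move=> oU; elim: k f g => [|k IH] f g /=.
  by move=> cf cg x Ux; exact: (cvgD (cf x Ux) (cg x Ux)).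
move=> [df cf] [dg cg]; split=> [x Ux|a].
  by apply: differentiableD; [apply: df|apply: dg].
apply: Ck_ext (IH _ _ (cf a) (cg a)) => // x Ux.
by rewrite deriveD//; apply: diff_derivable; [apply: df|apply: dg].
Qed.

Lemma Ck_mul k U f g : open U -> Ck k U f -> Ck k U g -> Ck k U (fun x => f x * g x).
Proof.
move=> oU; elim: k f g => [|k IH] f g.
  by move=> cf cg x Ux; exact: (cvgM (cf x Ux) (cg x Ux)).
move=> ckf ckg; have [df cf] := ckf; have [dg cg] := ckg; split=> [x Ux|a].
  by apply: differentiableM; [apply: df|apply: dg].
have fg' := IH _ _ (Ck_pred ckf) (cg a); have gf' := IH _ _ (Ck_pred ckg) (cf a).
apply: Ck_ext (Ck_add oU fg' gf') => // x Ux.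
rewrite (@deriveM _ _ f g)//.
- by apply: diff_derivable; apply: df.
- by apply: diff_derivable; apply: dg.
Qed.

Lemma Ck_sum k U (I : Type) (r : seq I) (F : I -> 'rV[R]_N -> R) : open U ->
  (forall i, Ck k U (F i)) -> Ck k U (fun x => \sum_(i <- r) F i x).
Proof.
move=> oU cF; elim: r => [|i r IH].
  by apply: Ck_ext (Ck_cst k U 0) => // y _; rewrite big_nil.
by apply: Ck_ext (Ck_add oU (cF i) IH) => // y _; rewrite big_cons.
Qed.

Lemma Ck_prod k U (I : Type) (r : seq I) (F : I -> 'rV[R]_N -> R) : open U ->
  (forall i, Ck k U (F i)) -> Ck k U (fun x => \prod_(i <- r) F i x).
Proof.
move=> oU cF; elim: r => [|i r IH].
  by apply: Ck_ext (Ck_cst k U 1) => // y _; rewrite big_nil.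
by apply: Ck_ext (Ck_mul oU (cF i) IH) => // y _; rewrite big_cons.
Qed.

Lemma derive_comp1 (V : normedModType R) (phi : R -> R) (f : V -> R) x v :
  differentiable f x -> derivable phi (f x) 1 ->
  'D_v (fun y => phi (f y)) x = 'D_1 phi (f x) * 'D_v f x.
Proof.
move=> df /derivable1_diffP dphi.
rewrite (@deriveE _ _ _ (phi \o f)); last exact: differentiable_comp.
rewrite diff_comp//= (deriveE _ df) deriveE//.
by rewrite -[X in 'd phi _ X]mulr1 [LHS]linearZ /= mulrC.
Qed.

(** The outer function comes with its tower of derivatives, so that the induction on [k], run for
    all [m] at once, can pass from [phi m] to [phi m.+1] when the chain rule is applied. *)
Lemma Ck_comp1 (phi : nat -> R -> R) (W : set R) k U f m : open U ->
  (forall m t, W t -> is_derive t 1 (phi m) (phi m.+1 t)) ->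
  (forall x, U x -> W (f x)) ->
  Ck k U f -> Ck k U (fun x => phi m (f x)).
Proof.
move=> oU dphi UW; elim: k m => [|k IH] m.
  move=> cf x Ux; apply: (@continuous_comp _ _ _ f (phi m)); first exact: cf.
  apply: differentiable_continuous; apply/derivable1_diffP.
  by have [] := dphi m _ (UW _ Ux).
move=> ckf; have [df cf] := ckf; split=> [x Ux|a].
  apply: (@differentiable_comp _ _ _ _ f (phi m)); first exact: df.
  by apply/derivable1_diffP; have [] := dphi m _ (UW _ Ux).
apply: Ck_ext (Ck_mul oU (IH m.+1 (Ck_pred ckf)) (cf a)) => // x Ux.
have [dm <-] := dphi m _ (UW _ Ux).
by rewrite (@derive_comp1 _ (phi m) f)//; exact: df.
Qed.

End CkTheory.

Section CkRow.
Context {R : realType} {N : nat}.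

Lemma differentiable_row (V : normedModType R) (T : V -> 'rV[R]_N) x :
  (forall b, differentiable (fun y => T y 0 b) x) -> differentiable T x.
Proof.
move=> dT; rewrite (_ : T = \sum_b (fun y => T y 0 b *: delta_mx 0 b)).
  by apply: differentiable_sum => b; apply: differentiableZl.
apply/funext => y; rewrite fct_sumE.
exact: row_sum_delta.
Qed.

Lemma continuous_row (X : topologicalType) (T : X -> 'rV[R]_N) x :
  (forall b, {for x, continuous (fun y => T y 0 b)}) -> {for x, continuous T}.
Proof.
move=> cT; rewrite (_ : T = fun y => \sum_b (T y 0 b *: delta_mx 0 b)).
  apply: (@cvg_big _ _ +%R 0 xpredT (@add_continuous _)) => b _.
  by apply: cvgZr_tmp; exact: cT.
by apply/funext => y; exact: row_sum_delta.
Qed.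

Lemma derive_comp_row (V : normedModType R) (F : 'rV[R]_N -> R) (T : V -> 'rV[R]_N) x v :
  differentiable T x -> differentiable F (T x) ->
  'D_v (fun y => F (T y)) x =
  \sum_b 'D_v (fun y => T y 0 b) x * 'D_(delta_mx 0 b) F (T x).
Proof.
move=> dT dF; rewrite (@deriveE _ _ _ (F \o T)); last exact: differentiable_comp.
rewrite diff_comp//= -(deriveE v dT) [X in 'd F _ X]row_sum_delta linear_sum /=.
apply: eq_bigr => b _; rewrite linearZ /= (deriveE _ dF); congr (_ * _).
by rewrite derive_mx ?mxE//; exact: diff_derivable.
Qed.
End CkRow.

Section CkComp.
Context {R : realType} {N N' : nat}.
Implicit Types (U : set 'rV[R]_N) (V : set 'rV[R]_N').

Lemma Ck_comp k U V (F : 'rV[R]_N' -> R) (T : 'rV[R]_N -> 'rV[R]_N') :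
  open U -> (forall x, U x -> V (T x)) ->
  (forall b, Ck k U (fun x => T x 0 b)) -> Ck k V F -> Ck k U (F \o T).
Proof.
move=> oU UV; elim: k F => [|k IH] F.
  move=> cT cF x Ux; apply: continuous_comp; last exact: cF (UV _ Ux).
  by apply: continuous_row => b; exact: cT.
move=> ckT [dF cF]; have dT x : U x -> differentiable T x.
  by move=> Ux; apply: differentiable_row => b; have [+ _] := ckT b; apply.
split=> [x Ux|a]; first by apply: differentiable_comp; [exact: dT|exact: dF (UV _ Ux)].
have ckT' b : Ck k U (fun x => T x 0 b) := Ck_pred (ckT b).
have cE b := Ck_mul oU ((ckT b).2 a) (IH _ ckT' (cF b)).
apply: Ck_ext (Ck_sum (index_enum _) oU cE) => // x Ux.
by rewrite (@derive_comp_row _ _ _ F T)//; [exact: dT|exact: dF (UV _ Ux)].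
Qed.

Lemma smooth_comp U V (F : 'rV[R]_N' -> R) (T : 'rV[R]_N -> 'rV[R]_N') :
  open U -> (forall x, U x -> V (T x)) ->
  (forall b, smooth U (fun x => T x 0 b)) -> smooth V F -> smooth U (F \o T).
Proof. by move=> oU UV sT sF k; apply: Ck_comp (sF k) => // b; apply: sT. Qed.
End CkComp.

(** * Smooth cut-off functions *)

Section FlatFunctions.
Context {R : realType}.
Implicit Types (P : {poly R}) (x t : R).

(** The functions [P(1/x) exp(-1/x)], extended by 0. Differentiation only replaces [P] by
    [X^2 (P - P')], so one computation of a first derivative, valid for every [P], gives smoothness
    across 0. *)
Definition flat P x : R := if 0 < x then P.[x^-1] * expR (- x^-1) else 0.

Definition flat_deriv P : {poly R} := 'X^2 * (P - P^`()).

Lemma flat_le0 P x : x <= 0 -> flat P x = 0.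
Proof. by move=> x0; rewrite /flat ltNge x0. Qed.

Lemma exprn_le_expR n t : 0 <= t -> t ^+ n <= n`!%:R * expR t.
Proof.
move=> t0; case: n => [|n].
  by rewrite expr0 fact0 mul1r (le_trans _ (expR_ge1Dx t))// lerDl.
rewrite mulrC -ler_pdivrMr ?ltr0n ?fact_gt0//.
by apply: le_trans (expR_ge1Dxn n t0); rewrite lerDr.
Qed.

Lemma poly_le_expR P : exists2 C, 0 < C & forall t, 0 <= t -> `|P.[t]| <= C * expR t.
Proof.
exists (1 + \sum_(i < size P) `|P`_i| * i`!%:R).
  by rewrite ltr_pwDl// sumr_ge0// => i _; rewrite mulr_ge0.
move=> t t0; rewrite horner_coef mulrDl mul1r mulr_suml.
apply: le_trans (ler_norm_sum _ _ _) _.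
rewrite -[leLHS]add0r lerD ?expR_ge0// ler_sum// => i _.
by rewrite normrM -mulrA ler_wpM2l// ger0_norm ?exprn_ge0// exprn_le_expR.
Qed.

Lemma is_derive_flat P x : is_derive x 1 (flat P) (flat (flat_deriv P) x).
Proof.
have [x0|x0|->] := ltgtP x 0.
- rewrite (flat_le0 _ (ltW x0)).
  have d0 : is_derive x 1 (cst (0 : R)) (0 : R) by exact: is_derive_cst.
  apply: near_eq_is_derive d0.
  near=> y; rewrite flat_le0//; apply/ltW.
  by near: y; exact: lt_nbhsl.
- have xN0 : x != 0 by rewrite gt_eqF.
  have dV : is_derive x 1 (fun y : R => y^-1) (- x ^- 2).
    have -> : - x ^- 2 = - x ^- 2 *: 1 by rewrite [RHS]mulr1.
    by apply: (@is_deriveV _ id).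
  have dP := @is_derive1_comp _ (horner P) _ x _ _ (is_derive_poly _ _) dV.
  have dE := @is_derive1_comp _ expR _ x _ _ (is_derive_expR _) (is_deriveN dV).
  have -> : flat (flat_deriv P) x =
      (horner P \o GRing.inv) x *: (expR (- x^-1) * - - x ^- 2) +
      (expR \o - GRing.inv) x *: (P^`().[x^-1] * - x ^- 2).
    rewrite /flat x0 /flat_deriv !hornerE /GRing.scale /=.
    have -> : (- GRing.inv) x = - x^-1 by [].
    by rewrite -exprVn; ring.
  apply: near_eq_is_derive (is_deriveM dP dE).
  by near=> y; rewrite /flat ifT//; near: y; exact: lt_nbhsr.
(* At 0 the quotient is [h^-1 P(h^-1) exp(-h^-1)]; bounding [X^2 P] by a multiple of the exponential
   leaves a factor [h], hence the limit 0. *)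
- have [C C0 PC] := poly_le_expR ('X^2 * P).
  suff c : h^-1 *: ((flat P \o shift 0) (h *: 1) - flat P 0) @[h --> 0^'] --> (0 : R).
    rewrite (flat_le0 _ (lexx 0)).
    by split; [apply: cvgP c|apply: cvg_lim c].
  apply/cvgrPdist_le => e e0; near=> h.
  have hN0 : h != 0 by near: h; exact: nbhs_dnbhs_neq.
  rewrite sub0r normrN /= addr0 [h *: 1]mulr1 (flat_le0 _ (lexx 0)) subr0 normrZ.
  have [h0|h0] := leP h 0; first by rewrite flat_le0// normr0 mulr0 ltW.
  rewrite /flat h0 normrM normfV (gtr0_norm h0) (gtr0_norm (expR_gt0 _)).
  have hV0 : 0 <= h^-1 by rewrite invr_ge0 ltW.
  have := PC _ hV0; rewrite !hornerE normrM normrX (ger0_norm hV0) => PCh.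
  rewrite -[leLHS]/(h^-1 * `|P.[h^-1]| * expR (- h^-1)) expRN.
  rewrite ler_pdivrMr ?expR_gt0//.
  have -> : h^-1 * `|P.[h^-1]| = h * (h^-1 ^+ 2 * `|P.[h^-1]|).
    by rewrite expr2 !mulrA mulfV// mul1r.
  apply: le_trans (ler_wpM2l (ltW h0) PCh) _.
  rewrite mulrA ler_wpM2r ?expR_ge0// -ler_pdivlMr// -(gtr0_norm h0).
  near: h; apply: dnbhs0_le; exact: divr_gt0.
Unshelve. all: by end_near. Qed.

Lemma flat1_ge0 x : 0 <= flat 1 x.
Proof. by rewrite /flat; case: ifP => // _; rewrite hornerE mul1r expR_ge0. Qed.

Lemma expRN1_le_flat1 x : 1 <= x -> expR (-1) <= flat 1 x.
Proof.
move=> x1; rewrite /flat (lt_le_trans ltr01 x1) hornerE mul1r ler_expR lerN2.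
by rewrite invf_le1// (lt_le_trans ltr01 x1).
Qed.

Lemma flat1_le_expRN1 x : x <= 1 -> flat 1 x <= expR (-1).
Proof.
move=> x1; rewrite /flat; case: ifP => [x0|_]; last exact: expR_ge0.
by rewrite hornerE mul1r ler_expR lerN2 -[leLHS]invr1 lef_pV2 ?posrE.
Qed.

(** [flat 'X^2] is the derivative of [flat 1]. The bound is [t^2 <= 2! exp t] at [t = x^-1]. *)
Lemma flatX2_bound x : 0 <= flat 'X^2 x <= 2.
Proof.
rewrite /flat; case: ifP => [x0|_]; last by rewrite lexx ler0n.
rewrite !hornerE; apply/andP; split; first by rewrite mulr_ge0 ?expR_ge0 ?exprn_ge0// invr_ge0 ltW.
rewrite expRN ler_pdivrMr ?expR_gt0//.
by apply: (@exprn_le_expR 2 x^-1); rewrite invr_ge0 ltW.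
Qed.

Lemma expR1N : expR 1 * expR (-1) = 1 :> R.
Proof. by rewrite -expRD subrr expR0. Qed.

End FlatFunctions.

(* [expR 1 * flat 1 (1 - x)] is [>= 1] for [x <= 0] and vanishes for [x >= 1].
   The definitions are locked because comparing instances of them by conversion
   would unfold the exponential series. *)
HB.lock Definition step {R : realType} (x : R) : R :=
  expR 1 * flat 1 (1 - expR 1 * flat 1 (1 - x)).

HB.lock Definition dstep {R : realType} (x : R) : R :=
  expR 1 ^+ 2 * (flat 'X^2 (1 - expR 1 * flat 1 (1 - x)) * flat 'X^2 (1 - x)).

(** Each of the two factors [flat 'X^2] in [dstep] is at most 2. *)
HB.lock Definition dstep_bound {R : realType} : R := expR 1 ^+ 2 * 4.

Section StepFunction.
Context {R : realType}.
Implicit Types (x : R).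

Lemma step_le0 x : x <= 0 -> step x = 0.
Proof.
move=> x0; rewrite step.unlock [X in _ * X]flat_le0 ?mulr0// subr_le0.
rewrite -[leLHS]expR1N ler_wpM2l ?expR_ge0// expRN1_le_flat1//; lra.
Qed.

Lemma step_ge1 x : 1 <= x -> step x = 1.
Proof.
move=> x1; rewrite step.unlock (@flat_le0 _ _ (1 - x)) ?subr_le0// mulr0 subr0.
by rewrite /flat ltr01 invr1 hornerC mul1r expR1N.
Qed.

Lemma step_itv x : 0 <= step x <= 1.
Proof.
rewrite step.unlock mulr_ge0 ?expR_ge0 ?flat1_ge0//= -[leRHS]expR1N.
by rewrite ler_wpM2l ?expR_ge0// flat1_le_expRN1// gerBl mulr_ge0 ?expR_ge0 ?flat1_ge0.
Qed.

Lemma dstep_le0 x : x <= 0 -> dstep x = 0.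
Proof.
move=> x0; rewrite dstep.unlock [X in X * flat _ (1 - x)]flat_le0.
  by rewrite mul0r mulr0.
rewrite subr_le0 -[leLHS]expR1N ler_wpM2l ?expR_ge0// expRN1_le_flat1//; lra.
Qed.

Lemma dstep_ge1 x : 1 <= x -> dstep x = 0.
Proof. by move=> x1; rewrite dstep.unlock (@flat_le0 _ 'X^2 (1 - x)) ?mulr0// subr_le0. Qed.

Lemma dstep_bound_ge0 : 0 <= dstep_bound :> R.
Proof. by rewrite dstep_bound.unlock mulr_ge0 ?exprn_ge0 ?expR_ge0. Qed.

Lemma dstep_le x : `|dstep x| <= dstep_bound.
Proof.
rewrite dstep.unlock dstep_bound.unlock; set y := 1 - _ * _.
have /andP[y0 y2] := flatX2_bound y; have /andP[x0 x2] := flatX2_bound (1 - x).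
rewrite ger0_norm ?mulr_ge0 ?exprn_ge0 ?expR_ge0//.
rewrite ler_wpM2l ?exprn_ge0 ?expR_ge0//.
by apply: le_trans (ler_pM y0 x0 y2 x2) _; lra.
Qed.

Lemma is_derive_step x : is_derive x 1 step (dstep x).
Proof.
rewrite step.unlock dstep.unlock.
have dX : flat_deriv 1 = 'X^2 :> {poly R} by rewrite /flat_deriv derivC subr0 mulr1.
have d1 : is_derive x 1 (cst 1 - id) (0 - 1 : R).
  exact: is_deriveB.
have := @is_derive1_comp _ (flat 1) _ x _ _ (is_derive_flat _ _) d1.
rewrite dX => d2.
have d3 : is_derive x 1 (cst 1 - expR 1 \*: (flat 1 \o (cst 1 - id)))
    (0 - expR 1 *: (flat 'X^2 (1 - x) * (0 - 1))).
  exact: is_deriveB.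
have := @is_derive1_comp _ (flat 1) _ x _ _ (is_derive_flat _ _) d3.
rewrite dX => d4.
have := @is_deriveZ _ _ _ _ (expR 1) _ _ _ d4.
rewrite (_ : _ *: _ =
  expR 1 ^+ 2 * (flat 'X^2 (1 - expR 1 * flat 1 (1 - x)) * flat 'X^2 (1 - x)))//.
rewrite /GRing.scale/=.
have -> : (cst 1 - expR 1 \*: (flat 1 \o (cst 1 - id))) x =
  1 - expR 1 * flat 1 (1 - x) by [].
by ring.
Qed.
End StepFunction.

Lemma smooth_step (R : realType) N (U : set 'rV[R]_N) (f : 'rV[R]_N -> R) : open U ->
  smooth U f -> smooth U (fun x => step (f x)).
Proof.
move=> oU sf k; rewrite step.unlock; have cst1 c := Ck_cst k U c.
have fl g : Ck k U g -> Ck k U (fun x => flat 1 (g x)).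
  move=> cg; apply: (Ck_comp1 (phi := fun m => flat (iter m flat_deriv 1)) (W := setT) 0%N) => //.
  by move=> m t _; exact: is_derive_flat.
have onem g c : Ck k U g -> Ck k U (fun x => 1 - c * g x).
  move=> cg; apply: (Ck_ext (f := fun x => 1 + (- c) * g x)) => //.
    by move=> y _; rewrite mulNr.
  by apply: Ck_add => //; exact: Ck_mul.
apply: Ck_mul => //; apply/fl/onem/fl.
by apply: Ck_ext (onem _ 1 (sf k)) => // y _; rewrite mul1r.
Qed.

Lemma smooth_powR (R : realType) N (U : set 'rV[R]_N) (f : 'rV[R]_N -> R) a : open U ->
  (forall x, U x -> 0 < f x) ->
  smooth U f -> smooth U (fun x => f x `^ a).
Proof.
move=> oU f0 sf k.
(* [phi m] is the [m]-th derivative of [t ^ a], a falling factorial of [a] being its coefficient. *)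
pose phi m (t : R) := (\prod_(i < m) (a - i%:R)) * t `^ (a - m%:R).
apply: (Ck_ext (f := fun x => phi 0%N (f x))) => //.
  by move=> y _; rewrite /phi big_ord0 mul1r subr0.
apply: (Ck_comp1 (phi := phi) 0%N (W := [set t | 0 < t])) => // m t /= t0.
have -> : phi m.+1 t = \prod_(i < m) (a - i%:R) *: ((a - m%:R) * t `^ (a - m%:R - 1)).
  rewrite /phi big_ord_recr /= -[RHS]/(_ * _) mulrA; congr (_ * _ `^ _).
  by rewrite -natr1; ring.
by apply: is_deriveZ; exact: is_derive1_powR.
Qed.

(** * One-variable profiles and the test function in coordinates *)

Section Profiles.
Context {R : realType}.
Variables (a d T s' s : R).
Hypotheses (a0 : 0 <= a) (d0 : 0 < d) (dT : d <= T) (s's : s' < s).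

(** The first argument of [step] goes from 0 to 1 as [t] goes from [d / 2] to [d], the second from 1
    to 0 as [t] goes from [T] to [2 * T]. *)
Definition radial (t : R) : R := t `^ a * (step (2 / d * t - 1) * step (2 - T^-1 * t)).

Definition lateral (u : R) : R := step ((s - u) / (s - s')) * step ((s + u) / (s - s')).

Let T0 : 0 < T. Proof. exact: lt_le_trans dT. Qed.
Let ss0 : 0 < s - s'. Proof. by rewrite subr_gt0. Qed.

Lemma mulr_itv01 (x y : R) : 0 <= x <= 1 -> 0 <= y <= 1 -> 0 <= x * y <= 1.
Proof.
by move=> /andP[x0 x1] /andP[y0 y1]; rewrite mulr_ge0//= mulr_ile1.
Qed.

Lemma radial_itv (t : R) : 0 <= radial t <= t `^ a.
Proof.
have /andP[m0 m1] := mulr_itv01 (step_itv (2 / d * t - 1)) (step_itv (2 - T^-1 * t)).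
by rewrite /radial mulr_ge0 ?powR_ge0//= ler_piMr ?powR_ge0.
Qed.

Lemma radial_mid (t : R) : d <= t <= T -> radial t = t `^ a.
Proof.
move=> /andP[dt tT]; rewrite /radial !step_ge1 ?mulr1//.
  have : T^-1 * t <= 1 by rewrite ler_pdivrMl// mulr1.
  by lra.
have : 1 <= d^-1 * t by rewrite ler_pdivlMl// mulr1.
by lra.
Qed.

Lemma radial_supp (t : R) : radial t != 0 -> d / 2 < t < 2 * T.
Proof.
apply: contraR; rewrite negb_and -!leNgt => /orP[td|tT]; rewrite /radial.
  rewrite [X in _ * (X * _)]step_le0 ?mul0r ?mulr0//.
  have : d^-1 * t <= 2^-1 by rewrite ler_pdivrMl.
  by lra.
rewrite [X in _ * (_ * X)]step_le0 ?mulr0//.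
have : 2 <= T^-1 * t by rewrite ler_pdivlMl// mulrC.
by lra.
Qed.

Definition dradial (t : R) : R :=
  a * t `^ (a - 1) * (step (2 / d * t - 1) * step (2 - T^-1 * t)) +
  t `^ a * (dstep (2 / d * t - 1) * (2 / d) * step (2 - T^-1 * t)
            - step (2 / d * t - 1) * (dstep (2 - T^-1 * t) * T^-1)).

Lemma is_derive_step_affine (b c t : R) :
  is_derive t 1 (fun u => step (b * u + c)) (dstep (b * t + c) * b).
Proof.
have d1 : is_derive t 1 (b \*: id + cst c) (b *: 1 + 0 : R) by exact: is_deriveD.
have := @is_derive1_comp _ step _ t _ _ (is_derive_step _) d1.
by rewrite addr0 [b *: 1]mulr1.
Qed.

Lemma is_derive_radial (t : R) : 0 < t -> is_derive t 1 radial (dradial t).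
Proof.
move=> t0.
have d1 := is_derive_step_affine (2 / d) (-1) t.
have d2 := is_derive_step_affine (- T^-1) 2 t.
have d3 := is_deriveM d1 d2.
have := is_deriveM (is_derive1_powR a t0) d3.
rewrite /GRing.scale /= => D.
have -> : radial = (fun u : R => u `^ a) * ((fun u => step (2 / d * u - 1))
  * (fun u => step (- T^-1 * u + 2))).
  by apply/funext => u; rewrite /radial !fctE mulNr [- _ + 2]addrC.
apply: (is_derive_eq D); rewrite /dradial /GRing.scale /= !fctE mulNr [- _ + 2]addrC.
by ring.
Qed.

Lemma dradial_mid (t : R) : d <= t <= T -> `|dradial t| <= a * t `^ (a - 1).
Proof.
move=> /andP[dt tT]; rewrite /dradial.
have dt1 : 1 <= d^-1 * t by rewrite ler_pdivlMl// mulr1.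
have tT1 : T^-1 * t <= 1 by rewrite ler_pdivrMl// mulr1.
rewrite !dstep_ge1 ?mul0r ?mulr0 ?subr0 ?mulr0 ?addr0; try lra.
have /andP[m0 m1] := mulr_itv01 (step_itv (2 / d * t - 1)) (step_itv (2 - T^-1 * t)).
by have h := mulr_ge0 a0 (powR_ge0 t (a - 1)); rewrite ger0_norm ?(mulr_ge0 h m0)// ler_piMr.
Qed.

(** The cut-offs are scale invariant: the derivative of the lower one has size [2 / d] but vanishes
    for [t > d], that of the upper one has size [T^-1] but vanishes for [t > 2 * T]. So [t] times
    either is at most [2 * dstep_bound], and the constant depends on neither [d] nor [T]. *)
Lemma dradial_le (t : R) : 0 < t -> `|dradial t| <= (a + 4 * dstep_bound) * t `^ (a - 1).
Proof.
move=> t0; rewrite /dradial.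
have /andP[x0 x1] := step_itv (2 / d * t - 1).
have /andP[y0 y1] := step_itv (2 - T^-1 * t).
have Dx := dstep_le (2 / d * t - 1); have Dy := dstep_le (2 - T^-1 * t).
have D0 := @dstep_bound_ge0 R.
have tE : t `^ a = t `^ (a - 1) * t.
  by rewrite -[X in _ * X]powRr1 ?ltW// -powRD ?subrK// (gt_eqF t0) implybT.
have /andP[m0 m1] := mulr_itv01 (step_itv (2 / d * t - 1)) (step_itv (2 - T^-1 * t)).
apply: le_trans (ler_normD _ _) _; rewrite [leRHS]mulrDl; apply: lerD.
  by have h := mulr_ge0 a0 (powR_ge0 t (a - 1)); rewrite ger0_norm ?(mulr_ge0 h m0)// ler_piMr.
rewrite tE -mulrA normrM ger0_norm ?powR_ge0// mulrC ler_wpM2r ?powR_ge0//.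
have dt0 : 0 <= d^-1 * t by rewrite mulr_ge0 ?invr_ge0 ?(ltW d0) ?(ltW T0) ?(ltW t0).
have Tt0 : 0 <= T^-1 * t by rewrite mulr_ge0 ?invr_ge0 ?(ltW d0) ?(ltW T0) ?(ltW t0).
have b1 : `|t * (dstep (2 / d * t - 1) * (2 / d) * step (2 - T^-1 * t))| <= 2 * dstep_bound.
  have [tl|tg] := leP t d; last first.
    rewrite dstep_ge1 ?mul0r ?mulr0 ?normr0 ?mulr_ge0//.
    have : 1 <= d^-1 * t by rewrite ler_pdivlMl// mulr1 ltW.
    by lra.
  have tl1 : d^-1 * t <= 1 by rewrite ler_pdivrMl// mulr1.
  have -> : t * (dstep (2 / d * t - 1) * (2 / d) * step (2 - T^-1 * t)) =
    (2 * (d^-1 * t) * step (2 - T^-1 * t)) * dstep (2 / d * t - 1) by ring.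
  have h : 0 <= 2 * (d^-1 * t) by rewrite mulr_ge0.
  rewrite normrM ler_pM// (ger0_norm (mulr_ge0 h y0)).
  by apply: le_trans (ler_piMr h y1) _; lra.
have b2 : `|t * (step (2 / d * t - 1) * (dstep (2 - T^-1 * t) * T^-1))| <= 2 * dstep_bound.
  have [tl|tg] := leP t (2 * T); last first.
    rewrite dstep_le0 ?mul0r ?mulr0 ?normr0 ?mulr_ge0//.
    have : 2 <= T^-1 * t by rewrite ler_pdivlMl// mulrC ltW.
    by lra.
  have tl1 : T^-1 * t <= 2 by rewrite ler_pdivrMl// mulrC.
  have -> : t * (step (2 / d * t - 1) * (dstep (2 - T^-1 * t) * T^-1)) =
    (T^-1 * t * step (2 / d * t - 1)) * dstep (2 - T^-1 * t) by ring.
  rewrite normrM ler_pM// (ger0_norm (mulr_ge0 Tt0 x0)).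
  exact: le_trans (ler_piMr Tt0 x1) tl1.
rewrite mulrBr; apply: le_trans (ler_normB _ _) _.
by apply: le_trans (lerD b1 b2) _; lra.
Qed.

Lemma lateral_itv (u : R) : 0 <= lateral u <= 1.
Proof. exact: mulr_itv01 (step_itv _) (step_itv _). Qed.

Lemma lateral_mid (u : R) : `|u| <= s' -> lateral u = 1.
Proof.
rewrite ler_norml => /andP[u1 u2]; rewrite /lateral !step_ge1 ?mulr1//.
  by rewrite ler_pdivlMr// mul1r; lra.
by rewrite ler_pdivlMr// mul1r; lra.
Qed.

Lemma lateral_supp (u : R) : lateral u != 0 -> `|u| < s.
Proof.
apply: contraR; rewrite -leNgt ler_normr => /orP[us|us]; rewrite /lateral.
  by rewrite step_le0 ?mul0r// pmulr_lle0 ?invr_gt0//; lra.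
by rewrite [X in _ * X]step_le0 ?mulr0// pmulr_lle0 ?invr_gt0//; lra.
Qed.

Definition dlateral (u : R) : R :=
  (s - s')^-1 * (step ((s - u) / (s - s')) * dstep ((s + u) / (s - s'))
    - dstep ((s - u) / (s - s')) * step ((s + u) / (s - s'))).

Lemma is_derive_lateral (u : R) : is_derive u 1 lateral (dlateral u).
Proof.
have d1 := is_derive_step_affine (- (s - s')^-1) (s / (s - s')) u.
have d2 := is_derive_step_affine ((s - s')^-1) (s / (s - s')) u.
have := is_deriveM d1 d2; rewrite /GRing.scale /= => D.
have E1 v : - (s - s')^-1 * v + s / (s - s') = (s - v) / (s - s') by ring.
have E2 v : (s - s')^-1 * v + s / (s - s') = (s + v) / (s - s') by ring.
have -> : lateral = (fun v => step (- (s - s')^-1 * v + s / (s - s')))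
   * (fun v => step ((s - s')^-1 * v + s / (s - s'))).
  by apply/funext => v; rewrite /lateral !fctE E1 E2.
apply: (is_derive_eq D); rewrite /dlateral E1 E2.
by ring.
Qed.

Lemma dlateral_le (u : R) : `|dlateral u| <= 2 * dstep_bound / (s - s').
Proof.
rewrite /dlateral normrM gtr0_norm ?invr_gt0// mulrC ler_wpM2r ?invr_ge0 ?(ltW ss0)//.
have /andP[x0 x1] := step_itv ((s - u) / (s - s')).
have /andP[y0 y1] := step_itv ((s + u) / (s - s')).
apply: le_trans (ler_normB _ _) _; rewrite (normrM (step _)) (normrM (dstep _)) (ger0_norm x0)
  (ger0_norm y0).
have := dstep_le ((s - u) / (s - s')); have := dstep_le ((s + u) / (s - s')).
set D1 := `|_|; set D2 := `|_| => h1 h2.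
have : step ((s - u) / (s - s')) * D1 <= D1 by rewrite ler_piMl// normr_ge0.
have : D2 * step ((s + u) / (s - s')) <= D2 by rewrite ler_piMr// normr_ge0.
by lra.
Qed.
End Profiles.

Lemma open_coord_gt (R : realType) N (b : 'I_N) (c : R) : open [set x : 'rV[R]_N | c < x 0 b].
Proof.
by apply: (@open_comp _ _ (fun x : 'rV[R]_N => x 0 b) [set y | c < y]) => [x _|];
  [exact: coord_continuous|exact: open_gt].
Qed.

Lemma open_coord_lt (R : realType) N (b : 'I_N) (c : R) : open [set x : 'rV[R]_N | x 0 b < c].
Proof.
by apply: (@open_comp _ _ (fun x : 'rV[R]_N => x 0 b) [set y | y < c]) => [x _|];
  [exact: coord_continuous|exact: open_lt].
Qed.

(** A directional derivative sees only the restriction to a line; for a product of functions of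
    single coordinates this restriction is a constant times one profile. *)
Lemma derive_line (R : realType) (V : normedModType R) (f : V -> R) (phi : R -> R) x v c u d :
  (forall h, f (h *: v + x) = c * phi (h + u)) -> is_derive u 1 phi d -> 'D_v f x = c * d.
Proof.
move=> fE [dphi <-].
transitivity ('D_1 (c \*: phi) u); last by rewrite deriveZ.
rewrite /derive (_ : (fun h => _) =
  fun h => h^-1 *: (((c \*: phi) \o shift u) (h *: 1) - (c \*: phi) u))//.
apply/funext => h /=; have := fE 0; rewrite scale0r !add0r => ->.
by rewrite fE [h *: 1]mulr1.
Qed.

Section Bump.
Context {R : realType} {n : nat}.
Variables (q : 'rV[R]_n.+1) (a d T s' s : R).
Hypotheses (a0 : 0 <= a) (d0 : 0 < d) (dT : d <= T) (s's : s' < s).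
Implicit Types (x : 'rV[R]_n.+1) (j : 'I_n).

Definition lbump x : R := \prod_(j < n) lateral s' s (x 0 (lift 0 j) - q 0 (lift 0 j)).

Definition bump x : R := radial a d T (x 0 0) * lbump x.

Lemma lbump_itv x : 0 <= lbump x <= 1.
Proof.
rewrite /lbump; elim/big_ind: _ => [|y z|j _]; first by rewrite ler01 lexx.
  exact: mulr_itv01.
exact: lateral_itv.
Qed.

Lemma bump_itv x : 0 <= bump x <= x 0 0 `^ a.
Proof.
have /andP[r0 r1] := radial_itv a d T (x 0 0); have /andP[l0 l1] := lbump_itv x.
by rewrite /bump mulr_ge0//= (le_trans _ r1)// ler_piMr.
Qed.

Lemma bump_mid x : d <= x 0 0 <= T ->
  (forall j, `|x 0 (lift 0 j) - q 0 (lift 0 j)| <= s') -> bump x = x 0 0 `^ a.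
Proof.
move=> xdT xs; rewrite /bump radial_mid// /lbump big1 ?mulr1// => j _.
exact: lateral_mid.
Qed.

Lemma bump_supp x : bump x != 0 ->
  d / 2 < x 0 0 < 2 * T /\ forall j, `|x 0 (lift 0 j) - q 0 (lift 0 j)| < s.
Proof.
rewrite /bump mulf_eq0 negb_or => /andP[/radial_supp -> // /prodf_neq0 lx].
by split=> // j; apply: (@lateral_supp _ s') => //; exact: lx.
Qed.

Lemma smooth_bump : smooth [set x | 0 < x 0 0] bump.
Proof.
have oU := @open_coord_gt R n.+1 0 0.
move: (oU); set U := [set _ | _] => {}oU k.
have aff (b : 'I_n.+1) (c e : R) : smooth U (fun x => c * x 0 b + e).
  by move=> l; apply: Ck_add => //; [apply: Ck_mul => //|];
    [exact: Ck_cst|exact: Ck_coord|exact: Ck_cst].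
apply: Ck_mul => //.
  apply: Ck_mul => //; first by apply: (smooth_powR (f := fun x => x 0 0)) => // l; exact: Ck_coord.
  apply: Ck_mul => //; first exact: (smooth_step oU (aff _ _ _)).
  apply: (Ck_ext (f := fun x => step (- T^-1 * x 0 0 + 2))) => //;
    last exact: (smooth_step oU (aff _ _ _)).
  by move=> y _; rewrite addrC mulNr.
apply: Ck_prod => // j; apply: Ck_mul => //.
  apply: (Ck_ext (f := fun x => step (- (s - s')^-1 * x 0 (lift 0 j) + (s + q 0 (lift 0 j)) /
    (s - s')))) => //.
    by move=> y _; congr step; ring.
  exact: (smooth_step oU (aff _ _ _)).
apply: (Ck_ext (f := fun x => step ((s - s')^-1 * x 0 (lift 0 j) + (s - q 0 (lift 0 j)) / (s -
  s')))) => //.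
  by move=> y _; congr step; ring.
exact: (smooth_step oU (aff _ _ _)).
Qed.

Lemma derive_bump0 x : 0 < x 0 0 ->
  'D_(delta_mx 0 0) bump x = lbump x * dradial a d T (x 0 0).
Proof.
move=> x0; apply: derive_line (is_derive_radial _ _ _ x0) => h.
rewrite /bump !mxE eqxx mulr1 mulrC; congr (_ * _).
by apply: eq_bigr => j _; rewrite !mxE /= mulr0 add0r.
Qed.

Lemma derive_bump_lift x j : 'D_(delta_mx 0 (lift 0 j)) bump x =
  radial a d T (x 0 0) * \prod_(k < n | k != j) lateral s' s (x 0 (lift 0 k) - q 0 (lift 0 k))
    * dlateral s' s (x 0 (lift 0 j) - q 0 (lift 0 j)).
Proof.
apply: derive_line (is_derive_lateral _ _ _) => h.
rewrite /bump !mxE /= mulr0 add0r -mulrA; congr (_ * _).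
rewrite /lbump (bigD1 j)//= mulrC; congr (_ * _); last first.
  by rewrite !mxE !eqxx mulr1 addrA.
apply: eq_bigr => k kj; rewrite !mxE eqxx /=.
by rewrite (inj_eq lift_inj) (negbTE kj) mulr0 add0r.
Qed.

Lemma derive_bump0_le x : 0 < x 0 0 ->
  `|'D_(delta_mx 0 0) bump x| <= (a + 4 * dstep_bound) * x 0 0 `^ (a - 1).
Proof.
move=> x0; rewrite derive_bump0// normrM; have /andP[l0 l1] := lbump_itv x.
by rewrite ger0_norm//; apply: le_trans (dradial_le a0 d0 dT x0); rewrite ler_piMl.
Qed.

Lemma derive_bump0_mid x : d <= x 0 0 <= T ->
  `|'D_(delta_mx 0 0) bump x| <= a * x 0 0 `^ (a - 1).
Proof.
move=> xdT; have x0 : 0 < x 0 0 by case/andP: xdT => + _; exact: lt_le_trans.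
rewrite derive_bump0// normrM; have /andP[l0 l1] := lbump_itv x.
by rewrite ger0_norm//; apply: le_trans (dradial_mid a0 d0 dT xdT); rewrite ler_piMl.
Qed.

(** The power of [x_0] is not lowered here, unlike in the normal derivative; after multiplication by
    the factor [x_0] of the metric this term is small near the boundary. *)
Lemma derive_bump_lift_le x j : `|'D_(delta_mx 0 (lift 0 j)) bump x| <=
  2 * dstep_bound / (s - s') * x 0 0 `^ a.
Proof.
rewrite derive_bump_lift normrM mulrC ler_pM//; first exact: dlateral_le.
have /andP[r0 r1] := radial_itv a d T (x 0 0).
have /andP[p0 p1] : 0 <= \prod_(k < n | k != j) lateral s' s (x 0 (lift 0 k) - q 0 (lift 0 k)) <= 1.
  elim/big_ind: _ => [|y z|k _]; first by rewrite ler01 lexx.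
    exact: mulr_itv01.
  exact: lateral_itv.
by rewrite (ger0_norm (mulr_ge0 r0 p0)); apply: le_trans r1; rewrite ler_piMr.
Qed.

End Bump.

(** * Superellipsoids *)

Section Superellipsoid.
Context {R : realType} {n : nat}.
Variables (m l : 'rV[R]_n.+1) (k : nat).
Hypotheses (l0 : forall a, 0 < l 0 a) (k0 : (0 < k)%N).
Implicit Types (x : 'rV[R]_n.+1).

(* For large [k] the convex set [superell < 1], whose boundary is smooth, fills
   the box [|x_a - m_a| < l_a], hence contains the support of the test function. *)
Definition superell x : R := \sum_a ((x 0 a - m 0 a) / l 0 a) ^+ k.*2.

Lemma expr_double_ge0 (t : R) : 0 <= t ^+ k.*2.
Proof. by rewrite -mul2n exprM exprn_ge0// sqr_ge0. Qed.

Lemma smooth_superell U : open U -> smooth U superell.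
Proof.
move=> oU j; apply: Ck_sum => // a.
apply: (Ck_ext (f := fun x => \prod_(i < k.*2) ((l 0 a)^-1 * (x 0 a + - m 0 a)))) => //.
  by move=> x _; rewrite prodr_const card_ord mulrC.
apply: Ck_prod => // i; apply: Ck_mul => //; first exact: Ck_cst.
by apply: Ck_add => //; [exact: Ck_coord|exact: Ck_cst].
Qed.

Lemma normr_le1_expr (t : R) : t ^+ k.*2 <= 1 -> `|t| <= 1.
Proof.
have E : t ^+ k.*2 = `|t| ^+ k.*2 by rewrite -normrX ger0_norm ?expr_double_ge0.
by rewrite E expr_le1// double_gt0.
Qed.

Lemma normr_lt1_expr (t : R) : t ^+ k.*2 < 1 -> `|t| < 1.
Proof.
have E : t ^+ k.*2 = `|t| ^+ k.*2 by rewrite -normrX ger0_norm ?expr_double_ge0.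
by rewrite E expr_lt1// double_gt0.
Qed.

Lemma superell_term x a : ((x 0 a - m 0 a) / l 0 a) ^+ k.*2 <= superell x.
Proof.
rewrite /superell (bigD1 a)//= lerDl sumr_ge0// => b _; exact: expr_double_ge0.
Qed.

Lemma superell_lt1 x a : superell x < 1 -> `|x 0 a - m 0 a| < l 0 a.
Proof.
move=> /(le_lt_trans (superell_term x a))/normr_lt1_expr.
by rewrite normrM normfV (gtr0_norm (l0 a)) ltr_pdivrMr// mul1r.
Qed.

Lemma superell_le1 x a : superell x <= 1 -> `|x 0 a - m 0 a| <= l 0 a.
Proof.
move=> /(le_trans (superell_term x a))/normr_le1_expr.
by rewrite normrM normfV (gtr0_norm (l0 a)) ler_pdivrMr// mul1r.
Qed.

Lemma superell_le x rho : 0 <= rho ->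
  (forall a, `|x 0 a - m 0 a| <= rho * l 0 a) -> superell x <= n.+1%:R * rho ^+ k.*2.
Proof.
move=> rho0 xrho; apply: le_trans (_ : \sum_(a < n.+1) rho ^+ k.*2 <= _).
  apply: ler_sum => a _.
  rewrite -[leLHS]ger0_norm ?expr_double_ge0// normrX lerXn2r ?nnegrE//.
  by rewrite normrM normfV (gtr0_norm (l0 a)) ler_pdivrMr.
by rewrite sumr_const card_ord mulr_natl.
Qed.

Lemma superell_scale x (t : R) : superell (m + t *: (x - m)) = t ^+ k.*2 * superell x.
Proof.
rewrite /superell mulr_sumr; apply: eq_bigr => a _.
by rewrite !mxE addrAC subrr add0r -mulrA exprMn.
Qed.

Lemma derive_superell x a : 'D_(delta_mx 0 a) superell x =
  (k.*2)%:R * ((x 0 a - m 0 a) / l 0 a) ^+ (k.*2).-1 / l 0 a.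
Proof.
pose rest := \sum_(b | b != a) ((x 0 b - m 0 b) / l 0 b) ^+ k.*2.
pose phi : R -> R := cst rest + ((l 0 a)^-1 \*: (id - cst (m 0 a))) ^+ k.*2.
have d1 : is_derive (x 0 a) 1 (id - cst (m 0 a) : R -> R) (1 - 0 : R) by exact: is_deriveB.
have d2 := @is_deriveX _ _ _ k.*2 _ _ _ (@is_deriveZ _ _ _ _ (l 0 a)^-1 _ _ _ d1).
have dphi : is_derive (x 0 a) 1 phi _ := is_deriveD (@is_derive_cst _ _ _ rest _ _) d2.
rewrite (@derive_line _ _ superell phi x _ 1 (x 0 a) _ _ dphi).
  have -> : ((l 0 a)^-1 \*: (id - cst (m 0 a) : R ->
    R)) (x 0 a) = (x 0 a - m 0 a) / l 0 a by exact: mulrC.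
  by rewrite mul1r add0r subr0 /GRing.scale /= mulr1.
move=> h; rewrite mul1r /superell (bigD1 a)//= addrC; congr (_ + _).
  apply: eq_bigr => b ba; rewrite !mxE (negbTE ba) andbF mulr0 add0r//.
rewrite !mxE !eqxx mulr1 mulrC.
by rewrite [RHS](_ : _ = ((l 0 a)^-1 * (h + x 0 a - m 0 a)) ^+ k.*2)// exprfctE.
Qed.

(** Every partial derivative is an odd power of [(x_a - m_a) / l_a] up to a nonzero factor, so the
    gradient vanishes only at the centre, where [superell] is 0. *)
Lemma superell_grad x : superell x = 1 -> exists a, 'D_(delta_mx 0 a) superell x != 0.
Proof.
move=> S1; apply: contrapT => /forallNP N.
have xm a : (x 0 a - m 0 a) / l 0 a = 0.
  have /negP := N a; rewrite negbK derive_superell !mulf_eq0 invr_eq0 (gt_eqF (l0 a)) orbF.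
  rewrite pnatr_eq0 double_eq0 (gtn_eqF k0) orFb => /eqP.
  by move/eqP; rewrite expf_eq0 => /andP[_] /eqP.
have := S1; rewrite /superell big1 ?[RHS]eqxx => [/eqP|a _]; first by rewrite eq_sym oner_eq0.
by rewrite xm expr0n double_eq0 (gtn_eqF k0).
Qed.

Lemma open_superell : open [set x | superell x < 1].
Proof.
apply: (@open_comp _ _ superell [set y | y < 1]); last exact: open_lt.
by move=> x _; apply: (smooth_continuous (@smooth_superell setT openT)).
Qed.

Lemma closed_superell : closed [set x | superell x <= 1].
Proof.
apply: (@closed_comp _ _ superell [set y | y <= 1]); last exact: closed_le.
by move=> x _; apply: (smooth_continuous (@smooth_superell setT openT)).
Qed.

Lemma compact_box (y c : 'rV[R]_n.+1) : compact [set x :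
  'rV[R]_n.+1 | forall a, `|x 0 a - y 0 a| <= c 0 a].
Proof.
have := @rV_compact R n.+1 (fun a => `[y 0 a - c 0 a,
  y 0 a + c 0 a]%classic) (fun a => @segment_compact _ _ _).
congr compact; apply/seteqP; split => x /= xc a; have := xc a;
  by rewrite /= in_itv/= ler_distl.
Qed.

Lemma compact_superell : compact [set x | superell x <= 1].
Proof.
apply: (subclosed_compact closed_superell (@compact_box m l)).
by move=> x /= Sx a; exact: superell_le1.
Qed.

Lemma superell_center : superell m = 0.
Proof.
rewrite /superell big1// => a _.
by rewrite subrr mul0r expr0n double_eq0 (gtn_eqF k0).
Qed.

Lemma superell_segment x (t : R) : 0 <= t <= 1 -> superell x < 1 ->
  superell (m + t *: (x - m)) < 1.
Proof.
move=> /andP[t0 t1] S1; rewrite superell_scale; apply: le_lt_trans S1.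
rewrite ler_piMl ?exprn_ile1// /superell sumr_ge0// => a _; exact: expr_double_ge0.
Qed.

(** The set is star-shaped about [m]: it is a union of segments through [m]. *)
Lemma connected_superell : connected [set x | superell x < 1].
Proof.
pose seg (x : 'rV[R]_n.+1) := (fun t : R => m + t *: (x - m)) @` `[0, 1].
have -> : [set x | superell x < 1] = \bigcup_(x in [set x | superell x < 1]) seg x.
  apply/seteqP; split => [x Sx|y [x Sx [t /= + <-]]].
    by exists x => //; exists 1; rewrite /= ?in_itv/= ?lexx ?ler01// scale1r addrC subrK.
  by rewrite in_itv /=; move=> t01; exact: superell_segment.
apply: bigcup_connected.
  exists m => x _; exists 0; first by rewrite /= in_itv/= lexx ler01.
  by rewrite scale0r addr0.
move=> x _; apply: connected_continuous_connected; first exact: segment_connected.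
apply: continuous_subspaceT => t; apply: cvgD; first exact: cvg_cst.
by apply: cvgZr_tmp; exact: cvg_id.
Qed.

End Superellipsoid.

Lemma exists_expr_lt1 (R : realType) (N : nat) (rho : R) : 0 <= rho < 1 ->
  exists2 k : nat, (0 < k)%N & N%:R * rho ^+ k.*2 < 1.
Proof.
move=> /andP[rho0 rho1].
have rho_cvg : (fun k => N%:R * rho ^+ k) @ \oo --> (0 : R).
  rewrite -[X in _ --> X](mulr0 N%:R); apply: cvgM; first exact: cvg_cst.
  by apply: cvg_expr; rewrite ger0_norm.
have : \forall k \near \oo, N%:R * rho ^+ k < 1.
  by apply: cvgr_lt rho_cvg _ _.
(* [K.+1] is positive and its double exceeds [K], the rank from which the limit bound holds. *)
move=> [K _ HK]; exists K.+1 => //; apply: HK => /=.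
by rewrite -addnn; apply: leq_trans (leq_addr _ _).
Qed.

(** * Charts and the invariance of the metric quantities *)

Lemma row_smooth_differentiable (R : realType) N N' (U : set 'rV[R]_N) (T : 'rV[R]_N ->
  'rV[R]_N') x :
  (forall b, smooth U (fun y => T y 0 b)) -> U x -> differentiable T x.
Proof.
by move=> sT Ux; apply: differentiable_row => b; exact: smooth_differentiable (sT b) Ux.
Qed.

(** The right partial derivative tests [f] only at [x] and on a short ray [x + h e_a] with [h > 0].
    Agreement with [F] there is enough, which covers interior and boundary points alike. *)
Lemma rpartial_ext (R : realType) N (f F : 'rV[R]_N -> R) a x :
  differentiable F x -> f x = F x ->
  (\forall h \near (0 : R)^'+, f (x + h *: delta_mx 0 a) = F (x + h *: delta_mx 0 a)) ->
  rpartial f a x = 'D_(delta_mx 0 a) F x.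
Proof.
move=> dF fx fF; apply: cvg_lim => //.
have c : h^-1 *: ((F \o shift x) (h *: delta_mx 0 a) - F x) @[h --> 0^'+] --> 'D_(delta_mx 0 a) F x.
  have /cvg_ex[l cl] := @diff_derivable _ _ _ F x (delta_mx 0 a) dF.
  have <- : l = 'D_(delta_mx 0 a) F x by apply/esym/cvg_lim.
  exact: cvg_dnbhs_at_right cl.
apply: cvg_trans c; apply: near_eq_cvg; near=> h.
rewrite /= [h *: _ + x]addrC fx; congr (_ * (_ - _)); apply/esym; near: h.
exact: fF.
Unshelve. all: by end_near. Qed.

Section ChartGeometry.
Context {R : realType} {n : nat} {M : bmanifold R n}.
Implicit Types (i j : midx M) (p q : M) (f : M -> R) (U O : set M).
Implicit Types (x y : 'rV[R]_n.+1) (B V : set 'rV[R]_n.+1) (F : 'rV[R]_n.+1 -> R).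

Local Notation dom i := (cdom (mchart i)).
Local Notation phi i := (cmap (mchart i)).
Local Notation psi i := (cinv (mchart i)).

Lemma chartK i p : dom i p -> psi i (phi i p) = p.
Proof. by move=> ip; have [_ _ K _ _] := mchartP i; apply: K; rewrite inE. Qed.

Lemma chart_image i x : (phi i @` dom i) x -> dom i (psi i x) /\ phi i (psi i x) = x.
Proof. by move=> [p ip <-]; rewrite chartK. Qed.

Lemma chart_ge0 i p : dom i p -> 0 <= phi i p 0 0.
Proof.
move=> ip; have [_ [V [_ E]] _ _ _] := mchartP i.
have : (phi i @` dom i) (phi i p) by exists p.
by rewrite E => -[].
Qed.

Lemma open_dom i : open (dom i).
Proof. by have [] := mchartP i. Qed.

Lemma interior_gt0 i p : minterior p -> dom i p -> 0 < phi i p 0 0.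
Proof.
move=> pint ip; rewrite lt_neqAle chart_ge0// andbT.
by apply/eqP => p0; apply: pint; exists i.
Qed.

Lemma open_chart_preimage i B : open B -> open [set p | dom i p /\ B (phi i p)].
Proof.
move=> oB; have [oD _ _ cphi _] := mchartP i.
by apply: (continuous_inP (phi i) oD).1 oB => p; rewrite inE => /cphi.
Qed.

(** [cinv] is continuous only within the image of the chart, hence the guard in the conclusion. *)
Lemma near_chart_inv j O p : open O -> O p -> dom j p ->
  \forall y \near phi j p, (phi j @` dom j) y -> O (psi j y).
Proof.
move=> oO Op jp; have [_ _ _ _ /subspace_continuousP cpsi] := mchartP j.
have im : (phi j @` dom j) (phi j p) by exists p.
have c : psi j @ within (phi j @` dom j) (nbhs (phi j p)) --> p.
  by rewrite -[X in _ --> X](chartK jp); exact: cpsi.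
apply: (c O).
exact: open_nbhs_nbhs.
Qed.

(** The image is relatively open in the half-space, so near its points membership reduces to the
    sign of [x_0]. *)
Lemma near_image i p : dom i p ->
  \forall y \near phi i p, 0 <= (y : 'rV[R]_n.+1) 0 0 -> (phi i @` dom i) y.
Proof.
move=> ip; have [_ [V [oV E]] _ _ _] := mchartP i.
have : (phi i @` dom i) (phi i p) by exists p.
rewrite E => -[Vp _]; near=> y => y0; split => //.
by near: y; exact: open_nbhs_nbhs.
Unshelve. all: by end_near. Qed.

Lemma near_gt0 x : 0 < x 0 0 -> \forall y \near x, 0 < (y : 'rV[R]_n.+1) 0 0.
Proof. by move=> x0; apply: open_nbhs_nbhs; split => //; exact: open_coord_gt. Qed.

(** [mtransition] extends each component on a neighbourhood of its own. These finitely many sets are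
    intersected, and shrunk once more so that image points of chart [i] stay over the domain of
    [j]. *)
Lemma transition_extension i j p : dom i p -> dom j p ->
  exists V (T : 'rV[R]_n.+1 -> 'rV[R]_n.+1), [/\ open V, V (phi i p),
    (forall b, smooth V (fun y => T y 0 b)) &
    forall y, V y -> (phi i @` dom i) y -> dom j (psi i y) /\ phi j (psi i y) = T y].
Proof.
move=> ip jp.
have im : (phi i @` (dom i `&` dom j)) (phi i p) by exists p.
have /choice[VF VFP] b : exists VF : set 'rV[R]_n.+1 * ('rV[R]_n.+1 -> R),
    [/\ open VF.1, VF.1 (phi i p), smooth VF.1 VF.2 &
     forall y, VF.1 y -> (phi i @` (dom i `&` dom j)) y -> VF.2 y = phi j (psi i y) 0 b].
  by have [V [F [oV Vp sF E]]] := @mtransition _ _ M i j b _ im; exists (V, F).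
pose W := [set y | (forall b, (VF b).1 y) /\ ((phi i @` dom i) y -> dom j (psi i y))].
have nW : nbhs (phi i p) W.
  have n1 : nbhs (phi i p) [set y | forall b, (VF b).1 y].
    apply: (@filter_forall _ _ (fun b => (VF b).1) (nbhs (phi i p)) _) => b.
    by apply: open_nbhs_nbhs; split; have [] := VFP b.
  have n2 := near_chart_inv (open_dom j) jp ip.
  by near=> y; split; near: y.
exists (interior W), (fun y => \row_b (VF b).2 y); split => //.
- exact: open_interior.
- move=> b; have [_ _ s _] := VFP b.
  apply: (smooth_ext (f := (VF b).2)); first exact: open_interior.
    by move=> y _; rewrite mxE.
  by apply: smooth_sub s => y /interior_subset [].
- move=> y /interior_subset [Wy1 Wy2] iy; have jy := Wy2 iy; split => //.
  apply/rowP => b; rewrite mxE; have [_ _ _ ->//] := VFP b.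
  have [iy' E] := chart_image iy.
  by exists (psi i y).
Unshelve. all: by end_near. Qed.

Lemma smooth_on_local U f : (forall p, U p -> exists O f', [/\ open O, O p,
    smooth_on O f' & forall q, O q -> f q = f' q]) -> smooth_on U f.
Proof.
move=> loc i _ [p [ip Up] <-].
have [W0 [f' [oO Op sf' ff']]] := loc p Up.
have [|V [F [oV Vp sF E]]] := sf' i (phi i p); first by exists p.
have nO := near_chart_inv oO Op ip.
pose W := [set y | (phi i @` dom i) y -> W0 (psi i y)].
exists (V `&` interior W), F; split.
- by apply: openI => //; exact: open_interior.
- by split.
- by apply: smooth_sub sF => y [].
- move=> y [Vy /interior_subset Wy] [q' [iq' Uq'] qy].
  have Oq' : W0 q' by rewrite -(chartK iq') qy; apply: Wy; exists q'.
  rewrite (E y Vy); last by exists q'.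
  by rewrite /= -qy chartK// ff'.
Qed.

Lemma smooth_on_cst U (c : R) : smooth_on U (fun=> c).
Proof.
move=> i x _; exists setT, (fun=> c); split => //; first exact: openT.
by move=> k; exact: Ck_cst.
Qed.

(** In another chart the function becomes [F \o T], with [T] the smooth extension of the transition
    map. *)
Lemma smooth_on_chart i B F : open B -> smooth B F ->
  smooth_on [set p | dom i p /\ B (phi i p)] (F \o phi i).
Proof.
move=> oB sF j _ [p [jp [ip Bp]] <-].
have [V [T [oV Vp sT E]]] := transition_extension jp ip.
have dT y : V y -> differentiable T y by exact: row_smooth_differentiable.
have imj : (phi j @` dom j) (phi j p) by exists p.
have [_ Tp] := E _ Vp imj; rewrite chartK// in Tp.
have oVT : open (V `&` T @^-1` B).
  by apply: (continuous_inP T oV).1 oB => y; rewrite inE => /dT/differentiable_continuous.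
exists (V `&` T @^-1` B), (F \o T); split.
- exact: oVT.
- by split => //=; rewrite -Tp.
- apply: smooth_comp sF; last 1 first.
  + by move=> b; apply: smooth_sub (sT b) => y [].
  + exact: oVT.
  + by move=> y [].
- move=> y [Vy _] [q' [jq' [iq' Bq']] qy].
  have [|_ Ty] := E y Vy; first by exists q'.
  by rewrite /= Ty.
Qed.

End ChartGeometry.

Section MatrixForms.
Context {R : realType} {N : nat}.
Implicit Types (A J : 'M[R]_N) (v d : 'rV[R]_N).

Lemma spd_unitmx A : spd A -> A \in unitmx.
Proof.
move=> [_ pos]; rewrite -row_free_unit -kermx_eq0; apply/rowV0P => v /sub_kermxP vA.
apply/eqP; apply/negP => /negP/pos.
by rewrite vA mul0mx mxE ltxx.
Qed.

(** The metric norm of the gradient is the dual norm of the differential. *)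
Lemma dual_form A d : A^T = A -> A \in unitmx ->
  (d *m invmx A) *m A *m (d *m invmx A)^T = d *m invmx A *m d^T.
Proof.
by move=> symA uA; rewrite mulmxKV// trmx_mul trmx_inv symA mulmxA.
Qed.

(** Covectors change by [J^T] and the metric by [J A J^T]; the identity [J^T (J A J^T)^-1 J = A^-1]
    makes the dual norm independent of the chart. *)
Lemma dual_form_change A J d : A \in unitmx -> J \in unitmx ->
  (d *m J^T) *m invmx (J *m A *m J^T) *m (d *m J^T)^T = d *m invmx A *m d^T.
Proof.
move=> uA uJ; have uJT : J^T \in unitmx by rewrite unitmx_tr.
have uG : J *m A *m J^T \in unitmx by rewrite !unitmx_mul uJ uA uJT.
suff E : J^T *m invmx (J *m A *m J^T) *m J = invmx A.
  by rewrite -E trmx_mul trmxK !mulmxA.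
apply: (can_inj (mulmxK uA)); rewrite mulVmx//.
apply: (can_inj (mulmxK uJT)); rewrite mul1mx -!mulmxA.
by rewrite mulVmx ?mulmx1// mulmxA.
Qed.

End MatrixForms.

Section IntegralMonotone.
Import HBNNSimple.

(** The integral of a nonnegative function is a supremum over the simple functions below it, a
    family that grows with the function. It is applied to speeds and gradient norms, which involve
    the arbitrary [chart_at] and for which no measurability is established. *)
Lemma ge0_le_integral_nomeas d (X : measurableType d) (R : realType) (mu : {measure set X ->
  \bar R})
    (D : set X) (f1 f2 : X -> \bar R) :
  (forall x, D x -> (0 <= f1 x)%E) -> (forall x, D x -> (f1 x <= f2 x)%E) ->
  (\int[mu]_(x in D) f1 x <= \int[mu]_(x in D) f2 x)%E.
Proof.
move=> f10 f12; have f20 x : D x -> (0 <= f2 x)%E.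
  by move=> Dx; exact: le_trans (f10 x Dx) (f12 x Dx).
rewrite !ge0_integralE//; apply: ereal_sup_le => _ [h hf <-].
exists h => // x.
apply: le_trans (hf x) _; rewrite /patch; case: ifPn => //; rewrite inE; exact: f12.
Qed.

End IntegralMonotone.

Lemma jacobianE (R : realType) N N' (T : 'rV[R]_N ->
  'rV[R]_N') (y : 'rV[R]_N) a b : differentiable T y ->
  ('J T y) a b = 'D_(delta_mx 0 a) (fun z => T z 0 b) y.
Proof.
move=> dT; have := deriveEjacobian (delta_mx 0 a) dT.
move=> /(congr1 (fun w : 'rV_N' => w 0 b)); rewrite -rowE mxE => <-.
by rewrite derive_mx ?mxE//; exact: diff_derivable.
Qed.

Section MetricGeometry.
Context {R : realType} {n : nat} {M : bmanifold R n}.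
Implicit Types (i j : midx M) (p q : M) (f : M -> R) (g : tensor2 M).
Implicit Types (x y v : 'rV[R]_n.+1).

Local Notation dom i := (cdom (mchart i)).
Local Notation phi i := (cmap (mchart i)).
Local Notation psi i := (cinv (mchart i)).
Local Notation e a := (delta_mx 0 a : 'rV[R]_n.+1).

Lemma chart_atP p : dom (chart_at p) p.
Proof. exact: projT2 (cid (mcover p)). Qed.

Lemma transition_differentiable i j p : dom i p -> dom j p -> 0 < phi i p 0 0 ->
  differentiable (phi j \o psi i) (phi i p).
Proof.
move=> ip jp p0; have [V [T [oV Vp sT E]]] := transition_extension ip jp.
apply: (near_eq_differentiable (f := T)); last exact: row_smooth_differentiable Vp.
have n1 := near_gt0 p0; have n2 := near_image ip.
near=> y; have y0 : 0 < (y : 'rV[R]_n.+1) 0 0 by near: y.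
have iy : (phi i @` dom i) y by apply: (near n2) => //; exact: ltW.
have Vy : V y by near: y; exact: open_nbhs_nbhs.
by have [_ /= ->] := E y Vy iy.
Unshelve. all: by end_near. Qed.

Lemma dcoordE i p f : differentiable (f \o psi i) (phi i p) ->
  dcoord i f p = \row_a 'D_(e a) (f \o psi i) (phi i p).
Proof.
move=> df; apply/rowP => a; rewrite !mxE.
by apply: rpartial_ext => //; near=> h.
Unshelve. all: by end_near. Qed.

Lemma near_transition i j p f : dom i p -> dom j p -> 0 < phi j p 0 0 ->
  \forall y \near phi j p, ((f \o psi i) \o (phi i \o psi j)) y = (f \o psi j) y.
Proof.
move=> ip jp pj0.
have n1 := near_gt0 pj0; have n2 := near_image jp; have n3 := near_chart_inv (open_dom i) ip jp.
near=> y; have y0 : 0 < (y : 'rV[R]_n.+1) 0 0 by near: y.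
have jy : (phi j @` dom j) y by apply: (near n2) => //; exact: ltW.
have iy : dom i (psi j y) by apply: (near n3).
by rewrite /= chartK.
Unshelve. all: by end_near. Qed.

Lemma dcoord_change i j p f : dom i p -> dom j p -> minterior p ->
  differentiable (f \o psi i) (phi i p) ->
  dcoord j f p = dcoord i f p *m ('J (phi i \o psi j) (phi j p))^T.
Proof.
move=> ip jp pint df.
have pj0 := interior_gt0 pint jp.
have dT := transition_differentiable jp ip pj0.
have TE : (phi i \o psi j) (phi j p) = phi i p by rewrite /= chartK.
have nE := near_transition f ip jp pj0.
have dfT : differentiable (f \o psi i) ((phi i \o psi j) (phi j p)) by rewrite TE.
have dF := differentiable_comp dT dfT.
rewrite (dcoordE df) dcoordE; last exact: near_eq_differentiable nE dF.
apply/rowP => a; rewrite mxE [RHS]mxE -(near_eq_derive _ nE).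
rewrite (@derive_comp_row _ _ _ (f \o psi i) (phi i \o psi j) _ _ dT dfT).
by apply: eq_bigr => b _; rewrite mxE [_^T _ _]mxE (jacobianE _ _ dT) TE mulrC.
Qed.

Section Invariance.
Variable g : tensor2 M.
Hypothesis gR : riemannian_metric g.

Lemma metric_unitmx i p : dom i p -> minterior p -> tcomp g i p \in unitmx.
Proof. by move=> ip pint; have [gpos _ _] := gR; apply: spd_unitmx; exact: gpos. Qed.

(** The transformation law writes the invertible matrix of [g] in chart [i] as a product having the
    Jacobian as a factor. *)
Lemma jacobian_unitmx i j p : dom i p -> dom j p -> minterior p ->
  'J (phi j \o psi i) (phi i p) \in unitmx.
Proof.
move=> ip jp pint; have [_ gtr _] := gR; have := metric_unitmx ip pint.
by rewrite (gtr i j p pint ip jp) !unitmx_mul => /andP[/andP[]].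
Qed.

(** [gradnorm] is defined through [chart_at p]; by invariance it can be computed in any chart around
    [p]. *)
Lemma gradnorm_coord i p f : dom i p -> minterior p ->
  differentiable (f \o psi i) (phi i p) ->
  gradnorm g f p =
    Num.sqrt ((dcoord i f p *m invmx (tcomp g i p) *m (dcoord i f p)^T) 0 0).
Proof.
move=> ip pint df; have [gpos gtr _] := gR; set j := chart_at p.
have jp : dom j p by exact: chart_atP.
have [symG _] := gpos _ _ pint jp.
rewrite /gradnorm -/j /vnorm /gradient dual_form//; last exact: metric_unitmx.
rewrite (dcoord_change ip jp pint df) (gtr j i p pint jp ip) dual_form_change//.
  exact: metric_unitmx.
exact: jacobian_unitmx.
Qed.

(** The smoothness condition on the boundary of a domain is stated in [chart_at p], while the
    gradient is computed in the working chart. *)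
Lemma dcoord_neq0 i j p f : dom i p -> dom j p -> minterior p ->
  differentiable (f \o psi i) (phi i p) -> dcoord i f p != 0 -> dcoord j f p != 0.
Proof.
move=> ip jp pint df; apply: contra => /eqP j0; apply/eqP.
have uJ : ('J (phi i \o psi j) (phi j p))^T \in unitmx by rewrite unitmx_tr; exact: jacobian_unitmx.
by apply: (can_inj (mulmxK uJ)); rewrite -dcoord_change// j0 mul0mx.
Qed.

Lemma vnorm_change i j p v : dom i p -> dom j p -> minterior p ->
  vnorm g j p (v *m 'J (phi j \o psi i) (phi i p)) = vnorm g i p v.
Proof.
move=> ip jp pint; have [_ gtr _] := gR.
by rewrite /vnorm (gtr i j p pint ip jp) trmx_mul !mulmxA.
Qed.

End Invariance.
End MetricGeometry.

(** Right difference quotients at a local minimum are nonnegative; [derive_eq0_min] adds the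
    direction [-v]. Both serve at zeros of nonnegative functions: [r] and the bump. *)
Lemma derive_ge0_min (R : realType) (V : normedModType R) (f : V -> R) x v :
  differentiable f x -> (\forall y \near x, f x <= f y) -> 0 <= 'D_v f x.
Proof.
move=> df fmin.
have c : h^-1 *: ((f \o shift x) (h *: v) - f x) @[h --> 0^'+] --> 'D_v f x.
  by apply: cvg_dnbhs_at_right; exact: diff_derivable.
rewrite -(cvg_lim _ c)//; apply: limr_ge; first by apply: cvgP c.
have cv : (fun h : R => h *: v + x) @ 0^'+ --> x.
  apply: cvg_at_right_filter.
  have c0 : h *: v + x @[h --> (0 : R)] --> 0 *: v + x.
    by apply: cvgD; [apply: cvgZr_tmp; exact: cvg_id|exact: cvg_cst].
  by rewrite scale0r add0r in c0.
near=> h; apply: mulr_ge0; first by rewrite invr_ge0 ltW//; near: h; exact: nbhs_right_gt.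
rewrite subr_ge0 /=; near: h; exact: (cv _ fmin).
Unshelve. all: by end_near. Qed.

Lemma derive_eq0_min (R : realType) (V : normedModType R) (f : V -> R) x v :
  differentiable f x -> (\forall y \near x, f x <= f y) -> 'D_v f x = 0.
Proof.
move=> df fmin; apply/eqP; rewrite eq_le derive_ge0_min// andbT.
by rewrite -oppr_ge0 deriveE// -linearN -deriveE// derive_ge0_min.
Qed.

(** * Interior points seen in a chart, and lengths of coordinate segments *)

Section Interior.
Context {R : realType} {n : nat} {M : bmanifold R n}.
Implicit Types (i j : midx M) (p q : M) (r : M -> R).

Local Notation dom i := (cdom (mchart i)).
Local Notation phi i := (cmap (mchart i)).
Local Notation psi i := (cinv (mchart i)).

Lemma defining_ge0 r p : defining_function r -> 0 <= r p.
Proof.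
move=> [_ rpos rzero _]; have [pb|pint] := pselect (mboundary p); first by rewrite rzero.
by rewrite ltW// rpos.
Qed.

(* At a boundary point with [phi i p 0 0 > 0], the function [r >= 0] would have
   an interior minimum in the chart [i], contradicting [dr <> 0]. *)
Lemma chart_gt0_interior r i p : defining_function r -> dom i p ->
  0 < phi i p 0 0 -> minterior p.
Proof.
move=> rdef ip p0 pb; have [sr _ rzero dr] := rdef.
have /negP := dr i p pb ip; apply; apply/eqP.
have [|V [F [oV Vp sF E]]] := sr i (phi i p); first by exists p.
have n1 := near_gt0 p0; have n2 := near_image ip.
have nE : {near phi i p, F =1 r \o psi i}.
  near=> y; have y0 : 0 < (y : 'rV[R]_n.+1) 0 0 by near: y.
  have [q iq qy] : (phi i @` dom i) y by apply: (near n2) => //; exact: ltW.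
  by apply: E; [near: y; exact: open_nbhs_nbhs|exists q].
have df : differentiable (r \o psi i) (phi i p).
  by apply: near_eq_differentiable nE _; exact: smooth_differentiable sF Vp.
rewrite dcoordE//; apply/rowP => a; rewrite !mxE derive_eq0_min//.
by near=> y; rewrite /= chartK// rzero// defining_ge0.
Unshelve. all: by end_near. Qed.

End Interior.

Section Segments.
Context {R : realType} {n : nat} {M : bmanifold R n}.
Variables (i : midx M) (r : M -> R) (W : set 'rV[R]_n.+1) (m v : 'rV[R]_n.+1).
Hypotheses (rdef : defining_function r) (oW : open W).
Hypothesis WP : forall y, W y -> (cmap (mchart i) @` cdom (mchart i)) y /\ 0 < y 0 0.

Local Notation dom i := (cdom (mchart i)).
Local Notation phi i := (cmap (mchart i)).
Local Notation psi i := (cinv (mchart i)).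

Definition segment (s : R) : 'rV[R]_n.+1 := m + s *: v.

Hypothesis Wseg : forall t : R, 0 <= t <= 1 -> W (segment t).

Lemma is_derive_segment (s : R) : is_derive s 1 segment v.
Proof.
have E : \forall h \near (0 : R)^', h^-1 *: ((segment \o shift s) (h *: 1) - segment s) = v.
  near=> h; have h0 : h != 0 by near: h; exact: nbhs_dnbhs_neq.
  rewrite /segment /= [h *: 1]mulr1 opprD addrACA subrr add0r -scalerBl addrK scalerA.
  by rewrite mulVf// scale1r.
by split; [exact: is_cvg_near_cst E|exact: lim_near_cst E].
Unshelve. all: by end_near. Qed.

Lemma segment_differentiable (s : R) : differentiable segment s.
Proof. by apply/derivable1_diffP; have [] := is_derive_segment s. Qed.

Lemma continuous_segment : continuous segment.
Proof. by move=> s; apply: differentiable_continuous; exact: segment_differentiable. Qed.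

Lemma derive_comp_segment (T : 'rV[R]_n.+1 -> 'rV[R]_n.+1) (s : R) : differentiable T (segment s) ->
  'D_1 (T \o segment) s = v *m 'J T (segment s).
Proof.
move=> dT; have ds := segment_differentiable s.
rewrite deriveE; last exact: differentiable_comp.
rewrite diff_comp//= -(@deriveE _ _ _ segment s 1 ds) -deriveEjacobian//.
by have [_ ->] := is_derive_segment s; rewrite deriveE.
Qed.

Lemma near_segment (A : set 'rV[R]_n.+1) (t : R) : open A -> A (segment t) ->
  \forall s \near t, A (segment s).
Proof. by move=> oA At; apply: continuous_segment; exact: open_nbhs_nbhs. Qed.

Lemma segment_dom y : W y -> [/\ dom i (psi i y), phi i (psi i y) = y & minterior (psi i y)].
Proof.
move=> /WP [iy y0]; have [ip pE] := chart_image iy; split => //.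
by apply: chart_gt0_interior rdef ip _; rewrite pE.
Qed.

Lemma C1_curve_segment : C1_curve (psi i \o segment).
Proof.
move=> t t01; have Wt := Wseg t01; have [ip pE pint] := segment_dom Wt.
split => //.
  apply: continuous_comp; first exact: continuous_segment.
  move=> A; rewrite nbhsE => -[B [oB Bp] BA].
  have n1 := near_chart_inv oB Bp ip; rewrite pE in n1.
  have n2 : \forall y \near segment t, W y by exact: open_nbhs_nbhs.
  suff : nbhs (segment t) (psi i @^-1` A) by [].
  by apply: filterS2 n1 n2 => y h1 /WP[iy _]; apply: BA; exact: h1.
move=> j jp; have [V [T [oV Vp sT E]]] := transition_extension ip jp.
rewrite pE in Vp.
have dT y : V y -> differentiable T y by exact: row_smooth_differentiable.
have oVW := openI oV oW.
have nVW : \forall s \near t, (V `&` W) (segment s) by exact: near_segment.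
have eqT s : (V `&` W) (segment s) -> {near s, T \o segment =1 phi j \o (psi i \o segment)}.
  move=> VWs; have nVWs := near_segment oVW VWs.
  near=> u; have [Vu Wu] : (V `&` W) (segment u) by near: u.
  by have [_ /= ->] := E _ Vu (WP Wu).1.
have dTs s : V (segment s) -> derivable (T \o segment) s 1.
  move=> Vs; apply/derivable1_diffP; apply: differentiable_comp; last exact: dT.
  exact: segment_differentiable.
split.
  near=> s; have VWs : (V `&` W) (segment s) by near: s.
  by apply: near_eq_derivable (eqT s VWs) _; apply: dTs; case: VWs.
(* By the chain rule [D] along the segment is the velocity in the chart [j], written with the smooth
   extension [T] of the transition map; in this form its continuity in [t] is visible. *)
pose D y : 'rV[R]_n.+1 := \row_b \sum_a v 0 a * 'D_(delta_mx 0 a) (fun z => T z 0 b) y.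
have nD : {near t, D \o segment =1 fun s => 'D_1 (phi j \o (psi i \o segment)) s}.
  near=> s; have VWs : (V `&` W) (segment s) by near: s.
  have [Vs _] := VWs.
  rewrite /= -(near_eq_derive _ (eqT s VWs)) derive_comp_segment; last exact: dT.
  apply/rowP => b; rewrite [LHS]mxE [RHS]mxE; apply: eq_bigr => a _.
  by rewrite jacobianE//; exact: dT.
suff c : (D \o segment) @ t --> (D \o segment) t.
  rewrite [X in _ --> X](nbhs_singleton nD) in c.
  exact: cvg_trans (near_eq_cvg nD) c.
apply: continuous_comp; first exact: continuous_segment.
apply: continuous_row => b.
have cD : Ck 0 V (fun y => \sum_a v 0 a * 'D_(delta_mx 0 a) (fun z => T z 0 b) y).
  apply: Ck_sum => // a; apply: Ck_mul => //; first exact: Ck_cst.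
  exact: smooth_pd.
rewrite (_ : (fun _ => _) = fun y => \sum_a v 0 a * 'D_(delta_mx 0 a) (fun z => T z 0 b) y).
  exact: cD.
by apply/funext => y; rewrite mxE.
Unshelve. all: by end_near. Qed.

Variable g : tensor2 M.
Hypothesis gR : riemannian_metric g.

(** [curve_length] measures the speed at time [t] in [chart_at], a chart that may change with [t] in
    any manner. Invariance brings every speed back to the fixed chart [i], where the velocity is the
    constant vector [v]. *)
Lemma velocity_norm (t : R) j : 0 <= t <= 1 -> dom j (psi i (segment t)) ->
  vnorm g j (psi i (segment t)) ('D_1 (phi j \o (psi i \o segment)) t)
    = vnorm g i (psi i (segment t)) v.
Proof.
move=> t01 jp; have [ip pE pint] := segment_dom (Wseg t01).
have p0 := interior_gt0 pint ip.
rewrite (@derive_comp_segment (phi j \o psi i)).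
  by rewrite -[X in 'J _ X]pE vnorm_change.
by rewrite -pE; exact: transition_differentiable.
Qed.

Lemma rdist_segment (C : R) : (forall t : R, 0 <= t <= 1 -> vnorm g i (psi i (segment t)) v <= C) ->
  (rdist g (psi i m) (psi i (m + v)) <= C%:E)%E.
Proof.
move=> vC; apply: (@le_trans _ _ (curve_length g (psi i \o segment))).
  apply: ereal_inf_lbound; exists (psi i \o segment) => //; split.
  - exact: C1_curve_segment.
  - by rewrite /= /segment scale0r addr0.
  - by rewrite /= /segment scale1r.
apply: (@le_trans _ _ (\int[@lebesgue_measure R]_(t in (`[0%R, 1%R] : set R)) C%:E)%E).
  apply: ge0_le_integral_nomeas => t /=; first by rewrite lee_fin sqrtr_ge0.
  rewrite in_itv/= lee_fin => t01; rewrite velocity_norm ?vC//.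
  exact: chart_atP.
by rewrite integral_cst//= lebesgue_measure_itv/= lte_fin ltr01 sube0 mule1.
Qed.

End Segments.

(** * Asymptotics of the metric at the boundary *)

Section MatrixLimits.
Context {R : realType} {T : Type} (F : set_system T) {FF : Filter F}.

Lemma cvg_sum (I : Type) (s : seq I) (f : I -> T -> R) (l : I -> R) :
  (forall i, f i x @[x --> F] --> l i) ->
  \sum_(i <- s) f i x @[x --> F] --> \sum_(i <- s) l i.
Proof.
by move=> fl; apply: (@cvg_big _ _ +%R 0 xpredT (@add_continuous _)) => i _; exact: fl.
Qed.

Lemma cvg_prod_seq (I : Type) (s : seq I) (f : I -> T -> R) (l : I -> R) :
  (forall i, f i x @[x --> F] --> l i) ->
  \prod_(i <- s) f i x @[x --> F] --> \prod_(i <- s) l i.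
Proof.
move=> fl; elim: s => [|i s IH].
  by rewrite big_nil; under eq_cvg do rewrite big_nil; exact: cvg_cst.
by rewrite big_cons; under eq_cvg do rewrite big_cons; exact: cvgM.
Qed.

Lemma cvg_det N (A : T -> 'M[R]_N) (B : 'M[R]_N) :
  (forall a b, A x a b @[x --> F] --> B a b) -> \det (A x) @[x --> F] --> \det B.
Proof.
move=> AB; apply: cvg_sum => s; apply: cvgM; first exact: cvg_cst.
by apply: cvg_prod_seq => i; exact: AB.
Qed.

(** Near the limit the determinant is nonzero, so the entries of the inverse are quotients of
    cofactors by the determinant. *)
Lemma cvg_invmx N (A : T -> 'M[R]_N) (B : 'M[R]_N) :
  (forall a b, A x a b @[x --> F] --> B a b) -> B \in unitmx ->
  forall a b, invmx (A x) a b @[x --> F] --> invmx B a b.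
Proof.
move=> AB uB a b; have cd := cvg_det AB.
have dB : \det B != 0 by rewrite -unitfE -unitmxE.
have nA : \forall x \near F, \det (A x) != 0 by exact: cvgr_neq0 cd dB.
rewrite {2}/invmx uB mxE.
have c : (\det (A x))^-1 * (\adj (A x)) a b @[x --> F] --> (\det B)^-1 * (\adj B) a b.
  apply: cvgM; first exact: cvgV.
  rewrite mxE; under eq_cvg do rewrite mxE.
  apply: cvgM; first exact: cvg_cst.
  apply: cvg_det => k l; rewrite !mxE; under eq_cvg do rewrite !mxE.
  exact: AB.
apply: cvg_trans c; apply: near_eq_cvg; near=> x.
have dA : \det (A x) != 0 by near: x.
by rewrite /invmx unitmxE unitfE dA [(_ *: \adj _) a b]mxE.
Unshelve. all: by end_near. Qed.

End MatrixLimits.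

(* The determinant does not vanish on the segment from the identity to [A]. *)
Lemma spd_det_gt0 (R : realType) N (A : 'M[R]_N) : spd A -> 0 < \det A.
Proof.
move=> spdA; pose P (t : R) := (1 - t)%:M + t *: A.
have unitP t : 0 <= t <= 1 -> \det (P t) != 0.
  move=> /andP[t0 t1]; rewrite -unitfE -unitmxE; apply: spd_unitmx.
  have [symA posA] := spdA; split; first by rewrite /P linearD linearZ /= tr_scalar_mx symA.
  move=> v v0; rewrite /P mulmxDr mulmxDl mul_mx_scalar -scalemxAl -scalemxAr -scalemxAl !mxE.
  have vv : 0 < (v *m v^T) 0 0.
    have [b vb] : exists b, v 0 b != 0.
      apply: contrapT => /forallNP N0; move/eqP: v0; apply; apply/rowP => b.
      by have /negP := N0 b; rewrite negbK mxE => /eqP.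
    rewrite mxE (bigD1 b)//= mxE ltr_pwDl//; first by rewrite -expr2 exprn_even_gt0.
    by apply: sumr_ge0 => k _; rewrite mxE -expr2 sqr_ge0.
  have := posA v v0; rewrite !mxE in vv *.
  set X := \sum_ _ _ in vv *; set Y := \sum_ _ _ => Y0.
  have [->|tpos] := eqVneq t 0; first by rewrite subr0 mul1r mul0r addr0.
  have t0' : 0 < t by rewrite lt_def tpos.
  apply: ltr_wpDl; last exact: mulr_gt0.
  by apply: mulr_ge0; [rewrite subr_ge0|exact: ltW].
rewrite ltNge; apply/negP => det0.
have cP : continuous (fun t => \det (P t)).
  move=> t; apply: cvg_det => a b; rewrite !mxE; under eq_cvg do rewrite !mxE.
  apply: cvgD; last by apply: cvgM; [exact: cvg_id|exact: cvg_cst].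
  rewrite -mulr_natr; under eq_cvg do rewrite -mulr_natr.
  by apply: cvgM; [apply: cvgB; [exact: cvg_cst|exact: cvg_id]|exact: cvg_cst].
have P0 : \det (P 0) = 1 by rewrite /P subr0 scale0r addr0 det1.
have P1 : \det (P 1) = \det A by rewrite /P subrr scale1r raddf0 add0r.
have cw : {within `[0, 1], continuous (fun t => \det (P t))} by exact: continuous_subspaceT.
have bnd : Num.min (\det (P 0)) (\det (P 1)) <= 0 <= Num.max (\det (P 0)) (\det (P 1)).
  by rewrite P0 P1 ge_min le_max ler01 det0 orbT.
have [t t01 Pt0] := IVT ler01 cw bnd.
by have := unitP t; move: t01; rewrite in_itv/= => -> /(_ isT); rewrite Pt0 eqxx.
Qed.

Lemma form_sum (R : realType) N (A : 'M[R]_N) (v : 'rV[R]_N) :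
  (v *m A *m v^T) 0 0 = \sum_a \sum_b v 0 a * A a b * v 0 b.
Proof.
rewrite mxE exchange_big /=; apply: eq_bigr => b _.
by rewrite mxE mulr_suml mxE.
Qed.

Lemma form_bound (R : realType) N (A : 'M[R]_N) (v : 'rV[R]_N) (K : R) :
  (forall a b, `|A a b| <= K) -> (v *m A *m v^T) 0 0 <= K * (\sum_a `|v 0 a|) ^+ 2.
Proof.
move=> AK; rewrite form_sum expr2 mulr_suml mulr_sumr; apply: ler_sum => a _.
rewrite mulr_sumr mulr_sumr; apply: ler_sum => b _.
apply: le_trans (ler_norm _) _; rewrite !normrM mulrA ler_wpM2r//.
by rewrite mulrC ler_wpM2r.
Qed.

(** Only the normal entry of the inverse metric has to be sharp, since only the normal derivative of
    the test function is not small. All other terms are absorbed in the double product and the last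
    square, using [K <= K^2]. *)
Lemma dual_form_bound (R : realType) n (H : 'M[R]_n.+1) (d : 'rV[R]_n.+1) (e K : R) :
  0 <= e -> 1 <= K -> H 0 0 <= 1 + e -> (forall a b, `|H a b| <= K) ->
  (d *m H *m d^T) 0 0 <= ((1 + e) * `|d 0 0| + K * \sum_(j < n) `|d 0 (lift 0 j)|) ^+ 2.
Proof.
move=> e0 K1 H00 HK; set S := \sum_(j < n) _.
have S0 : 0 <= S by exact: sumr_ge0.
have tb a b : d 0 a * H a b * d 0 b <= K * `|d 0 a| * `|d 0 b|.
  apply: le_trans (ler_norm _) _; rewrite !normrM ler_wpM2r//.
  by rewrite mulrC ler_wpM2r.
rewrite form_sum big_ord_recl big_ord_recl.
have b0 : d 0 0 * H 0 0 * d 0 0 <= (1 + e) * `|d 0 0| ^+ 2.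
  by rewrite mulrC mulrA -expr2 mulrC -real_normK ?num_real// ler_wpM2r// exprn_ge0.
have b1 : \sum_(j < n) d 0 0 * H 0 (lift 0 j) * d 0 (lift 0 j) <= K * `|d 0 0| * S.
  by rewrite mulr_sumr; apply: ler_sum => j _; exact: tb.
have b2 : \sum_(j < n) \sum_b d 0 (lift 0 j) * H (lift 0 j) b * d 0 b <=
    K * S * (`|d 0 0| + S).
  rewrite [K * S]mulr_sumr mulr_suml; apply: ler_sum => j _.
  rewrite [in X in _ * X]/S big_ord_recl mulrDr lerD//.
  by rewrite mulr_sumr; apply: ler_sum => k _; exact: tb.
apply: le_trans (lerD (lerD b0 b1) b2) _.
have d0 := normr_ge0 (d 0 0); move: d0 S0; set D := `|_| => D0 S0.
have KK : K <= K ^+ 2 by rewrite expr2 ler_peMl//; lra.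
have h1 : (1 + e) * D ^+ 2 <= (1 + e) ^+ 2 * D ^+ 2.
  by rewrite ler_wpM2r ?exprn_ge0// expr2 ler_peMl//; lra.
have h2 : K * S ^+ 2 <= K ^+ 2 * S ^+ 2 by rewrite ler_wpM2r ?exprn_ge0.
have h3 : 0 <= e * K * D * S by rewrite !mulr_ge0//; lra.
have -> : ((1 + e) * D + K * S) ^+ 2 = (1 + e) ^+ 2 * D ^+ 2 + 2 * (K * D * S) + 2
  * (e * K * D * S) + K ^+ 2 * S ^+ 2 by ring.
have -> : (1 + e) * D ^+ 2 + K * D * S + K * S * (D + S) =
  (1 + e) * D ^+ 2 + 2 * (K * D * S) + K * S ^+ 2 by ring.
by lra.
Qed.

Lemma derive_comp_curve (R : realType) (V W : normedModType R) (F : V -> W) (z : R -> V) (s : R) :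
  differentiable z s -> differentiable F (z s) -> 'D_1 (F \o z) s = 'D_('D_1 z s) F (z s).
Proof.
move=> dz dF; rewrite deriveE; last exact: differentiable_comp.
by rewrite diff_comp//= (deriveE _ dF) -(@deriveE _ _ _ z s 1 dz).
Qed.

Lemma row_norm_lt (R : realType) N (v : 'rV[R]_N) (e : R) : 0 < e ->
  (forall a, `|v 0 a| < e) -> `|v| < e.
Proof.
move=> e0 ve; rewrite [ltLHS]/Num.Def.normr/= mx_normrE.
by apply/bigmax_ltP; split => // -[u a] _ /=; rewrite ord1.
Qed.

Lemma nbhs_row (R : realType) N (x : 'rV[R]_N) (P : set 'rV[R]_N) : nbhs x P ->
  exists2 rho : R, 0 < rho & forall y : 'rV[R]_N, (forall a, `|y 0 a - x 0 a| < rho) -> P y.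
Proof.
move=> /nbhs_ballP[rho rho0 xP]; exists rho => // y yx; apply: xP.
rewrite -ball_normE /=; apply: row_norm_lt => // a.
by rewrite !mxE distrC.
Qed.

Section Asymptotics.
Context {R : realType} {n : nat} {M : bmanifold R n}.
Variables (g gbar : tensor2 M) (r : M -> R) (theta : R) (i : midx M) (q : M).

Local Notation dom i := (cdom (mchart i)).
Local Notation phi i := (cmap (mchart i)).
Local Notation psi i := (cinv (mchart i)).
Local Notation e a := (delta_mx 0 a : 'rV[R]_n.+1).

Hypotheses (comp : compactification theta g r gbar) (iq : dom i q) (q0 : phi i q 0 0 = 0).
Hypothesis AH : dnorm2 gbar i r q = 1.

Let xq := phi i q.
Let c := rpartial (r \o psi i) 0 xq.
Let A := tcomp gbar i q.

Let rdef : defining_function r. Proof. by case: comp. Qed.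
Let qb : mboundary q. Proof. by exists i. Qed.

Let boundary_zero x : (phi i @` dom i) x -> x 0 0 = 0 -> r (psi i x) = 0.
Proof.
move=> /chart_image[ip pE] x0; have [_ _ rz _] := rdef; apply: rz; exists i.
by rewrite pE.
Qed.

(** In a direction [a != 0] the ray from [xq] stays on [x_0 = 0], where [r] vanishes; only the
    normal component survives. *)
Lemma dcoord_boundary : dcoord i r q = c *: e 0.
Proof.
apply/rowP => a; rewrite !mxE; have [->|a0] := eqVneq a 0; first by rewrite mulr1.
rewrite mulr0 (rpartial_ext (F := cst 0)) ?derive_cst//.
  by rewrite /= chartK//; have [_ _ + _] := rdef; apply.
have n1 := near_image iq.
have nn : \forall h \near (0 : R)^'+, (phi i @` dom i) (xq + h *: e a).
  have c0 : xq + h *: e a @[h --> (0 : R)] --> xq + 0 *: e a.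
    by apply: cvgD; [exact: cvg_cst|apply: cvgZr_tmp; exact: cvg_id].
  rewrite scale0r addr0 in c0.
  have n2 : \forall h \near (0 : R)^'+, 0 <= (xq + h *: e a) 0 0 ->
    (phi i @` dom i) (xq + h *: e a).
    exact: (cvg_at_right_filter c0 n1).
  near=> h; apply: (near n2) => //.
  by rewrite !mxE q0 eq_sym (negbTE a0) andbF mulr0 addr0.
near=> h; apply: boundary_zero; first by near: h.
by rewrite !mxE q0 eq_sym (negbTE a0) andbF mulr0 addr0.
Unshelve. all: by end_near. Qed.

Let H := [set x : 'rV[R]_n.+1 | 0 < x 0 0].

(* Mean value theorem along the normal coordinate, [r] vanishing on [x_0 = 0]. *)
Lemma cvg_ratio : r (psi i x) / x 0 0 @[x --> within H (nbhs xq)] --> c.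
Proof.
have [sr _ _ _] := rdef.
have [|V [F [oV Vq sF E]]] := sr i xq; first by exists q.
have imT x : (phi i @` dom i) x -> (phi i @` (dom i `&` setT)) x.
  by move=> [p ip <-]; exists p.
have n1 := near_image iq.
have dF x : V x -> differentiable F x by exact: smooth_differentiable.
have cE : c = 'D_(e 0) F xq.
  have imq : (phi i @` dom i) xq by exists q.
  apply: rpartial_ext; [exact: dF|by rewrite (E _ Vq (imT _ imq))|].
  have c0 : xq + h *: e 0 @[h --> (0 : R)] --> xq + 0 *: e 0.
    by apply: cvgD; [exact: cvg_cst|apply: cvgZr_tmp; exact: cvg_id].
  rewrite scale0r addr0 in c0.
  have nV : nbhs xq V by exact: open_nbhs_nbhs.
  have n2 : \forall h \near (0 : R)^'+, 0 <= (xq + h *: e 0) 0 0 ->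
    (phi i @` dom i) (xq + h *: e 0).
    exact: (cvg_at_right_filter c0 n1).
  have n3 : \forall h \near (0 : R)^'+, V (xq + h *: e 0).
    exact: (cvg_at_right_filter c0 nV).
  near=> h; have h0 : 0 < h by near: h; exact: nbhs_right_gt.
  have Vh : V (xq + h *: e 0) by near: h.
  have ih : (phi i @` dom i) (xq + h *: e 0).
    by apply: (near n2) => //; rewrite !mxE q0 !eqxx mulr1 add0r ltW.
  by rewrite (E _ Vh (imT _ ih)).
have cD : {for xq, continuous (fun x => 'D_(e 0) F x)}.
  exact: smooth_continuous (smooth_pd 0 sF) Vq.
apply/cvgrPdist_lt => eps eps0.
have nD : \forall x \near xq, `|'D_(e 0) F xq - 'D_(e 0) F x| < eps.
  by move: cD => /cvgrPdist_lt/(_ eps eps0).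
have nV : nbhs xq V by exact: open_nbhs_nbhs.
have [rho rho0 box] := nbhs_row (filterI nV (filterI nD n1)).
rewrite near_withinE; apply/nbhs_ballP; exists rho => // y.
rewrite -ball_normE /= => yb y0.
have {}yb a : `|y 0 a - xq 0 a| < rho.
  apply: le_lt_trans yb; rewrite [leRHS]/Num.Def.normr/= mx_normrE distrC.
  have -> : xq 0 a - y 0 a = (xq - y) 0 a by rewrite !mxE.
  exact: (@le_bigmax _ _ _ 0 (fun ij : 'I_1 * 'I_n.+1 => `|(xq - y) ij.1 ij.2|) (0, a)).
rewrite /H /= in y0.
(* Normal line through [y], parametrized by its normal coordinate: it passes through [y] at
   [s = y 0 0] and meets the boundary, where [r] vanishes, at [s = 0]. *)
pose z (s : R) := y + (s - y 0 0) *: e 0.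
have z0 (s : R) : z s 0 0 = s by rewrite !mxE !eqxx mulr1 addrC subrK.
have zbox (s : R) : 0 <= s <= y 0 0 -> forall a, `|z s 0 a - xq 0 a| < rho.
  move=> /andP[s0 sy] a; have [->|a0] := eqVneq a 0.
    rewrite z0 q0 subr0 ger0_norm//; apply: le_lt_trans sy _.
    by have := yb 0; rewrite q0 subr0 gtr0_norm.
  by rewrite !mxE (negbTE a0) andbF mulr0 addr0.
have dz (s : R) : is_derive s 1 z (e 0).
  have -> : z = segment (y - y 0 0 *: e 0) (e 0).
    by apply/funext => u; rewrite /z /segment scalerBl addrA addrAC.
  exact: is_derive_segment.
have dG (s : R) : 0 <= s <= y 0 0 -> is_derive s 1 (F \o z) ('D_(e 0) F (z s)).
  move=> sy; have [Vz _] := box _ (zbox s sy); have [dzs zE] := dz s.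
  have dzs' : differentiable z s by exact/derivable1_diffP.
  split; first by apply/derivable1_diffP; apply: differentiable_comp => //; exact: dF.
  by rewrite derive_comp_curve ?zE//; exact: dF.
have [s||s sy GE] := @MVT _ (F \o z) (fun s => 'D_(e 0) F (z s)) 0 (y 0 0) y0.
- by rewrite in_itv/= => /andP[/ltW s0 /ltW sy]; apply: dG; rewrite s0.
- apply: derivable_within_continuous => s; rewrite in_itv/= => sy.
  by have [] := dG s sy.
have sy' : 0 <= s <= y 0 0 by move: sy; rewrite in_itv/= => /andP[/ltW -> /ltW ->].
have yy : 0 <= y 0 0 <= y 0 0 by rewrite lexx ltW.
have y00 : (0 : R) <= 0 <= y 0 0 by rewrite lexx ltW.
have zy : z (y 0 0) = y by rewrite /z subrr scale0r addr0.
have [Vy [_ iy]] := box _ (zbox _ yy); rewrite zy in Vy iy.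
have [V0 [_ i0]] := box _ (zbox _ y00); rewrite z0 in i0.
have [Vs [Ds _]] := box _ (zbox _ sy').
move: GE; rewrite subr0 /= zy (E _ Vy (imT _ (iy (ltW y0)))) (E _ V0 (imT _ (i0 (lexx _)))) /=.
rewrite (boundary_zero (i0 (lexx _)) (z0 0)) subr0 => ->.
by rewrite mulfK ?gt_eqF// cE.
Unshelve. all: by end_near. Qed.

Lemma cvg_gbar a b : gbar i x a b @[x --> within H (nbhs xq)] --> A a b.
Proof.
have [_ _ _ gext] := comp.
have [|V [F [oV Vq [dF _] E]]] := gext i a b xq; first by exists q.
have imq : (phi i @` dom i) xq by exists q.
have -> : A a b = F xq by rewrite E.
have cF : F x @[x --> within H (nbhs xq)] --> F xq.
  by apply: cvg_within_filter; exact: differentiable_continuous (dF _ Vq).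
apply: cvg_trans cF; apply: near_eq_cvg; rewrite near_withinE.
have n1 := near_image iq; have nV : nbhs xq V by exact: open_nbhs_nbhs.
near=> x => x0; apply: E; first by near: x.
by apply: (near n1) => //; exact: ltW.
Unshelve. all: by end_near. Qed.

Let spdA : spd A. Proof. by case: comp => _ _ + _; apply. Qed.

Lemma conormal_form : c ^+ 2 * invmx A 0 0 = 1.
Proof.
have := AH; rewrite /dnorm2 dcoord_boundary form_sum -/A => <-.
rewrite (bigD1 0)//= [X in _ + X]big1 => [|a a0].
  rewrite addr0 (bigD1 0)//= [X in _ + X]big1 => [|a a0];
    first by rewrite !mxE !eqxx mulr1 addr0 expr2 mulrAC.
  by rewrite !mxE (negbTE a0) andbF !mulr0.
by rewrite big1// => b _; rewrite !mxE (negbTE a0) andbF mulr0 !mul0r.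
Qed.

(** By [conormal_form] [c] is not 0, and a negative limit of [r / x_0] would make [r] negative
    somewhere. *)
Lemma conormal_gt0 : 0 < c.
Proof.
have cN0 : c != 0.
  by apply: contra_eq_neq conormal_form => ->; rewrite expr0n mul0r eq_sym oner_neq0.
rewrite lt_neqAle eq_sym cN0 /= leNgt; apply/negP => c0.
have : \forall x \near within H (nbhs xq), r (psi i x) / x 0 0 < 0.
  exact: (cvgr_lt c cvg_ratio 0 c0).
rewrite near_withinE => /nbhs_row[rho rho0 box].
have rho20 : 0 < rho / 2 by rewrite divr_gt0.
have h0 : (xq + (rho / 2) *: e 0) 0 0 = rho / 2 by rewrite !mxE q0 !eqxx mulr1 add0r.
have : r (psi i (xq + (rho / 2) *: e 0)) / (xq + (rho / 2) *: e 0) 0 0 < 0.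
  apply: box; last by rewrite /H /= h0.
  move=> a; rewrite !mxE addrAC subrr add0r normrM (gtr0_norm rho20).
  have : `|((0 == 0 :> 'I_1) && (a == 0))%:R| <= 1 :> R by case: (_ && _); rewrite ?normr0 ?normr1.
  by move=> b1; apply: le_lt_trans (ler_wpM2l (ltW rho20) b1) _; lra.
rewrite h0 ltNge mulr_ge0 ?invr_ge0 ?(ltW rho20)//; exact: defining_ge0.
Qed.

(** Since [g = gbar / r^2] in dimension [n + 1], [x_0^(n+1) sqrt(det g)] equals
    [sqrt(det gbar) / (r / x_0)^(n+1)], and [w0] is its limit at [q]. *)
Let w0 := Num.sqrt (\det A) / c ^+ n.+1.

Lemma density_gt0 : 0 < w0.
Proof. by rewrite divr_gt0 ?exprn_gt0 ?conormal_gt0// sqrtr_gt0 spd_det_gt0. Qed.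

Lemma metric_compactified x : (phi i @` dom i) x -> 0 < x 0 0 ->
  [/\ 0 < r (psi i x), gbar i x \in unitmx, g i x \in unitmx &
      gbar i x = r (psi i x) ^+ 2 *: g i x].
Proof.
move=> /chart_image[ip pE] x0; have [_ gE gpos _] := comp.
have pint : minterior (psi i x) by apply: chart_gt0_interior rdef ip _; rewrite pE.
have r0 : 0 < r (psi i x) by have [_ + _ _] := rdef; apply.
have E : gbar i x = r (psi i x) ^+ 2 *: g i x.
  by have := gE i _ pint ip; rewrite /tcomp pE.
have u : gbar i x \in unitmx by have := gpos _ _ ip; rewrite /tcomp pE => /spd_unitmx.
split => //; move: u; rewrite E !unitmxE detZ unitrM => /andP[_ //].
Qed.

Lemma near_boundary_geometry eps : 0 < eps < 1 -> exists K rho : R, [/\ 0 < rho, 1 <= K &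
  forall x : 'rV[R]_n.+1, (forall a, `|x 0 a - xq 0 a| < rho) -> 0 < x 0 0 ->
  [/\ (phi i @` dom i) x,
    forall d : 'rV[R]_n.+1, Num.sqrt ((d *m invmx (g i x) *m d^T) 0 0) <=
      x 0 0 * ((1 + eps) * `|d 0 0| + K * \sum_(j < n) `|d 0 (lift 0 j)|),
    (1 - eps) * w0 <= x 0 0 ^+ n.+1 * Num.sqrt (\det (g i x)) <= (1 + eps) * w0 &
    forall v : 'rV[R]_n.+1, Num.sqrt ((v *m g i x *m v^T) 0 0) <= K / x 0 0 * \sum_a `|v 0 a|]].
Proof.
move=> /andP[eps0 eps1].
(* Since [g^-1 = r^2 gbar^-1], the matrix [h] is [g^-1 / x_0^2]. It tends to [c^2 A^-1], whose
   normal entry is 1 by [conormal_form]. *)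
pose kap x := r (psi i x) / x 0 0.
pose h x a b := kap x ^+ 2 * invmx (gbar i x) a b.
have ck := cvg_ratio.
have ck2 : kap x ^+ 2 @[x --> within H (nbhs xq)] --> c ^+ 2.
  by rewrite expr2; under eq_cvg do rewrite expr2; exact: cvgM.
have ch a b : h x a b @[x --> within H (nbhs xq)] --> c ^+ 2 * invmx A a b.
  by apply: cvgM => //; apply: cvg_invmx; [exact: cvg_gbar|exact: spd_unitmx].
have n1 : \forall x \near within H (nbhs xq), h x 0 0 < 1 + eps.
  by apply: (cvgr_lt _ (ch 0 0)); rewrite conormal_form ltrDl.
(* One plus the sum of the absolute values of all entries of the limit strictly exceeds each of
   them, so it bounds all entries near [xq]. *)
pose K1 := 1 + \sum_(ab : 'I_n.+1 * 'I_n.+1) `|c ^+ 2 * invmx A ab.1 ab.2|.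
pose K2 := 1 + \sum_(ab : 'I_n.+1 * 'I_n.+1) `|A ab.1 ab.2|.
have sum_le (f : 'I_n.+1 * 'I_n.+1 -> R) ab : `|f ab| < 1 + \sum_ab `|f ab|.
  by rewrite (bigD1 ab)//= addrCA ltrDl ltr_pwDl// sumr_ge0.
have n2 : \forall x \near within H (nbhs xq), forall ab : 'I_n.+1 * 'I_n.+1, `|h x ab.1 ab.2| < K1.
  apply: (@filter_forall _ _ (fun ab x => `|h x ab.1 ab.2| < K1)) => -[a b].
  by apply: (cvgr_norm_lt _ (ch a b)); exact: (sum_le (fun ab => c ^+ 2 * invmx A ab.1 ab.2)
    (a, b)).
have n3 : \forall x \near within H (nbhs xq), forall ab :
  'I_n.+1 * 'I_n.+1, `|gbar i x ab.1 ab.2| < K2.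
  apply: (@filter_forall _ _ (fun ab x => `|gbar i x ab.1 ab.2| < K2)) => -[a b].
  have cg := @cvg_gbar a b.
  apply: (cvgr_norm_lt _ cg); exact: (sum_le (fun ab => A ab.1 ab.2) (a, b)).
have c0 := conormal_gt0; have w00 := density_gt0.
have n4 : \forall x \near within H (nbhs xq), c / 2 < kap x.
  by apply: (cvgr_gt _ ck); lra.
pose w x := Num.sqrt (\det (gbar i x)) / kap x ^+ n.+1.
have cw : w x @[x --> within H (nbhs xq)] --> w0.
  apply: cvgM.
    apply: (@cvg_comp _ _ _ (fun x => \det (gbar i x)) Num.sqrt); last exact: sqrt_continuous.
    by apply: cvg_det; exact: cvg_gbar.
  apply: cvgV; first by rewrite expf_neq0 ?gt_eqF.
  apply: (@cvg_comp _ _ _ kap (fun t => t ^+ n.+1)); first exact: ck.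
  exact: exprn_continuous.
have n5 : \forall x \near within H (nbhs xq), w x < (1 + eps) * w0.
  by apply: (cvgr_lt _ cw); nra.
have n6 : \forall x \near within H (nbhs xq), (1 - eps) * w0 < w x.
  by apply: (cvgr_gt _ cw); nra.
have n7 : \forall x \near within H (nbhs xq), (phi i @` dom i) x.
  by rewrite near_withinE; apply: filterS (near_image iq) => x xi x0; apply: xi; exact: ltW.
have : \forall x \near within H (nbhs xq), [/\ h x 0 0 < 1 + eps,
    forall ab : 'I_n.+1 * 'I_n.+1, `|h x ab.1 ab.2| < K1,
    forall ab : 'I_n.+1 * 'I_n.+1, `|gbar i x ab.1 ab.2| < K2, c / 2 < kap x &
    [/\ w x < (1 + eps) * w0, (1 - eps) * w0 < w x & (phi i @` dom i) x]].
  by near=> x; split; [near: x..|split; near: x].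
rewrite near_withinE => /nbhs_row[rho rho0 box].
have K11 : 1 <= K1 by rewrite lerDl sumr_ge0.
have K21 : 1 <= K2 by rewrite lerDl sumr_ge0.
have K3 : 0 <= K2 * (2 / c) by rewrite mulr_ge0 ?divr_ge0 ?(ltW c0)//; lra.
(* [K1] serves for covectors. For tangent vectors [sqrt g] is [sqrt gbar / r], and
   [1 / r = 1 / (kap x_0) <= (2 / c) / x_0]. *)
exists (K1 + K2 * (2 / c)), rho; split => //; first by lra.
move=> x xb x0; have [hx1 hx2 hx3 hx4 [hx5 hx6 ix]] := box x xb x0.
have [r0 ubar ug gE] := metric_compactified ix x0.
have xN0 : x 0 0 != 0 by rewrite gt_eqF.
have kx0 : 0 < kap x by rewrite divr_gt0.
have rE : r (psi i x) = kap x * x 0 0 by rewrite divfK.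
have gE' : g i x = (r (psi i x) ^+ 2)^-1 *: gbar i x.
  by rewrite gE scalerA mulVf ?scale1r// expf_neq0// gt_eqF.
have invE : invmx (g i x) = x 0 0 ^+ 2 *: \matrix_(a, b) h x a b.
  have : invmx (gbar i x) = (r (psi i x) ^+ 2)^-1 *: invmx (g i x).
    by rewrite {1}gE invmxZ// -gE.
  move=> iE; apply/matrixP => a b; rewrite !mxE /h iE mxE rE.
  by field; rewrite xN0 gt_eqF.
split => //.
- move=> d; rewrite invE -scalemxAr -scalemxAl mxE sqrtrM ?sqr_ge0// sqrtr_sqr gtr0_norm//.
  rewrite ler_wpM2l ?(ltW x0)//.
  have S0 : 0 <= \sum_(j < n) `|d 0 (lift 0 j)| by exact: sumr_ge0.
  have B0 : 0 <= (1 + eps) * `|d 0 0| + K1 * \sum_(j < n) `|d 0 (lift 0 j)|.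
    by rewrite addr_ge0 ?mulr_ge0//; lra.
  apply: (@le_trans _ _ ((1 + eps) * `|d 0 0| + K1 * \sum_(j < n) `|d 0 (lift 0 j)|)).
    rewrite -[leRHS]ger0_norm// -sqrtr_sqr ler_wsqrtr//.
    apply: dual_form_bound => //; [exact: ltW|by rewrite mxE ltW|].
    by move=> a b; rewrite mxE; exact: ltW (hx2 (a, b)).
  by rewrite lerD2l ler_wpM2r// lerDl.
- have -> : x 0 0 ^+ n.+1 * Num.sqrt (\det (g i x)) = w x.
    rewrite gE' detZ sqrtrM; last by rewrite exprn_ge0 ?invr_ge0 ?exprn_ge0 ?(ltW r0).
    rewrite -exprVn -exprM mulnC exprM sqrtr_sqr ger0_norm;
      last by rewrite exprn_ge0 ?invr_ge0 ?(ltW r0).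
    rewrite /w rE mulrA mulrC; congr (_ * _).
    by rewrite invfM exprMn !exprVn mulrCA mulfV ?mulr1// expf_neq0.
  by rewrite (ltW hx5) (ltW hx6).
- move=> v; set S := \sum_a _; have S0 : 0 <= S by exact: sumr_ge0.
  rewrite gE' -scalemxAr -scalemxAl mxE sqrtrM ?invr_ge0 ?sqr_ge0//.
  rewrite -exprVn sqrtr_sqr ger0_norm ?invr_ge0 ?(ltW r0)//.
  have vb : Num.sqrt ((v *m gbar i x *m v^T) 0 0) <= K2 * S.
    have K2S : 0 <= K2 * S by rewrite mulr_ge0//; lra.
    rewrite -[leRHS]ger0_norm// -sqrtr_sqr ler_wsqrtr//.
    apply: le_trans (form_bound (K := K2) v _) _; first by move=> a b; exact: ltW (hx3 (a, b)).
    by rewrite exprMn ler_wpM2r ?sqr_ge0// expr2 ler_peMl//; lra.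
  have rV0 : 0 <= (r (psi i x))^-1 by rewrite invr_ge0 ltW.
  apply: le_trans (ler_wpM2l rV0 vb) _; rewrite mulrA ler_wpM2r//.
  rewrite rE invfM.
  have kV : (kap x)^-1 <= 2 / c by rewrite -[leRHS]invf_div lef_pV2 ?posrE ?divr_gt0//; exact: ltW.
  have xV0 : 0 <= (x 0 0)^-1 by rewrite invr_ge0 ltW.
  rewrite mulrAC ler_wpM2r// mulrC.
  apply: le_trans (ler_wpM2l _ kV) _; first by lra.
  by rewrite lerDr; lra.
Unshelve. all: by end_near. Qed.

End Asymptotics.

(** * Volume of coordinate slabs *)

Section IteratedIntegrals.
Context {R : realType}.

Lemma lebesgue_int_ge0 N (f : 'rV[R]_N -> \bar R) :
  (forall y, (0 <= f y)%E) -> (0 <= lebesgue_int f)%E.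
Proof.
elim: N f => [|N IH] f f0 /=; first exact: f0.
by apply: integral_ge0 => t _; apply: IH => y.
Qed.

Lemma lebesgue_int_le N (f h : 'rV[R]_N -> \bar R) :
  (forall y, (0 <= f y)%E) -> (forall y, (f y <= h y)%E) ->
  (lebesgue_int f <= lebesgue_int h)%E.
Proof.
elim: N f h => [|N IH] f h f0 fh /=; first exact: fh.
apply: ge0_le_integral_nomeas => t _; first exact: lebesgue_int_ge0.
by apply: IH => y.
Qed.

Lemma lebesgue_int0 N : lebesgue_int (fun _ : 'rV[R]_N => 0%E) = 0%E.
Proof. by elim: N => [//|N IH] /=; apply: integral0_eq => u _. Qed.

Lemma row_mx_head N (t : R) (y : 'rV[R]_N) :
  (row_mx (const_mx t : 'rV[R]_1) y : 'rV[R]_(1 + N)) 0 (0 : 'I_N.+1) = t.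
Proof.
have -> : (0 : 'I_N.+1) = lshift N (0 : 'I_1) by apply: val_inj.
by rewrite row_mxEl mxE.
Qed.

Lemma row_mx_lift N (t : R) (y : 'rV[R]_N) (j : 'I_N) :
  (row_mx (const_mx t : 'rV[R]_1) y : 'rV[R]_(1 + N)) 0 (lift 0 j : 'I_N.+1) = y 0 j.
Proof.
have -> : (lift 0 j : 'I_N.+1) = rshift 1 j by apply: val_inj.
by rewrite row_mxEr.
Qed.

Lemma integral_interval (a b : R) (f : R -> R) :
  (\int[@lebesgue_measure R]_t (if (a < t < b)%R then (f t)%:E else 0%E) =
   \int[@lebesgue_measure R]_(t in (`]a, b[ : set R)) (f t)%:E)%E.
Proof.
rewrite [RHS]integral_mkcond; apply: eq_integral => t _.
by rewrite patchE mem_setE in_itv.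
Qed.

Lemma lebesgue_int_cube N (c : 'rV[R]_N) (s k : R) : 0 < s ->
  lebesgue_int (fun y : 'rV[R]_N => if [forall j, `|y 0 j - c 0 j| < s] then k%:E else 0%E)
  = (k * (2 * s) ^+ N)%:E.
Proof.
move=> s0; elim: N c => [|N IH] c /=.
  by rewrite expr0 mulr1 ifT//; apply/forallP => -[].
pose c' : 'rV[R]_N := \row_j c 0 (lift 0 j).
transitivity (\int[@lebesgue_measure R]_t
    (if (c 0 0 - s < t < c 0 0 + s)%R then (k * (2 * s) ^+ N)%:E else 0))%E.
  apply: eq_integral => t _; case: ifPn => ct.
    rewrite -(IH c'); congr lebesgue_int; apply/funext => y.
    congr (if _ then _ else _); apply/forallP/forallP => yc j.
      by have := yc (lift 0 j); rewrite row_mx_lift mxE.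
    case: (unliftP 0 j) => [j' ->|->]; first by have := yc j'; rewrite row_mx_lift mxE.
    by rewrite row_mx_head ltr_distl.
  rewrite -[RHS](lebesgue_int0 N); congr lebesgue_int; apply/funext => y; rewrite ifF//.
  apply/negbTE; apply: contra ct => /forallP/(_ 0).
  by rewrite row_mx_head ltr_distl.
rewrite (integral_interval _ _ (fun=> k * (2 * s) ^+ N)) integral_cst//=.
rewrite lebesgue_measure_itv /= lte_fin ifT; last by lra.
by rewrite -EFinD -EFinM; congr EFin; rewrite exprS; ring.
Qed.

Lemma integral_inv (a b k : R) : 0 < a -> a < b ->
  (\int[@lebesgue_measure R]_(t in (`]a, b[ : set R)) (k * t^-1)%:E = (k * ln (b / a))%:E)%E.
Proof.
move=> a0 ab; have b0 := lt_trans a0 ab.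
have dln (t : R) : 0 < t -> is_derive t 1 (k \*: @ln R) (k *: t^-1).
  by move=> t0; apply: is_deriveZ; exact: is_derive1_ln.
have cf : {within `[a, b], continuous (fun t : R => k * t^-1)}.
  apply: continuous_in_subspaceT => t; rewrite inE /= in_itv /= => /andP[ta _].
  apply: cvgM; first exact: cvg_cst.
  by apply: cvgV; [rewrite gt_eqF//; exact: lt_le_trans ta|exact: cvg_id].
have cln (t : R) : 0 < t -> {for t, continuous (k \*: @ln R)}.
  move=> t0; apply: differentiable_continuous; apply/derivable1_diffP.
  by have [] := dln t t0.
rewrite -(@integral_itv_bndoo _ _ _ _ true false).
  rewrite (@continuous_FTC2 _ _ (k \*: @ln R))//.
  - by rewrite -EFinD /= -mulrBr ln_div// posrE.
  - split => [t||].
    + by rewrite in_itv/= => /andP[/(lt_trans a0)/dln[]].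
    + by apply: cvg_at_right_filter; exact: cln.
    + by apply: cvg_at_left_filter; exact: cln.
  - move=> t; rewrite in_itv/= => /andP[/(lt_trans a0)/dln[_ +] _].
    by rewrite derive1E.
apply/measurable_EFinP; apply: measurable_funM => //.
apply: subspace_continuous_measurable_fun => //.
apply: continuous_in_subspaceT => t; rewrite inE /= in_itv /= => /andP[ta _].
by apply: cvgV; [rewrite gt_eqF//; exact: lt_trans ta|exact: cvg_id].
Qed.

Definition in_slab n (q : 'rV[R]_n.+1) (a b s : R) (x : 'rV[R]_n.+1) : bool :=
  (a < x 0 0 < b) && [forall j : 'I_n, `|x 0 (lift 0 j) - q 0 (lift 0 j)| < s].

(** The normal coordinate is the outermost variable of [lebesgue_int], so the inner integral is the
    volume of a cube and the outer one a logarithm. *)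
Lemma lebesgue_int_slab n (q : 'rV[R]_n.+1) (a b s k : R) : 0 < a -> a < b -> 0 < s ->
  lebesgue_int (fun x => if in_slab q a b s x then (k / x 0 0)%:E else 0%E)
  = (k * (2 * s) ^+ n * ln (b / a))%:E.
Proof.
move=> a0 ab s0 /=; rewrite -integral_inv// -integral_interval.
pose q' : 'rV[R]_n := \row_j q 0 (lift 0 j).
apply: eq_integral => t _; case: ifPn => tab.
  rewrite mulrAC -(lebesgue_int_cube q' _ s0); congr lebesgue_int; apply/funext => y.
  rewrite /in_slab row_mx_head tab /=; congr (if _ then _ else _).
  by apply/forallP/forallP => yq j; have := yq j; rewrite row_mx_lift mxE.
rewrite -[RHS](lebesgue_int0 n); congr lebesgue_int.
by apply/funext => y; rewrite /in_slab row_mx_head (negbTE tab).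
Qed.

End IteratedIntegrals.

Lemma measurable_patch_open (R : realType) (n : nat) (M : bmanifold R n) (A : set M) (u : M -> R) :
  open A -> (forall p, A p -> {for p, continuous u}) ->
  measurable_fun setT (fun p : borel M => if p \in A then (u p)%:E else 0%E).
Proof.
move=> oA cu.
have mopen (B : set M) : open B -> measurable (B : set (borel M)).
  by move=> oB; exact: sub_sigma_algebra.
have -> : (fun p : borel M => if p \in A then (u p)%:E else 0%E) =
    EFin \o (fun p : borel M => if p \in A then u p else 0).
  by apply/funext => p /=; case: ifP.
apply/measurable_EFinP; apply: (measurability _ (RGenOInfty.measurableE R)).
move=> _ [_ [a ->] <-]; rewrite setTI.
have oB : open (A `&` u @^-1` [set t | a < t]).
  apply: ((continuous_inP u oA).1 _ _ (@open_gt R a)) => p; rewrite inE; exact: cu.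
(* The value 0 taken off [A] exceeds [a] exactly when [a < 0]; the preimage then also contains the
   complement of [A]. *)
have [a0|a0] := ltP a 0.
  rewrite (_ : _ @^-1` _ = (A `&` u @^-1` [set t | a < t]) `|` ~` A).
    by apply: measurableU; [exact: mopen|apply: measurableC; exact: mopen].
  apply/seteqP; split => p /=; rewrite in_itv /= andbT.
    by case: ifPn; [rewrite inE => Ap ap; left|rewrite notin_setE => nA _; right].
  by case=> [[Ap ap]|nA]; [rewrite mem_set|rewrite memNset].
rewrite (_ : _ @^-1` _ = A `&` u @^-1` [set t | a < t]); first exact: mopen.
apply/seteqP; split => p /=; rewrite in_itv /= andbT.
  by case: ifPn; [rewrite inE|move=> _; rewrite ltNge a0].
by move=> [Ap ap]; rewrite mem_set.
Qed.

Lemma open_slab (R : realType) n (q : 'rV[R]_n.+1) a b s : open [set x | in_slab q a b s x].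
Proof.
have c0 := @open_coord_gt R n.+1 0 a; have c1 := @open_coord_lt R n.+1 0 b.
have -> : [set x | in_slab q a b s x] = [set x : 'rV[R]_n.+1 | a < x 0 0] `&`
    ([set x : 'rV[R]_n.+1 | x 0 0 < b] `&`
    [set x : 'rV[R]_n.+1 | forall j : 'I_n, `|x 0 (lift 0 j) - q 0 (lift 0 j)| < s]).
  apply/seteqP; split => x.
    by move=> /andP[/andP[xa xb] /forallP xq].
  by move=> [xa [xb xq]]; rewrite /= /in_slab xa xb; apply/forallP.
apply: openI => //; apply: openI => //.
rewrite openE => x xq; apply: (@filter_forall _ _
  (fun j (y : 'rV[R]_n.+1) => `|y 0 (lift 0 j) - q 0 (lift 0 j)| < s) (nbhs x) _) => j.
have oj := @open_coord_lt R n.+1 (lift 0 j) (q 0 (lift 0 j) + s).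
have oj' := @open_coord_gt R n.+1 (lift 0 j) (q 0 (lift 0 j) - s).
have : nbhs x ([set y | y 0 (lift 0 j) < q 0 (lift 0 j) + s] `&`
               [set y | q 0 (lift 0 j) - s < y 0 (lift 0 j)]).
  apply: open_nbhs_nbhs; split; first exact: openI.
  by have := xq j; rewrite ltr_distl /= => /andP[].
by apply: filterS => y /= [y1 y2]; rewrite ltr_distl y1 y2.
Qed.

Section SlabVolume.
Context {R : realType} {n : nat} {M : bmanifold R n}.
Variables (g : tensor2 M) (vol : {measure set (borel M) -> \bar R}) (r : M -> R).
Variables (i : midx M) (xq : 'rV[R]_n.+1) (w0 eps rho : R).

Local Notation dom i := (cdom (mchart i)).
Local Notation phi i := (cmap (mchart i)).
Local Notation psi i := (cinv (mchart i)).

Hypotheses (hvol : riemannian_volume g vol) (rdef : defining_function r).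
Hypotheses (xq0 : xq 0 0 = 0) (w00 : 0 <= w0) (eps01 : 0 < eps < 1).
Hypothesis good : forall x : 'rV[R]_n.+1, (forall a, `|x 0 a - xq 0 a| < rho) -> 0 < x 0 0 ->
  (phi i @` dom i) x /\
  (1 - eps) * w0 <= x 0 0 ^+ n.+1 * Num.sqrt (\det (g i x)) <= (1 + eps) * w0.

Definition slab (a b s : R) : set M := [set p | dom i p /\ in_slab xq a b s (phi i p)].

(** [x_0^n] is the [p]-th power of [x_0^(n/p)]; multiplied by the density, close to [w0 x_0^(-n-1)],
    it becomes nearly [w0 / x_0]. *)
Definition slab_weight (a b s : R) (p : borel M) : \bar R :=
  if p \in slab a b s then (phi i p 0 0 ^+ n)%:E else 0%E.

Lemma in_slab_box a b s x : 0 < a -> b <= rho -> s <= rho -> in_slab xq a b s x ->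
  (forall c, `|x 0 c - xq 0 c| < rho) /\ 0 < x 0 0.
Proof.
move=> a0 br sr /andP[/andP[xa xb] /forallP xs].
have x0 := lt_trans a0 xa; split => // c.
case: (unliftP 0 c) => [j ->|->]; first exact: lt_le_trans (xs j) sr.
by rewrite xq0 subr0 gtr0_norm// (lt_le_trans xb).
Qed.

Lemma in_slab_interior a b s x : 0 < a -> b <= rho -> s <= rho -> in_slab xq a b s x ->
  [/\ dom i (psi i x), phi i (psi i x) = x & minterior (psi i x)].
Proof.
move=> a0 br sr /(in_slab_box a0 br sr)[xb x0].
have [/chart_image[ip pE] _] := good xb x0; split => //.
by apply: chart_gt0_interior rdef ip _; rewrite pE.
Qed.

Lemma open_slab_preimage a b s : open (slab a b s).
Proof. exact: (@open_chart_preimage R n M i _ (@open_slab R n xq a b s)). Qed.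

Lemma measurable_slab_weight a b s : measurable_fun setT (slab_weight a b s).
Proof.
apply: measurable_patch_open; first exact: open_slab_preimage.
move=> p [ip _]; have [_ _ _ cphi _] := mchartP i.
apply: (@continuous_comp _ _ _ (fun p => phi i p 0 0) (fun t => t ^+ n));
  last exact: exprn_continuous.
apply: (@continuous_comp _ _ _ (phi i) (fun x : 'rV[R]_n.+1 => x 0 0)); first exact: cphi.
exact: coord_continuous.
Qed.

Lemma slab_weight_ge0 a b s p : 0 <= a -> (0 <= slab_weight a b s p)%E.
Proof.
move=> a0; rewrite /slab_weight; case: ifPn => //; rewrite inE => -[_ /andP[/andP[pa _] _]].
by rewrite lee_fin exprn_ge0// ltW// (le_lt_trans a0).
Qed.

(** The weight is a Borel function, so [riemannian_volume] turns its integral into a Lebesgue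
    integral, whose integrand lies between [(1 - eps) w0 / x_0] and [(1 + eps) w0 / x_0] on the slab
    and is 0 outside. *)
Lemma slab_volume a b s : 0 < a -> a < b -> b <= rho -> 0 < s -> s <= rho ->
  (((1 - eps) * w0 * (2 * s) ^+ n * ln (b / a))%:E
    <= \int[vol]_(p in (dom i `&` @minterior R n M : set (borel M))) slab_weight a b s p
    <= ((1 + eps) * w0 * (2 * s) ^+ n * ln (b / a))%:E)%E.
Proof.
move=> a0 ab br s0 sr.
rewrite hvol; [|exact: measurable_slab_weight|by move=> p; rewrite slab_weight_ge0// ltW].
set f := (X in (_ <= lebesgue_int X)%E).
rewrite -!(lebesgue_int_slab xq)//.
have fin y : in_slab xq a b s y -> f y = (y 0 0 ^+ n * Num.sqrt (\det (g i y)))%:E.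
  move=> ys; have [ip pE pint] := in_slab_interior a0 br sr ys.
  rewrite /f mem_set; last by exists (psi i y).
  by rewrite /slab_weight mem_set ?pE//; split; rewrite ?pE.
have fout y : ~~ in_slab xq a b s y -> f y = 0%E.
  move=> ys; rewrite /f; case: ifPn => //; rewrite inE => -[p [ip pint] pE].
  rewrite /slab_weight memNset ?mul0e// => -[_].
  by rewrite -pE chartK// pE; apply/negP.
have bnd y : in_slab xq a b s y ->
    (1 - eps) * w0 / y 0 0 <= y 0 0 ^+ n * Num.sqrt (\det (g i y)) <= (1 + eps) * w0 / y 0 0.
  move=> /(in_slab_box a0 br sr)[yb y0]; have [_ /andP[l u]] := good yb y0.
  rewrite ler_pdivrMr// ler_pdivlMr//.
  by rewrite mulrAC -exprSr l u.
have f0 y : (0 <= f y)%E.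
  have [ys|ys] := boolP (in_slab xq a b s y); last by rewrite fout.
  have [_ y0] := in_slab_box a0 br sr ys.
  by rewrite fin// lee_fin mulr_ge0 ?sqrtr_ge0// exprn_ge0// ltW.
have /andP[eps0 eps1] := eps01.
apply/andP; split; apply: lebesgue_int_le => // y.
- case: ifPn => // /(in_slab_box a0 br sr)[_ y0].
  by rewrite lee_fin divr_ge0 ?mulr_ge0 ?subr_ge0 ?(ltW eps1) ?(ltW y0).
- have [ys|ys] := boolP (in_slab xq a b s y) => //; rewrite fin// lee_fin.
  by have /andP[] := bnd y ys.
- have [ys|ys] := boolP (in_slab xq a b s y); last by rewrite -/(f y) fout.
  by rewrite -/(f y) fin// lee_fin; have /andP[] := bnd y ys.
Qed.

Lemma integral_slab_weight (Omega : set M) a b s :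
  slab a b s `<=` Omega -> Omega `<=` dom i `&` @minterior R n M ->
  (\int[vol]_(p in (Omega : set (borel M))) slab_weight a b s p =
  \int[vol]_(p in (dom i `&` @minterior R n M : set (borel M))) slab_weight a b s p)%E.
Proof.
move=> sO OD; rewrite integral_mkcond [RHS]integral_mkcond; apply: eq_integral => p _.
rewrite !patchE; have [pO|pO] := boolP (p \in Omega).
  by rewrite mem_set//; apply: OD; move: pO; rewrite inE.
case: ifPn => // _; rewrite /slab_weight memNset// => /sO pO'.
by move: pO; rewrite notin_setE.
Qed.

End SlabVolume.

(** * The test domain and the test function *)

Section Domain.
Context {R : realType} {n : nat} {M : bmanifold R n}.
Variables (g : tensor2 M) (r : M -> R) (i : midx M) (m l : 'rV[R]_n.+1) (k : nat) (C : R).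

Local Notation dom i := (cdom (mchart i)).
Local Notation phi i := (cmap (mchart i)).
Local Notation psi i := (cinv (mchart i)).
Local Notation S := (superell m l k).
Local Notation e a := (delta_mx 0 a : 'rV[R]_n.+1).

Hypotheses (gR : riemannian_metric g) (rdef : defining_function r).
Hypotheses (l0 : forall a, 0 < l 0 a) (k0 : (0 < k)%N).
Hypothesis box : forall x : 'rV[R]_n.+1, (forall a, `|x 0 a - m 0 a| <= l 0 a) ->
  [/\ (phi i @` dom i) x, 0 < x 0 0 &
   forall v : 'rV[R]_n.+1, Num.sqrt ((v *m g i x *m v^T) 0 0) <= C * \sum_a `|v 0 a|].

Definition ell_domain : set M := [set p | dom i p /\ S (phi i p) < 1].

Lemma box_point (x : 'rV[R]_n.+1) : (forall a, `|x 0 a - m 0 a| <= l 0 a) ->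
  [/\ dom i (psi i x), phi i (psi i x) = x & minterior (psi i x)].
Proof.
move=> /box[/chart_image[ip pE] x0 _]; split => //.
by apply: chart_gt0_interior rdef ip _; rewrite pE.
Qed.

Lemma ell_box (x : 'rV[R]_n.+1) : S x < 1 -> forall a, `|x 0 a - m 0 a| <= l 0 a.
Proof. by move=> Sx a; apply/ltW/(superell_lt1 l0 k0). Qed.

Lemma ell_domain_interior : ell_domain `<=` @minterior R n M.
Proof. by move=> p [ip /ell_box/box_point[]]; rewrite chartK. Qed.

Lemma ell_domain_image : ell_domain = psi i @` [set x | S x < 1].
Proof.
apply/seteqP; split => [p [ip Sp]|_ [x Sx <-]]; first by exists (phi i p) => //; rewrite chartK.
by have [ip pE _] := box_point (ell_box Sx); split; rewrite ?pE.
Qed.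

Lemma open_ell_domain : open ell_domain.
Proof. exact: open_chart_preimage (@open_superell R n m l k). Qed.

Lemma continuous_within_box (A : set 'rV[R]_n.+1) :
  (forall x : 'rV[R]_n.+1, A x -> forall a, `|x 0 a - m 0 a| <= l 0 a) ->
    {within A, continuous (psi i)}.
Proof.
move=> AB; have [_ _ _ _ c] := mchartP i; apply: continuous_subspaceW c.
by move=> x /AB/box[].
Qed.

Lemma compact_box_image (A : set 'rV[R]_n.+1) :
  (forall x : 'rV[R]_n.+1, A x -> forall a, `|x 0 a - m 0 a| <= l 0 a) -> compact A ->
    compact (psi i @` A).
Proof. by move=> AB; apply: continuous_compact; exact: continuous_within_box. Qed.

(** The coordinate segment from the centre stays in the domain, and the components of its velocity
    are at most the [l 0 a]. *)
Lemma ell_domain_bounded (x : 'rV[R]_n.+1) : S x < 1 ->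
  (rdist g (psi i m) (psi i x) <= (C * \sum_a l 0 a)%:E)%E.
Proof.
move=> Sx; have -> : x = m + (x - m) by rewrite addrC subrK.
have seg (t : R) : 0 <= t <= 1 -> S (segment m (x - m) t) < 1.
  by move=> t01; exact: superell_segment.
have C0 : 0 <= C.
  have [_ _ /(_ (e 0))] := box (ell_box Sx).
  move=> /(le_trans (sqrtr_ge0 _)); rewrite pmulr_lge0//.
  rewrite (bigD1 0)//= mxE !eqxx normr1 ltr_pwDl// sumr_ge0//.
apply: (rdist_segment rdef (@open_superell R n m l k) (W := [set x | S x < 1])) => //.
  by move=> y /ell_box/box[].
move=> t t01; have [ip pE _] := box_point (ell_box (seg t t01)).
have [_ _ vC] := box (ell_box (seg t t01)).
rewrite /vnorm /tcomp pE; apply: le_trans (vC _) _.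
rewrite ler_wpM2l//; apply: ler_sum => a _; rewrite !mxE.
exact: ell_box.
Qed.

(** The image of the compact set [superell <= 1] is closed because [M] is Hausdorff, so the closure
    of the domain stays in the chart and its additional points satisfy [superell = 1]. There
    [superell - 1] is a local defining function, regular by [superell_grad]. *)
Lemma ell_domain_smooth_bounded : smooth_bounded_domain g ell_domain.
Proof.
have Sm : S m < 1 by rewrite superell_center.
have [im mE mint] := box_point (ell_box Sm).
split; first exact: ell_domain_interior.
- split; first exact: open_ell_domain.
    by exists (psi i m); split; rewrite ?mE.
  rewrite ell_domain_image; apply: connected_continuous_connected.
    exact: connected_superell.
  by apply: continuous_within_box => x; exact: ell_box.
- exists (psi i m), (C * \sum_a l 0 a); split => // q [iq Sq].
  by rewrite -(chartK iq); exact: ell_domain_bounded.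
- move=> p pint [clp np].
  have cS : closed (psi i @` [set x | S x <= 1]).
    apply: compact_closed; first exact: mhausdorff.
    apply: compact_box_image; last exact: compact_superell.
    by move=> x Sx a; exact: (superell_le1 l0 k0 _ Sx).
  have [x Sx xp] : (psi i @` [set x | S x <= 1]) p.
    rewrite [X in X p]((closure_id _).1 cS); apply: closure_subset clp.
    by rewrite ell_domain_image; apply: image_subset => x; exact: ltW.
  have bx a : `|x 0 a - m 0 a| <= l 0 a by exact: (superell_le1 l0 k0 _ Sx).
  have [ip pE _] := box_point bx; rewrite xp in ip pE.
  have S1 : S x = 1.
    apply/eqP; rewrite eq_le Sx /= leNgt; apply/negP => Sx1.
    by apply: np; split; rewrite ?pE.
  have oH := @open_coord_gt R n.+1 0 0.
  exists [set p | dom i p /\ 0 < phi i p 0 0], ((fun x => S x - 1) \o phi i).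
  have p0 : 0 < phi i p 0 0 by rewrite pE; have [] := box bx.
  have sS : smooth [set x : 'rV[R]_n.+1 | 0 < x 0 0] (fun x => S x - 1).
    move=> j; apply: Ck_add => //; last exact: Ck_cst.
    exact: smooth_superell.
  split.
  + exact: open_chart_preimage oH.
  + by [].
  + exact: (smooth_on_chart oH sS).
  + have nE : {near phi i p, (fun x => S x - 1) =1 ((fun x => S x - 1) \o phi i) \o psi i}.
      have n1 := near_gt0 p0; have n2 := near_image ip.
      near=> y; have y0 : 0 < (y : 'rV[R]_n.+1) 0 0 by near: y.
      have /chart_image[_ yE] : (phi i @` dom i) y by apply: (near n2) => //; exact: ltW.
      by rewrite /= yE.
    have dS : differentiable (fun x => S x - 1) (phi i p) by exact: smooth_differentiable sS p0.
    apply: (dcoord_neq0 gR ip (chart_atP p) pint).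
      exact: near_eq_differentiable nE dS.
    rewrite dcoordE; last exact: near_eq_differentiable nE dS.
    have [a /negP da] := superell_grad l0 k0 S1; apply/negP => /eqP/rowP/(_ a).
    rewrite !mxE -(near_eq_derive _ nE) pE => d0; apply: da.
    have dS' : differentiable S x.
      by apply: (smooth_differentiable (@smooth_superell R n m l k setT openT)).
    apply/eqP; rewrite -d0 deriveB ?derive_cst ?subr0//; exact: diff_derivable.
  + apply/seteqP; split => q /=.
      move=> [[iq Sq] [_ q0]]; split => //; first by rewrite subr_lt0.
    by move=> [[iq q0]]; rewrite subr_lt0.
Unshelve. all: by end_near. Qed.

End Domain.

Lemma fine_ratio_le (R : realType) (E B : \bar R) (U L : R) : 0 < L -> (0 <= E)%E ->
  (E <= U%:E)%E -> (L%:E <= B)%E -> B \is a fin_num ->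
  ((fine E / fine B)%:E <= (U / L)%:E)%E.
Proof.
move=> L0 E0 EU LB Bfin; have LB' : L <= fine B by rewrite -lee_fin fineK.
have B0 := lt_le_trans L0 LB'.
have Efin : E \is a fin_num by rewrite ge0_fin_numE//; apply: le_lt_trans EU _; exact: ltry.
have EU' : fine E <= U by rewrite -lee_fin fineK.
rewrite lee_fin ler_pM ?fine_ge0 ?invr_ge0 ?(ltW B0)//.
by rewrite lef_pV2 ?posrE.
Qed.

(** * The test function on the manifold: gradient, energy and norm estimates *)

Section TestFunction.
Context {R : realType} {n : nat} {M : bmanifold R n}.
Variables (g : tensor2 M) (vol : {measure set (borel M) -> \bar R}) (r : M -> R) (i : midx M).
Variables (xq : 'rV[R]_n.+1) (w0 eps K rho p d T : R).

Local Notation dom i := (cdom (mchart i)).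
Local Notation phi i := (cmap (mchart i)).
Local Notation psi i := (cinv (mchart i)).
Local Notation e a := (delta_mx 0 a : 'rV[R]_n.+1).

Hypotheses (gR : riemannian_metric g) (hvol : riemannian_volume g vol).
Hypotheses (rdef : defining_function r) (xq0 : xq 0 0 = 0) (w00 : 0 < w0) (eps01 : 0 < eps < 1).
Hypotheses (K1 : 1 <= K) (rho0 : 0 < rho) (p1 : 1 < p).
Hypothesis good : forall x : 'rV[R]_n.+1, (forall a, `|x 0 a - xq 0 a| < rho) -> 0 < x 0 0 ->
  [/\ (phi i @` dom i) x,
    forall v : 'rV[R]_n.+1, Num.sqrt ((v *m invmx (g i x) *m v^T) 0 0) <=
      x 0 0 * ((1 + eps) * `|v 0 0| + K * \sum_(j < n) `|v 0 (lift 0 j)|),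
    (1 - eps) * w0 <= x 0 0 ^+ n.+1 * Num.sqrt (\det (g i x)) <= (1 + eps) * w0 &
    forall v : 'rV[R]_n.+1, Num.sqrt ((v *m g i x *m v^T) 0 0) <= K / x 0 0 * \sum_a `|v 0 a|].

Let s := rho / 4.
Let s' := (1 - eps) * s.
Let al := n%:R / p.
Let Cchi := 2 * dstep_bound / (s - s') : R.

Hypotheses (d0 : 0 < d) (dT : d < T) (Trho : T <= rho / 8).
Hypothesis Teps : K * n%:R * Cchi * T <= eps.

Let eps0 : 0 < eps. Proof. by case/andP: eps01. Qed.
Let eps1 : eps < 1. Proof. by case/andP: eps01. Qed.
Let T0 : 0 < T. Proof. exact: lt_trans dT. Qed.
Let s0 : 0 < s. Proof. by rewrite divr_gt0. Qed.
Let s'0 : 0 < s'. Proof. by rewrite mulr_gt0// subr_gt0. Qed.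
Let s's : s' < s. Proof. by rewrite /s' gtr_pMl//; move: eps0; lra. Qed.
Let p0 : 0 < p. Proof. exact: lt_trans p1. Qed.
Let al0 : 0 <= al. Proof. by rewrite divr_ge0// ltW. Qed.
Let Cchi0 : 0 <= Cchi.
Proof. by rewrite divr_ge0 ?mulr_ge0 ?dstep_bound_ge0// ltW// subr_gt0. Qed.

(** About the centre [m], the half-sizes [c] give [[d/2, 2T]] times a cube of half-side [s], the box
    holding the support of [F]. The half-sizes [l] give the larger box [[d/4, 2T + d/4]] times a
    cube of half-side [2s], which still has [x_0 > 0] and lies within [rho] of [xq]. *)
Let m : 'rV[R]_n.+1 := \row_a (if a == 0 then T + d / 4 else xq 0 a).
Let l : 'rV[R]_n.+1 := \row_a (if a == 0 then T else 2 * s).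
Let c : 'rV[R]_n.+1 := \row_a (if a == 0 then T - d / 4 else s).
Let F := bump xq al d T s' s.

Let l0 a : 0 < l 0 a.
Proof. by rewrite mxE; case: ifP => _ //; rewrite mulr_gt0. Qed.

Local Ltac lra_params := move: d0 dT Trho T0 s0 eps0 eps1 K1 rho0 al0; lra.

Lemma exponent_exists : exists2 k : nat, (0 < k)%N &
  forall x : 'rV[R]_n.+1, (forall a, `|x 0 a - m 0 a| <= c 0 a) -> superell m l k x < 1.
Proof.
(* The ratios [c_a / l_a] are [1 - d / (4T)] in the normal direction and [1/2] in the others. *)
pose ra := Num.max (1 - d / (4 * T)) 2^-1.
have ra0 : 0 <= ra by rewrite le_max invr_ge0 ler0n orbT.
have dT4 : 0 < d / (4 * T) by rewrite divr_gt0// mulr_gt0.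
have ra1 : ra < 1 by rewrite gt_max; apply/andP; split; [by rewrite gtrBl|lra].
have [|k k0 kra] := @exists_expr_lt1 R n.+1 ra; first by rewrite ra0.
exists k => // x xc; apply: le_lt_trans kra; apply: superell_le => // a.
apply: le_trans (xc a) _; rewrite !mxE; case: ifPn => _.
  have -> : T - d / 4 = (1 - d / (4 * T)) * T by field; rewrite gt_eqF.
  by rewrite ler_wpM2r ?(ltW T0)// le_max lexx.
rewrite [leLHS](_ : s = 2^-1 * (2 * s)); last by field.
apply: ler_wpM2r; first by rewrite mulr_ge0// ltW.
by rewrite /ra le_max lexx orbT.
Qed.

Lemma box_good (x : 'rV[R]_n.+1) : (forall a, `|x 0 a - m 0 a| <= l 0 a) ->
  (forall a, `|x 0 a - xq 0 a| < rho) /\ d / 4 <= x 0 0 <= 3 * T.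
Proof.
move=> xb; have := xb 0; rewrite !mxE eqxx ler_distl => /andP[x1 x2].
have x0b : d / 4 <= x 0 0 <= 3 * T by apply/andP; split; lra_params.
split => // a; have [->|a0] := eqVneq a 0.
  rewrite xq0 subr0 ger0_norm; last by lra_params.
  by lra_params.
have := xb a; rewrite !mxE (negbTE a0) => /le_lt_trans; apply.
by rewrite /s; lra_params.
Qed.

Lemma bump_box (x : 'rV[R]_n.+1) : F x != 0 -> forall a, `|x 0 a - m 0 a| <= c 0 a.
Proof.
move=> /(bump_supp d0 (ltW dT) s's)[/andP[x1 x2] xs] a.
case: (unliftP 0 a) => [j ->|->]; rewrite !mxE /=; first exact: ltW.
by rewrite ler_distl; apply/andP; split; lra_params.
Qed.

Lemma in_slab_bump (x : 'rV[R]_n.+1) : F x != 0 -> in_slab xq (d / 2) (2 * T) s x.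
Proof.
move=> /(bump_supp d0 (ltW dT) s's)[x0 xs]; rewrite /in_slab x0.
exact/forallP.
Qed.

Variable k : nat.
Hypotheses (k0 : (0 < k)%N).
Hypothesis kc : forall x : 'rV[R]_n.+1, (forall a, `|x 0 a - m 0 a| <= c 0 a) ->
  superell m l k x < 1.

Let Om := ell_domain i m l k.

Let box (x : 'rV[R]_n.+1) : (forall a, `|x 0 a - m 0 a| <= l 0 a) ->
  [/\ (phi i @` dom i) x, 0 < x 0 0 &
   forall v : 'rV[R]_n.+1, Num.sqrt ((v *m g i x *m v^T) 0 0) <= (K / (d / 4)) * \sum_a `|v 0 a|].
Proof.
move=> /box_good[xr /andP[x1 x2]]; have d40 : 0 < d / 4 by rewrite divr_gt0.
have x0 : 0 < x 0 0 by exact: lt_le_trans x1.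
have [ix _ _ gx] := good xr x0; split => // v; apply: le_trans (gx v) _.
rewrite ler_wpM2r ?sumr_ge0// ler_wpM2l//; first by lra_params.
by rewrite lef_pV2 ?posrE.
Qed.

Lemma Om_domain : smooth_bounded_domain g Om.
Proof. exact: (ell_domain_smooth_bounded gR rdef l0 k0 box). Qed.

Let OmI : Om `<=` @minterior R n M.
Proof. exact: (ell_domain_interior rdef l0 k0 box). Qed.

Let oOm : open Om. Proof. exact: open_ell_domain. Qed.

(** The chart map is arbitrary off its domain, hence the explicit extension by 0. *)
Definition tfun (q : M) : R := if q \in Om then F (phi i q) else 0.

Lemma tfun_test : test_function Om tfun.
Proof.
(* The closed box of half-sizes [c] is compact, contains the support of [F] and lies in the
   superellipsoid; its image is the compact set asked of a test function. *)
pose A := [set x : 'rV[R]_n.+1 | forall a, `|x 0 a - m 0 a| <= c 0 a].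
have AB (x : 'rV[R]_n.+1) : A x -> forall a, `|x 0 a - m 0 a| <= l 0 a.
  by move=> /kc Sx a; exact: (ell_box l0 k0).
have cA : compact (psi i @` A).
  by apply: (compact_box_image (C := K / (d / 4)) box AB); exact: compact_box.
have AO : psi i @` A `<=` Om.
  move=> _ [x Ax <-]; have [ip pE _] := box_point rdef box (AB x Ax).
  by split; rewrite ?pE//; exact: kc.
have zero q : ~ (psi i @` A) q -> tfun q = 0.
  move=> nq; rewrite /tfun; case: ifPn => //; rewrite inE => -[iq Sq].
  apply/eqP; apply: contra_notT nq => /bump_box Aq.
  by exists (phi i q) => //; rewrite chartK.
split; last by exists (psi i @` A).
(* Two open sets cover [M]: [Om], where [tfun] is [F] in the chart, and the complement of the
   compact set, where it is 0. *)
apply: smooth_on_local => q _; have [qO|qO] := pselect (Om q).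
  exists Om, (F \o phi i); split => //.
    apply: (@smooth_on_chart R n M i [set x | superell m l k x < 1]); first exact: open_superell.
    apply: smooth_sub (smooth_bump _ _ _ _ _ _) => x /(ell_box l0 k0)/box[] //.
  by move=> q' q'O; rewrite /tfun mem_set.
exists (~` (psi i @` A)), (fun=> 0); split => //.
- by apply: closed_openC; apply: compact_closed cA; exact: mhausdorff.
- by move=> /AO.
- exact: smooth_on_cst.
Qed.

(** [C2] is the crude gradient constant on all of [Om]: [1 + eps <= 2] in the normal part, and
    [3 * eps <= 3] in the tangential part because [x_0 <= 3 * T]. The next constant [mc] is the
    sharp one between [d] and [T], tending to [n / p] with [eps]. *)
Let C2 := 2 * (al + 4 * dstep_bound) + 3 : R.
Let mc := (1 + eps) * al + eps.

Lemma tfun_near q : Om q -> {near phi i q, F =1 tfun \o psi i}.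
Proof.
move=> [iq Sq]; have : nbhs (phi i q) [set x | superell m l k x < 1].
  by apply: open_nbhs_nbhs; split => //; exact: open_superell.
apply: filterS => x Sx; have [ix xE _] := box_point rdef box (ell_box l0 k0 Sx).
by rewrite /= /tfun mem_set ?xE//; split; rewrite ?xE.
Qed.

Lemma Om_gt0 q : Om q -> 0 < phi i q 0 0.
Proof. by move=> [iq /(ell_box l0 k0)/box[]]. Qed.

Lemma bump_differentiable (x : 'rV[R]_n.+1) : 0 < x 0 0 -> differentiable F x.
Proof. exact: smooth_differentiable (smooth_bump _ _ _ _ _ _). Qed.

Lemma gradnorm_tfun q : Om q ->
  gradnorm g tfun q <= phi i q 0 0 * ((1 + eps) * `|'D_(e 0) F (phi i q)|
    + K * \sum_(j < n) `|'D_(e (lift 0 j)) F (phi i q)|).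
Proof.
move=> qO; have [iq Sq] := qO; have x0 := Om_gt0 qO.
have nE := tfun_near qO; have dF := bump_differentiable x0.
have df := near_eq_differentiable nE dF.
have [xr _] := box_good (ell_box l0 k0 Sq).
have [_ gx _ _] := good xr x0.
rewrite (gradnorm_coord gR iq (OmI qO) df) dcoordE// /tcomp.
apply: le_trans (gx _) _; rewrite !mxE -(near_eq_derive _ nE).
under eq_bigr do rewrite mxE -(near_eq_derive _ nE).
by [].
Qed.

Lemma gradnorm_ge0 (f : M -> R) q : 0 <= gradnorm g f q.
Proof. exact: sqrtr_ge0. Qed.

(** A zero of the nonnegative function [F] is a minimum, so all partial derivatives vanish there.
    Thus the energy is confined to the slab, where the weights are nonzero. *)
Lemma gradnorm_tfun0 q : Om q -> F (phi i q) = 0 -> gradnorm g tfun q = 0.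
Proof.
move=> qO Fq; have x0 := Om_gt0 qO; have dF := bump_differentiable x0.
have Fmin : \forall y \near phi i q, F (phi i q) <= F y.
  by near=> y; rewrite Fq; have /andP[] := bump_itv xq al d T s' s y.
apply/eqP; rewrite eq_le gradnorm_ge0 andbT; apply: le_trans (gradnorm_tfun qO) _.
rewrite derive_eq0_min// normr0 mulr0 add0r big1 ?mulr0// => j _.
by rewrite derive_eq0_min// normr0.
Unshelve. all: by end_near. Qed.

Lemma tangential_le (x : 'rV[R]_n.+1) : \sum_(j < n) `|'D_(e (lift 0 j)) F x| <= n%:R * Cchi *
  x 0 0 `^ al.
Proof.
apply: le_trans (_ : \sum_(j < n) Cchi * x 0 0 `^ al <= _).
  by apply: ler_sum => j _; exact: derive_bump_lift_le.
by rewrite sumr_const card_ord -mulrA mulr_natl.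
Qed.

Lemma powR_pred (t b : R) : 0 < t -> t * t `^ (b - 1) = t `^ b.
Proof.
by move=> t0; rewrite -{1}[t]powRr1 ?ltW// -powRD ?subrKC// (gt_eqF t0) implybT.
Qed.

Lemma gradnorm_mid q : Om q -> d <= phi i q 0 0 <= T ->
  gradnorm g tfun q <= mc * phi i q 0 0 `^ al.
Proof.
move=> qO xdT; have x0 := Om_gt0 qO; apply: le_trans (gradnorm_tfun qO) _.
set x := phi i q in xdT x0 *; have /andP[dx xT] := xdT.
have b0 : `|'D_(e 0) F x| <= al * x 0 0 `^ (al - 1).
  by apply: derive_bump0_mid => //; exact: ltW.
have b1 := tangential_le x.
have P0 : 0 <= x 0 0 `^ al by exact: powR_ge0.
have h0 : x 0 0 * ((1 + eps) * `|'D_(e 0) F x|) <= (1 + eps) * al * x 0 0 `^ al.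
  rewrite -(powR_pred al x0) mulrCA -mulrA ler_wpM2l//; first by lra_params.
  by rewrite mulrCA ler_wpM2l// ltW.
(* The lateral cut-offs are absorbed here: [x_0 <= T] and [Teps] bound their contribution by
   [eps]. *)
have h1 : x 0 0 * (K * \sum_(j < n) `|'D_(e (lift 0 j)) F x|) <= eps * x 0 0 `^ al.
  apply: (@le_trans _ _ ((K * n%:R * Cchi * T) * x 0 0 `^ al)); last by rewrite ler_wpM2r.
  have -> : K * n%:R * Cchi * T * x 0 0 `^ al = T * (K * (n%:R * Cchi * x 0 0 `^ al)) by ring.
  apply: ler_pM => //; rewrite ?mulr_ge0 ?sumr_ge0//; try lra_params.
  by rewrite ler_wpM2l//; lra_params.
by rewrite mulrDr /mc [leRHS]mulrDl; exact: lerD.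
Qed.

Lemma gradnorm_le q : Om q -> gradnorm g tfun q <= C2 * phi i q 0 0 `^ al.
Proof.
move=> qO; have x0 := Om_gt0 qO; apply: le_trans (gradnorm_tfun qO) _.
set x := phi i q in x0 *.
have [_ /andP[_ xT]] : (forall a, `|x 0 a - xq 0 a| < rho) /\ d / 4 <= x 0 0 <= 3 * T.
  by case: qO => _ /(ell_box l0 k0)/box_good.
have b0 : `|'D_(e 0) F x| <= (al + 4 * dstep_bound) * x 0 0 `^ (al - 1).
  by apply: derive_bump0_le => //; exact: ltW.
have b1 := tangential_le x.
have P0 : 0 <= x 0 0 `^ al by exact: powR_ge0.
have D0 := @dstep_bound_ge0 R.
have h0 : x 0 0 * ((1 + eps) * `|'D_(e 0) F x|) <= 2 * (al + 4 * dstep_bound) * x 0 0 `^ al.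
  rewrite -(powR_pred al x0) mulrCA -mulrA; apply: ler_pM; rewrite ?mulr_ge0//; try lra_params.
  by rewrite mulrCA ler_wpM2l// ltW.
have h1 : x 0 0 * (K * \sum_(j < n) `|'D_(e (lift 0 j)) F x|) <= 3 * x 0 0 `^ al.
  apply: (@le_trans _ _ ((3 * (K * n%:R * Cchi * T)) * x 0 0 `^ al)).
    have -> : 3 * (K * n%:R * Cchi * T) * x 0 0 `^ al =
      (3 * T) * (K * (n%:R * Cchi * x 0 0 `^ al)) by ring.
    apply: ler_pM => //; rewrite ?mulr_ge0 ?sumr_ge0//; try lra_params.
    by rewrite ler_wpM2l//; lra_params.
  by rewrite ler_wpM2r//; move: Teps; set Z := K * _ * _ * T; lra_params.
by rewrite mulrDr /C2 [leRHS]mulrDl; exact: lerD.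
Qed.

Let al_p : al * p = n%:R. Proof. by rewrite /al divfK// gt_eqF. Qed.

Lemma powR_bound (C t y : R) : 0 <= C -> 0 <= y -> 0 <= t -> y <= C * t `^ al ->
  y `^ p <= C `^ p * t ^+ n.
Proof.
move=> C0 y0 t0 yC; apply: le_trans (_ : (C * t `^ al) `^ p <= _).
  by rewrite ge0_ler_powR ?nnegrE ?mulr_ge0 ?powR_ge0// ltW.
by rewrite powRM ?powR_ge0// -powRrM al_p powR_mulrn.
Qed.

Let C20 : 0 <= C2.
Proof. by have := @dstep_bound_ge0 R; rewrite /C2; lra_params. Qed.

Let mc0 : 0 <= mc.
Proof. by rewrite /mc; apply: addr_ge0; [apply: mulr_ge0 => //|]; lra_params. Qed.

Let wt := slab_weight i xq.

Let wt_in a b u q : dom i q -> in_slab xq a b u (phi i q) -> wt a b u q = (phi i q 0 0 ^+ n)%:E.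
Proof. by move=> iq qs; rewrite /wt /slab_weight mem_set. Qed.

Let wt0 a b u q : 0 <= a -> (0 <= wt a b u q)%E. Proof. exact: slab_weight_ge0. Qed.

(** The sharp constant is needed only for [d <= x_0 <= T], but its weight is spread over the whole
    slab: this covers the end points missed by the open slab from [d] to [T] and costs only [ln 4]
    after integration. *)
Lemma energy_pointwise q : Om q -> ((gradnorm g tfun q `^ p)%:E <=
  (mc `^ p)%:E * wt (d / 2) (2 * T) s q +
  ((C2 `^ p)%:E * wt (d / 2) d s q + (C2 `^ p)%:E * wt T (2 * T) s q))%E.
Proof.
move=> qO; have d20 : 0 <= d / 2 by lra_params.
have term0 C a b u : 0 <= a -> (0 <= (C `^ p)%:E * wt a b u q)%E.
  by move=> a0; rewrite mule_ge0 ?wt0// lee_fin powR_ge0.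
have [F0|F0] := eqVneq (F (phi i q)) 0.
  rewrite gradnorm_tfun0// powR0 ?gt_eqF//.
  by rewrite adde_ge0 ?adde_ge0// ?term0 ?(ltW T0).
have [iq _] := qO; have x0 := Om_gt0 qO.
have qs := in_slab_bump F0; have /andP[/andP[xd xT] xs] := qs.
have [dx|xd'] := leP d (phi i q 0 0); last first.
  apply: le_trans (_ : ((C2 `^ p)%:E * wt (d / 2) d s q <= _)%E); last first.
    by rewrite addeCA leeDl// adde_ge0// term0// ltW.
  rewrite (wt_in iq) /in_slab ?xd ?xd'//=.
  by rewrite lee_fin; apply: powR_bound; rewrite ?gradnorm_ge0 ?(ltW x0)//; exact: gradnorm_le.
have [xT'|xT'] := leP (phi i q 0 0) T; last first.
  apply: le_trans (_ : ((C2 `^ p)%:E * wt T (2 * T) s q <= _)%E); last first.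
    by rewrite addeA leeDr// adde_ge0// term0.
  rewrite (wt_in iq) /in_slab ?xT ?xT'//=.
  by rewrite lee_fin; apply: powR_bound; rewrite ?gradnorm_ge0 ?(ltW x0)//; exact: gradnorm_le.
apply: le_trans (_ : ((mc `^ p)%:E * wt (d / 2) (2 * T) s q <= _)%E); last first.
  by rewrite leeDl// adde_ge0// term0// ltW.
rewrite (wt_in iq)// lee_fin; apply: powR_bound; rewrite ?gradnorm_ge0 ?(ltW x0)//.
by apply: gradnorm_mid => //; rewrite dx.
Qed.

Let good' (x : 'rV[R]_n.+1) : (forall a, `|x 0 a - xq 0 a| < rho) -> 0 < x 0 0 ->
  (phi i @` dom i) x /\
  (1 - eps) * w0 <= x 0 0 ^+ n.+1 * Num.sqrt (\det (g i x)) <= (1 + eps) * w0.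
Proof. by move=> xr x0; have [] := good xr x0. Qed.

Let in_slab_Om a b u (x : 'rV[R]_n.+1) : d / 2 <= a -> b <= 2 * T -> u <= s ->
  in_slab xq a b u x -> superell m l k x < 1.
Proof.
move=> da bT us /andP[/andP[ax xb] /forallP xs]; apply: kc => c'.
case: (unliftP 0 c') => [j ->|->]; rewrite !mxE /=; first exact: le_trans (ltW (xs j)) us.
by rewrite ler_distl; apply/andP; split; lra_params.
Qed.

Lemma slab_integral a b u : d / 2 <= a -> a < b -> b <= 2 * T -> 0 < u -> u <= s ->
  (((1 - eps) * w0 * (2 * u) ^+ n * ln (b / a))%:E
    <= \int[vol]_(q in (Om : set (borel M))) wt a b u q
    <= ((1 + eps) * w0 * (2 * u) ^+ n * ln (b / a))%:E)%E.
Proof.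
move=> da ab bT u0 us; rewrite /wt integral_slab_weight.
- apply: (slab_volume hvol rdef xq0 (ltW w00) eps01 good') => //; try lra_params.
  by apply: le_trans us _; rewrite /s; lra_params.
- by move=> q [iq qs]; split => //; exact: (in_slab_Om da bT us qs).
- by move=> q qO; split; [case: qO|exact: OmI].
Qed.

Let W := (1 + eps) * w0 * (2 * s) ^+ n.

Let W0 : 0 < W.
Proof. by rewrite !mulr_gt0 ?exprn_gt0 ?mulr_gt0//; lra_params. Qed.

Let mwt a b u : measurable_fun (Om : set (borel M)) (wt a b u).
Proof. by apply: measurable_funTS; exact: measurable_slab_weight. Qed.

Let mOm : measurable (Om : set (borel M)).
Proof. exact: sub_sigma_algebra. Qed.

Let d2 : 0 < d / 2. Proof. by lra_params. Qed.

Let ln_all : ln (2 * T / (d / 2)) = ln 4 + ln (T / d).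
Proof.
rewrite -lnM ?posrE ?divr_gt0//; congr ln.
by field; rewrite gt_eqF.
Qed.

(** The whole slab contributes [ln (4 T / d) = ln 4 + ln (T / d)], each of the two cut-off slabs
    [ln 2]; only [ln (T / d)] grows as [d -> 0]. *)
Lemma energy_le : (p_energy g vol p Om tfun <=
  (W * (mc `^ p * (ln 4 + ln (T / d)) + 2 * (C2 `^ p * ln 2)))%:E)%E.
Proof.
apply: (@le_trans _ _ (\int[vol]_(q in (Om : set (borel M)))
   ((mc `^ p)%:E * wt (d / 2) (2 * T) s q +
  ((C2 `^ p)%:E * wt (d / 2) d s q + (C2 `^ p)%:E * wt T (2 * T) s q)))%E).
  by apply: ge0_le_integral_nomeas => q qO; [rewrite lee_fin powR_ge0|exact: energy_pointwise].
have term0 C a b u q : 0 <= a -> (0 <= (C `^ p)%:E * wt a b u q)%E.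
  by move=> a0; rewrite mule_ge0 ?wt0// lee_fin powR_ge0.
have mterm C a b u : measurable_fun (Om : set (borel M)) (fun q => (C%:E * wt a b u q)%E).
  by apply: measurable_funeM; exact: mwt.
have d20 := ltW d2; have T0' := ltW T0.
rewrite ge0_integralD//; [|by move=> q _; exact: term0|by move=> q _; rewrite adde_ge0// term0
  |by apply: emeasurable_funD].
rewrite ge0_integralD//; [|by move=> q _; exact: term0|by move=> q _; exact: term0].
rewrite !ge0_integralZl_EFin ?powR_ge0//; try by move=> q _; exact: wt0.
have bound a b : d / 2 <= a -> a < b -> b <= 2 * T ->
    (\int[vol]_(q in (Om : set (borel M))) wt a b s q <= (W * ln (b / a))%:E)%E.
  by move=> h1 h2 h3; have /andP[] := slab_integral h1 h2 h3 s0 (lexx s).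
have b1 := bound (d / 2) (2 * T) (lexx _); have b2 := bound (d / 2) d (lexx _).
have b3 := bound T (2 * T).
have {}b1 := b1 _ (lexx _); have {}b3 := b3 _ _ (lexx _).
have e2 : d / (d / 2) = 2 by field; rewrite gt_eqF.
have e3 : 2 * T / T = 2 by rewrite mulfK// gt_eqF.
rewrite e2 in b2; rewrite e3 in b3; rewrite ln_all in b1.
have -> : W * (mc `^ p * (ln 4 + ln (T / d)) + 2 * (C2 `^ p * ln 2)) =
  mc `^ p * (W * (ln 4 + ln (T / d))) + (C2 `^ p * (W * ln 2) + C2 `^ p * (W * ln 2)) by ring.
rewrite !EFinD !EFinM; apply: leeD; last apply: leeD.
- by apply: lee_wpmul2l; [rewrite lee_fin powR_ge0|rewrite -EFinM; apply: b1; lra_params].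
- by apply: lee_wpmul2l; [rewrite lee_fin powR_ge0|rewrite -EFinM; apply: b2; lra_params].
- by apply: lee_wpmul2l; [rewrite lee_fin powR_ge0|rewrite -EFinM; apply: b3; lra_params].
Qed.

(** Provides the finiteness of the denominator: [lambda1_domain] asks for real limits. *)
Lemma Lp_le : (Lp_integral vol p Om tfun <= (W * (ln 4 + ln (T / d)))%:E)%E.
Proof.
rewrite -ln_all; apply: (@le_trans _ _ (\int[vol]_(q in (Om :
  set (borel M))) wt (d / 2) (2 * T) s q)%E).
  apply: ge0_le_integral_nomeas => q qO; first by rewrite lee_fin powR_ge0.
  have [F0|F0] := eqVneq (F (phi i q)) 0.
    by rewrite /tfun mem_set// F0 normr0 powR0 ?gt_eqF// wt0// ltW.
  have [iq _] := qO; have x0 := Om_gt0 qO.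
  rewrite (wt_in iq (in_slab_bump F0)) lee_fin.
  have -> : phi i q 0 0 ^+ n = 1 `^ p * phi i q 0 0 ^+ n by rewrite powR1 mul1r.
  have /andP[f0 f1] := bump_itv xq al d T s' s (phi i q).
  by apply: powR_bound; rewrite ?(ltW x0)// mul1r /tfun mem_set// ger0_norm.
have h1 : d / 2 < 2 * T by lra_params.
by have /andP[] := slab_integral (lexx _) h1 (lexx _) s0 (lexx s).
Qed.

(** On the slab from [d] to [T] of lateral width [s'] no cut-off acts, and [|f|^p] is exactly the
    weight [x_0^n]. *)
Lemma Lp_ge : (((1 - eps) * w0 * (2 * s') ^+ n * ln (T / d))%:E <= Lp_integral vol p Om tfun)%E.
Proof.
have h1 : d / 2 <= d by lra_params.
have h2 : T <= 2 * T by lra_params.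
have /andP[+ _] := slab_integral h1 dT h2 s'0 (ltW s's); move=> /le_trans; apply.
apply: ge0_le_integral_nomeas => q qO; first by apply: wt0; exact: ltW.
have [iq _] := qO; have x0 := Om_gt0 qO.
have [qs|qs] := boolP (in_slab xq d T s' (phi i q)); last first.
  rewrite /wt /slab_weight memNset ?lee_fin ?powR_ge0// => -[_]; exact/negP.
rewrite (wt_in iq qs) lee_fin /tfun mem_set//.
have /andP[/andP[xd xT] /forallP xs] := qs.
rewrite /F bump_mid//; last 3 first.
- exact: ltW.
- by rewrite (ltW xd) (ltW xT).
- by move=> j; exact: ltW.
by rewrite ger0_norm ?powR_ge0// -powRrM al_p powR_mulrn// ltW.
Qed.

Lemma gradnorm_zero q : gradnorm g (fun=> 0) q = 0.
Proof.
have dz : dcoord (chart_at q) (fun=> 0 : R) q = 0.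
  rewrite dcoordE; last exact: (@differentiable_cst _ _ _ (0 : R)).
  by apply/rowP => a; rewrite mxE [RHS]mxE; exact: (@derive_cst _ _ _ (0 : R)).
by rewrite /gradnorm /gradient dz /vnorm !mul0mx mxE sqrtr0.
Qed.

Lemma lambda1_le_quotient : (lambda1 g vol p <=
  ((W * (mc `^ p * (ln 4 + ln (T / d)) + 2 * (C2 `^ p * ln 2))) /
   ((1 - eps) * w0 * (2 * s') ^+ n * ln (T / d)))%:E)%E.
Proof.
set U := W * _; set L := (1 - eps) * _ * _ * _.
have L0 : 0 < L.
  rewrite mulr_gt0 ?ln_gt0 ?ltr_pdivlMr ?mul1r//.
  by rewrite !mulr_gt0 ?exprn_gt0 ?mulr_gt0//; lra_params.
have E0 : (0 <= p_energy g vol p Om tfun)%E.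
  by apply: integral_ge0 => q _; rewrite lee_fin powR_ge0.
have EU : (p_energy g vol p Om tfun <= U%:E)%E := energy_le.
have LL : (L%:E <= Lp_integral vol p Om tfun)%E := Lp_ge.
have LU := Lp_le.
have Efin : p_energy g vol p Om tfun \is a fin_num.
  by rewrite ge0_fin_numE//; apply: le_lt_trans EU _; exact: ltry.
have Lfin : Lp_integral vol p Om tfun \is a fin_num.
  rewrite ge0_fin_numE; first by apply: le_lt_trans LU _; exact: ltry.
  by apply: le_trans LL; rewrite lee_fin ltW.
have B0 : 0 < fine (Lp_integral vol p Om tfun).
  by rewrite (lt_le_trans L0)// -lee_fin fineK.
apply: le_trans (fine_ratio_le L0 E0 EU LL Lfin).
apply: (@le_trans _ _ (lambda1_domain g vol p Om)).
  by apply: ereal_inf_lbound; exists Om => //; exact: Om_domain.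
(* The element of the completion is represented by a constant sequence, Cauchy because its
   differences vanish. *)
apply: ereal_inf_lbound; exists (fun=> tfun), (fine (p_energy g vol p Om tfun)),
  (fine (Lp_integral vol p Om tfun)).
split; last by [].
- split; first by move=> _; exact: tfun_test.
  move=> ee ee0; exists 0%N => _ _ _ _.
  have -> : (tfun \- tfun)%R = fun=> 0 by apply/funext => q /=; rewrite subrr.
  rewrite /Lp_integral /p_energy integral0_eq ?integral0_eq ?adde0 ?lte_fin// => q _.
    by rewrite gradnorm_zero powR0 ?gt_eqF.
  by rewrite normr0 powR0 ?gt_eqF.
- by rewrite (fineK Efin); exact: cvg_cst.
- by rewrite (fineK Lfin); exact: cvg_cst.
- by rewrite gt_eqF.
Qed.

End TestFunction.

(** * The upper bound *)

Lemma lee_limit_inv (R : realType) (x : \bar R) (a b : R) :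
  (forall L : R, 0 < L -> (x <= (a + b / L)%:E)%E) -> (x <= a%:E)%E.
Proof.
(* The choice [L = (|b| + 1) / e] makes [b / L <= e]. *)
move=> H; apply/lee_addgt0Pr => e e0; have b1 : 0 < (`|b| + 1) / e by rewrite divr_gt0 ?ltr_wpDl.
apply: le_trans (H _ b1) _; rewrite -EFinD lee_fin lerD2l invf_div mulrA ler_pdivrMr ?ltr_wpDl//.
by rewrite mulrC ler_wpM2l ?(ltW e0)//; have := ler_norm b; lra.
Qed.

Lemma lee_limit_right (R : realType) (x : \bar R) (G : R -> R) (v : R) :
  (forall t : R, 0 < t < 1 -> (x <= (G t)%:E)%E) -> G t @[t --> 0^'+] --> v -> (x <= v%:E)%E.
Proof.
move=> xG Gv; case: x xG => [y||] xG.
- rewrite lee_fin -(cvg_lim _ Gv)//; apply: limr_ge; first by apply: cvgP Gv.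
  near=> t; have /= := xG t; rewrite lee_fin; apply.
  by apply/andP; split; [near: t; exact: nbhs_right_gt|near: t; exact: nbhs_right_lt].
- have h : 0 < (2^-1 : R) < 1 by apply/andP; split; lra.
  by have := xG _ h; rewrite leye_eq.
- by rewrite leNye.
Unshelve. all: by end_near. Qed.

(** The value [a = 0] occurs for [n = 0]; there the right limit of the power at 0 is used, and
    positivity of [h] places its values on that side. *)
Lemma cvg_powR_right (R : realType) (h : R -> R) (a p : R) : 0 < p -> 0 <= a ->
  (forall t, 0 < t -> 0 < h t) -> h t @[t --> 0^'+] --> a ->
  h t `^ p @[t --> 0^'+] --> a `^ p.
Proof.
move=> p0 a0 h0 ha; have [aE|aN0] := eqVneq a 0.
  rewrite aE powR0 ?gt_eqF//; rewrite aE in ha.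
  apply: (@cvg_comp _ _ _ h (fun u => u `^ p) _ (0^'+)); last exact: powR_cvg0.
  move=> A A0; have n1 : \forall u \near (0 : R), 0 < u -> A u by exact: A0.
  have n2 := ha _ n1; suff : \forall t \near (0 : R)^'+, A (h t) by [].
  have {}n2 : \forall t \near (0 : R)^'+, 0 < h t -> A (h t) by exact: n2.
  near=> t.
  have t0 : 0 < t by near: t; exact: nbhs_right_gt.
  by have := h0 t t0; near: t.
have a0' : 0 < a by rewrite lt_def aN0.
apply: (@cvg_comp _ _ _ h (fun u => u `^ p)); first exact: ha.
suff : {for a, continuous (fun u : R => u `^ p)} by [].
apply: differentiable_continuous; apply/derivable1_diffP.
by have [] := is_derive1_powR p a0'.
Unshelve. all: by end_near. Qed.

Theorem theorem1p2 (R : realType) (n : nat) (M : bmanifold R n) (theta : R)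
    (htheta : 0 < theta < 1) (g : tensor2 M)
    (hAH : asymptotically_hyperbolic theta g)
    (vol : {measure set (borel M) -> \bar R}) (hvol : riemannian_volume g vol)
    (p : R) (hp : 1 < p) :
  (lambda1 g vol p <= ((n%:R / p) `^ p)%:E)%E.
Proof.
have [[_ [q qb] gR _ [r [gbar comp]]] AH] := hAH.
have [i [iq q0]] := qb; have AHq := AH r gbar comp i q qb iq.
have rdef : defining_function r by case: comp.
have w00 := density_gt0 comp iq q0 AHq; set w0 := _ / _ in w00.
have p0 : 0 < p := lt_trans ltr01 hp.
have al0 : 0 <= n%:R / p by rewrite divr_ge0// ltW.
pose mc (eps : R) := (1 + eps) * (n%:R / p) + eps.
(* The limit of the bound as [d -> 0]: [1 + eps] and one factor [1 - eps] come from the density, the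
   other [n] factors [1 - eps] from [s' / s]. *)
apply: (lee_limit_right (G := fun eps => (1 + eps) / (1 - eps) ^+ n.+1 * mc eps `^ p)).
  move=> eps eps01; have /andP[eps0 eps1] := eps01.
  have [K [rho [rho0 K1 good]]] := near_boundary_geometry comp iq q0 AHq eps01.
  set s := rho / 4; set s' := (1 - eps) * s; set Cchi := 2 * dstep_bound / (s - s').
  have s0 : 0 < s by rewrite divr_gt0.
  have ss' : 0 < s - s' by rewrite /s' subr_gt0 gtr_pMl//; lra.
  have Z0 : 0 <= K * n%:R * Cchi.
    by rewrite !mulr_ge0 ?invr_ge0 ?dstep_bound_ge0 ?(ltW ss')//; lra.
  (* The first term keeps the domain where the geometry is controlled, the second gives [Teps]; the
     [+ 1] keeps the denominator positive, also for [n = 0]. *)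
  pose T := Num.min (rho / 8) (eps / (K * n%:R * Cchi + 1)).
  have Z1 : 0 < K * n%:R * Cchi + 1 by rewrite ltr_wpDl.
  have T0 : 0 < T by rewrite lt_min !divr_gt0.
  have Trho : T <= rho / 8 by rewrite ge_min lexx.
  have Teps : K * n%:R * Cchi * T <= eps.
    apply: le_trans (_ : K * n%:R * Cchi * (eps / (K * n%:R * Cchi + 1)) <= _).
      by rewrite ler_wpM2l// ge_min lexx orbT.
    by rewrite mulrA ler_pdivrMr// mulrC ler_wpM2l ?(ltW eps0)// lerDl.
  pose C2 := 2 * (n%:R / p + 4 * dstep_bound) + 3 : R.
  pose A := (1 + eps) / (1 - eps) ^+ n.+1.
  (* With [eps] and [T] fixed, the bound is exactly [a + b / L] for [L = ln (T / d)], so [d] is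
     taken as [T exp(-L)] and [L] is arbitrary. *)
  apply: (@lee_limit_inv _ _ _ (A * (mc eps `^ p * ln 4 + 2 * (C2 `^ p * ln 2)))) => L L0.
  pose d := T * expR (- L).
  have d0 : 0 < d by rewrite mulr_gt0 ?expR_gt0.
  have dT : d < T by rewrite gtr_pMr// expR_lt1 oppr_lt0.
  have TdE : ln (T / d) = L.
    by rewrite /d invfM mulrA mulfV ?gt_eqF// mul1r expRN invrK expRK.
  have [k k0 kc] := exponent_exists (cmap (mchart i) q) rho0 d0 dT.
  have := lambda1_le_quotient gR hvol rdef q0 w00 eps01 K1 rho0 hp good d0 dT Trho Teps k0 kc.
  rewrite -/s -/s' -/(mc eps) -/C2 TdE; move=> /le_trans; apply.
  rewrite lee_fin le_eqVlt; apply/orP; left; apply/eqP.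
  rewrite /A /s' exprS.
  have s2 : (2 * s) ^+ n != 0 by rewrite expf_neq0// mulf_neq0 ?gt_eqF.
  have -> : (2 * ((1 - eps) * s)) ^+ n = (1 - eps) ^+ n * (2 * s) ^+ n.
    by rewrite -exprMn; congr (_ ^+ _); ring.
  have e1 : (1 - eps) ^+ n != 0 by rewrite expf_neq0// subr_eq0 gt_eqF.
  field; rewrite s2 e1 !gt_eqF//=; lra.
have c0 : (1 + eps) / (1 - eps) ^+ n.+1 * mc eps `^ p @[eps --> (0 : R)^'+] -->
    (1 + 0) / (1 - 0) ^+ n.+1 * (n%:R / p) `^ p.
  have id0 : (fun t : R => t) @ (0 : R)^'+ --> (0 : R).
    by apply: cvg_at_right_filter; exact: cvg_id.
  have p10 : 1 + t @[t --> (0 : R)^'+] --> (1 + 0 : R) by apply: cvgD => //; exact: cvg_cst.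
  apply: cvgM.
    apply: cvgM => //; apply: cvgV; first by rewrite subr0 expr1n oner_neq0.
    apply: (@cvg_comp _ _ _ (fun t : R => 1 - t) (fun u => u ^+ n.+1));
      last exact: exprn_continuous.
    by apply: cvgB => //; exact: cvg_cst.
  apply: cvg_powR_right => // [t t0|].
    by rewrite ltr_wpDl// mulr_ge0//; lra.
  have -> : n%:R / p = (1 + 0) * (n%:R / p) + 0 by rewrite !addr0 mul1r.
  by apply: cvgD => //; apply: cvgM; [exact: p10|exact: cvg_cst].
by rewrite addr0 subr0 expr1n divr1 mul1r in c0.
Qed.
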